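(* Let $\phi=\tilde p/p$ be a rational inner function on $\mathbb{D}^2$ (as in the context) and let $i\in\{1,2\}$. Then for $1\le \mathfrak{p}<\infty$, $\frac{\partial\phi}{\partial z_i}\in H^{\mathfrak p}(\mathbb{D}^2)$ if and only if the $z_i$-contact order $K_i$ of $\phi$ satisfies $K_i<\frac{1}{\mathfrak p-1}$ (interpreted as $K_i<\infty$, i.e. always true, when $\mathfrak p=1$).
   Context: $\mathbb{D}^2$ is the open unit bidisk and $\mathbb{T}^2=(\partial\mathbb{D})^2$. A rational inner function of the form considered is $\phi=\tilde p/p$, where $p\in\mathbb{C}[z_1,z_2]$ has bidegree $(m,n)$, has no zeros in $\mathbb{D}^2$, is atoral (so it has finitely many zeros on $\mathbb{T}^2$, and $p,\tilde p$ have no common factor), and $\tilde p(z_1,z_2)=z_1^mz_2^n\overline{p(1/\bar z_1,1/\bar z_2)}$. Such $p$ has no zeros in $(\mathbb{D}\times\mathbb{T})\cup(\mathbb{T}\times\mathbb{D})$. A singularity of $\phi$ is a zero of $p$ on $\mathbb{T}^2$. For $0<\mathfrak p<\infty$, $H^{\mathfrak p}(\mathbb{D}^2)$ is the space of holomorphic $f$ on $\mathbb{D}^2$ with $\|f\|^{\mathfrak p}_{H^{\mathfrak p}}=\sup_{0<r<1}\frac{1}{4\pi^2}\int_{\mathbb{T}^2}|f(r\zeta)|^{\mathfrak p}|d\zeta|<\infty$. Contact order: for $\zeta_2\in\mathbb{T}$ which is not the $z_2$-coordinate of a singularity of $\phi$, set $\epsilon(\phi,\zeta_2)=\min\{1-|z_1|:\tilde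 p(z_1,\zeta_2)=0\}$ (the distance from the zeros of the degree-$m$ Blaschke product $\phi(\cdot,\zeta_2)$ to $\mathbb{T}$); set $\epsilon(\phi,\zeta_2)=0$ otherwise. For each $z_2$-coordinate $\tau_2$ of a singularity of $\phi$ there is a rational number $K>0$ (the $(z_1,\tau_2)$-contact order) such that $\epsilon(\phi,\zeta_2)\approx|\tau_2-\zeta_2|^K$ for $\zeta_2\in\mathbb{T}$ in a neighborhood of $\tau_2$ (here $A\approx B$ means $cB\le A\le CB$ for positive constants). The $z_1$-contact order $K_1$ of $\phi$ is the maximum of the $(z_1,\tau_2)$-contact orders over the finitely many such $\tau_2$, and $K_1=0$ if $\phi$ has no singularities. The $z_2$-contact order $K_2$ is defined analogously with the roles of the variables interchanged. *)

(* Defs.v *)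
From Stdlib Require Import Reals.
Open Scope R_scope.

Definition Cx := (R * R)%type.
Definition RtoC (x : R) : Cx := (x, 0).
Definition C0 : Cx := (0, 0).
Definition C1 : Cx := (1, 0).
Definition Cadd (z w : Cx) : Cx := (fst z + fst w, snd z + snd w).
Definition Copp (z : Cx) : Cx := (- fst z, - snd z).
Definition Csub (z w : Cx) : Cx := Cadd z (Copp w).
Definition Cmul (z w : Cx) : Cx :=
  (fst z * fst w - snd z * snd w, fst z * snd w + snd z * fst w).
Definition Cconj (z : Cx) : Cx := (fst z, - snd z).
Definition Cmod (z : Cx) : R := sqrt (fst z * fst z + snd z * snd z).
Definition Cinv (z : Cx) : Cx :=
  let d := fst z * fst z + snd z * snd z in (fst z / d, - snd z / d).
Definition Cdiv (z w : Cx) : Cx := Cmul z (Cinv w).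
Fixpoint Cpow (z : Cx) (k : nat) : Cx :=
  match k with O => C1 | S k' => Cmul z (Cpow z k') end.
Definition Cscale (r : R) (z : Cx) : Cx := (r * fst z, r * snd z).
Definition Cexpi (t : R) : Cx := (cos t, sin t).

Fixpoint csum (f : nat -> Cx) (n : nat) : Cx :=
  match n with O => f O | S n' => Cadd (csum f n') (f n) end.

(* ---------- Polynomials in two variables ----------
   A polynomial of bidegree at most (m,n) is given by its coefficient
   array a : nat -> nat -> Cx, only the entries a i j with i<=m, j<=n being used:
   p(z1,z2) = sum_{i<=m, j<=n} a i j z1^i z2^j. *)
Definition peval (a : nat -> nat -> Cx) (m n : nat) (z1 z2 : Cx) : Cx :=
  csum (fun i => csum (fun j => Cmul (a i j) (Cmul (Cpow z1 i) (Cpow z2 j))) n) m.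

Definition exact_bidegree (a : nat -> nat -> Cx) (m n : nat) : Prop :=
  (exists j, (j <= n)%nat /\ a m j <> C0) /\ (exists i, (i <= m)%nat /\ a i n <> C0).

(* reflection  p~(z) = z1^m z2^n conj(p(1/conj z1, 1/conj z2)),
   in coefficients: p~_{ij} = conj(p_{m-i, n-j}) *)
Definition refl_coef (a : nat -> nat -> Cx) (m n : nat) : nat -> nat -> Cx :=
  fun i j => Cconj (a (m - i)%nat (n - j)%nat).

Definition pdivides (q : nat -> nat -> Cx) (qm qn : nat) (f : Cx -> Cx -> Cx) : Prop :=
  exists (r : nat -> nat -> Cx) (rm rn : nat),
    forall z1 z2, f z1 z2 = Cmul (peval q qm qn z1 z2) (peval r rm rn z1 z2).

Definition nonconstant (q : nat -> nat -> Cx) (qm qn : nat) : Prop :=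
  exists i j, (i <= qm)%nat /\ (j <= qn)%nat /\ (i <> O \/ j <> O) /\ q i j <> C0.

Definition atoral (a : nat -> nat -> Cx) (m n : nat) : Prop :=
  ~ (exists q qm qn, nonconstant q qm qn /\
        pdivides q qm qn (peval a m n) /\
        pdivides q qm qn (peval (refl_coef a m n) m n)).

Definition phi (a : nat -> nat -> Cx) (m n : nat) (z1 z2 : Cx) : Cx :=
  Cdiv (peval (refl_coef a m n) m n z1 z2) (peval a m n z1 z2).

Definition is_partial (i : nat) (f : Cx -> Cx -> Cx) (z1 z2 L : Cx) : Prop :=
  forall eps, 0 < eps -> exists delta, 0 < delta /\
    forall h, 0 < Cmod h < delta ->
      Cmod (Csub (Cdiv (Csub (if Nat.eqb i 1 then f (Cadd z1 h) z2 else f z1 (Cadd z2 h))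
                             (f z1 z2)) h) L) < eps.

(* x^P for x >= 0, with 0^P = 0 (P > 0) *)
Definition rpow (x P : R) : R := if Rle_dec x 0 then 0 else Rpower x P.

Definition Int2 (g : R -> R -> R) (I : R) : Prop :=
  exists h : R -> R,
    (forall s, exists pr : Riemann_integrable (g s) 0 (2 * PI), RiemannInt pr = h s) /\
    (exists pr : Riemann_integrable h 0 (2 * PI), RiemannInt pr = I).

Definition in_Hardy (P : R) (f : Cx -> Cx -> Cx) : Prop :=
  exists M, forall r, 0 < r < 1 -> exists I,
    Int2 (fun s t => rpow (Cmod (f (Cscale r (Cexpi s)) (Cscale r (Cexpi t)))) P) I /\
    I / (4 * PI ^ 2) <= M.

Definition eval_i (i : nat) (g : Cx -> Cx -> Cx) (w zeta : Cx) : Cx :=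
  if Nat.eqb i 1 then g w zeta else g zeta w.

Definition is_eps (a : nat -> nat -> Cx) (m n i : nat) (zeta : Cx) (e : R) : Prop :=
  (exists w, eval_i i (peval (refl_coef a m n) m n) w zeta = C0 /\ e = 1 - Cmod w) /\
  (forall w, eval_i i (peval (refl_coef a m n) m n) w zeta = C0 -> e <= 1 - Cmod w).

Definition contact_order_at (a : nat -> nat -> Cx) (m n i : nat) (tau : Cx) (K : R) : Prop :=
  exists c Cc delta, 0 < c /\ 0 < Cc /\ 0 < delta /\
    forall zeta, Cmod zeta = 1 -> 0 < Cmod (Csub tau zeta) < delta ->
      exists e, is_eps a m n i zeta e /\
        c * rpow (Cmod (Csub tau zeta)) K <= e /\ e <= Cc * rpow (Cmod (Csub tau zeta)) K.

Definition sing_coord (a : nat -> nat -> Cx) (m n i : nat) (tau : Cx) : Prop :=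
  Cmod tau = 1 /\ exists w, Cmod w = 1 /\ eval_i i (peval a m n) w tau = C0.

(* K_i < 1/(P-1)  (always true for P = 1): every (z_i,tau)-contact order K
   satisfies K (P-1) < 1; K_i = 0 if there are no singularities. *)
Definition contact_cond (a : nat -> nat -> Cx) (m n i : nat) (P : R) : Prop :=
  forall tau, sing_coord a m n i tau ->
    exists K, contact_order_at a m n i tau K /\ K * (P - 1) < 1.

(* Main.v *)
(** A slice phi(., zeta) at a point zeta of the circle is a finite Blaschke product whose
    derivative has modulus sum_j (1 - |x_j|^2) / |w - x_j|^2 at w, where the x_j are the zeros
    of the slice.  Hence the p-th power of the derivative has integral comparable to
    eps(zeta)^(1 - p), where eps = min (1 - |x_j|), and this is integrable in zeta near a
    singular coordinate exactly when K (p - 1) < 1.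

    The contact order exists because eps is comparable to the smallest modulus among the
    numbers 1 - x_j conj(x_k).  By Newton's identities the elementary symmetric functions of
    these m^2 numbers are rational functions of zeta, so each of them vanishes to a definite
    order at tau, and the Newton polygon yields eps ~ |zeta - tau|^K on both sides of tau.

    To pass between the boundary and the circles of radius r < 1, the derivative num / p^2 is
    regularized to |num| / (|p|^2 + d), which is continuous on the closed bidisk; that integral
    means increase with r follows from a discretized Poisson formula, applied in one variable
    at a time. *)
From Stdlib Require Import Reals Lra Lia List FinFun Classical ClassicalEpsilon FunctionalExtensionality.
From Coquelicot Require Import Rcomplements Hierarchy Continuity Derive AutoDerive RInt RInt_analysis.
From Coquelicot Require Complex.
From mathcomp Require all_boot all_algebra complex Rstruct.
Require Import Defs.
Open Scope R_scope.

(** * Complex arithmetic *)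

(* Near a singular coordinate the roots x_j need not be single-valued functions of zeta, so no order
   of vanishing can be read off them one at a time. The numbers 1 - x_j conj(x_k) are chosen because
   all have modulus at least eps, some diagonal one has modulus at most 2 eps, and conj(zeta) =
   1/zeta on the circle keeps their symmetric functions rational.

   On the torus |d phi / d z_i|^p may be unbounded, while every integral here is a Riemann integral.
   The link between the two sides is a bound, uniform in d > 0, for the torus integral of the
   regularized integrand. For fixed d that integral is continuous in the radius up to r = 1, which
   gives one direction without a convergence theorem. For fixed r it is compared with the integral
   over |z_1| = |z_2| = r outside small neighbourhoods of the finitely many singular coordinates,
   which gives the other. Bounds on a whole period are glued from local ones by [cousin].

   The analysis is done for i = 1; transposing the coefficients gives i = 2. *)
Declare Scope cx_scope.
Delimit Scope cx_scope with Cx.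
Notation "x + y" := (Cadd x y) : cx_scope.
Notation "x * y" := (Cmul x y) : cx_scope.
Notation "x - y" := (Csub x y) : cx_scope.
Notation "- x" := (Copp x) : cx_scope.
Notation "x / y" := (Cdiv x y) : cx_scope.
Notation "x ^ k" := (Cpow x k) : cx_scope.

Lemma Cx_ring : ring_theory C0 C1 Cadd Cmul Csub Copp eq.
Proof.
  split; intros; unfold C0, C1, Csub, Cadd, Cmul, Copp; simpl; try reflexivity;
    try (destruct x; simpl); f_equal; ring.
Qed.

Lemma Cx_eta (z : Cx) : z = (fst z, snd z).
Proof. destruct z; reflexivity. Qed.

Lemma sqr_sum_pos (z : Cx) : z <> C0 -> 0 < fst z * fst z + snd z * snd z.
Proof.
  destruct z as [x y]; simpl; intros H.
  destruct (Req_dec x 0) as [->|Hx]; [destruct (Req_dec y 0) as [->|Hy]|]; [now elim H|nra|].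
  assert (0 < x * x) by nra; nra.
Qed.

Lemma Cx_field : field_theory C0 C1 Cadd Cmul Csub Copp Cdiv Cinv eq.
Proof.
  split; [exact Cx_ring| | reflexivity |].
  - unfold C1, C0; intros H; injection H; lra.
  - intros z Hz; assert (H := sqr_sum_pos z Hz); destruct z as [x y]; simpl in *.
    unfold Cmul, Cinv, C1; simpl; f_equal; field; lra.
Qed.

Add Field Cx_field_inst : Cx_field.

Lemma C1_neq_C0 : C1 <> C0.
Proof. exact (F_1_neq_0 Cx_field). Qed.

Lemma Cinv_l z : z <> C0 -> (Cinv z * z)%Cx = C1.
Proof. exact (Finv_l Cx_field z). Qed.

Lemma Cmod_Complex z : Cmod z = Complex.Cmod z.
Proof. unfold Cmod, Complex.Cmod; f_equal; ring. Qed.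

Lemma Cmod_ge0 z : 0 <= Cmod z.
Proof. apply sqrt_pos. Qed.

Lemma Cmod_sqr z : Cmod z * Cmod z = fst z * fst z + snd z * snd z.
Proof. apply sqrt_sqrt; nra. Qed.

Lemma Cmod_mul z w : Cmod (z * w)%Cx = Cmod z * Cmod w.
Proof. rewrite !Cmod_Complex; apply Complex.Cmod_mult. Qed.

Lemma Cmod_add z w : Cmod (z + w)%Cx <= Cmod z + Cmod w.
Proof. rewrite !Cmod_Complex; apply Complex.Cmod_triangle. Qed.

Lemma Cmod_opp z : Cmod (- z)%Cx = Cmod z.
Proof. unfold Cmod; simpl; f_equal; ring. Qed.

Lemma Cmod_conj z : Cmod (Cconj z) = Cmod z.
Proof. unfold Cmod; simpl; f_equal; ring. Qed.

Lemma Cmod_C0 : Cmod C0 = 0.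
Proof. unfold Cmod, C0; simpl; rewrite Rmult_0_l, Rplus_0_l; apply sqrt_0. Qed.

Lemma Cmod_C1 : Cmod C1 = 1.
Proof.
  unfold Cmod, C1; simpl; replace (1 * 1 + 0 * 0) with 1 by ring; apply sqrt_1.
Qed.

Lemma Cmod_gt0 z : z <> C0 -> 0 < Cmod z.
Proof. intros H; apply sqrt_lt_R0, sqr_sum_pos, H. Qed.

Lemma Cmod_eq0 z : Cmod z = 0 -> z = C0.
Proof.
  intros H; destruct (classic (z = C0)) as [|Hz]; [assumption|].
  apply Cmod_gt0 in Hz; lra.
Qed.

Lemma Cmod_neq0 z : 0 < Cmod z -> z <> C0.
Proof. intros H ->; rewrite Cmod_C0 in H; lra. Qed.

Lemma Cmod_sub_sym z w : Cmod (z - w)%Cx = Cmod (w - z)%Cx.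
Proof. rewrite <- Cmod_opp; f_equal; ring. Qed.

Lemma Cmod_sub z w : Cmod (z - w)%Cx <= Cmod z + Cmod w.
Proof. unfold Csub; rewrite <- (Cmod_opp w); apply Cmod_add. Qed.

Lemma Cmod_sub_ge z w : Cmod z - Cmod w <= Cmod (z - w)%Cx.
Proof.
  assert (H := Cmod_add (z - w)%Cx w); replace (z - w + w)%Cx with z in H by ring; lra.
Qed.

Lemma Cmod_inv z : z <> C0 -> Cmod (Cinv z) = / Cmod z.
Proof.
  intros H; assert (E := f_equal Cmod (Cinv_l z H)).
  rewrite Cmod_mul, Cmod_C1 in E; apply Cmod_gt0 in H.
  apply Rmult_eq_reg_r with (Cmod z); [rewrite E; field; lra|lra].
Qed.

Lemma Cmod_div z w : w <> C0 -> Cmod (z / w)%Cx = Cmod z / Cmod w.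
Proof. intros H; unfold Cdiv; rewrite Cmod_mul, Cmod_inv by assumption; reflexivity. Qed.

Lemma Cmod_pow z k : Cmod (z ^ k)%Cx = Cmod z ^ k.
Proof. induction k; simpl; [apply Cmod_C1|rewrite Cmod_mul, IHk; reflexivity]. Qed.

Lemma Cmod_RtoC x : Cmod (RtoC x) = Rabs x.
Proof.
  unfold Cmod; simpl; rewrite Rmult_0_l, Rplus_0_r; apply sqrt_Rsqr_abs.
Qed.

Lemma Cmod_fst z : Rabs (fst z) <= Cmod z.
Proof.
  unfold Cmod; rewrite <- sqrt_Rsqr_abs; apply sqrt_le_1; unfold Rsqr; nra.
Qed.

Lemma Cmul_integral z w : (z * w)%Cx = C0 -> z = C0 \/ w = C0.
Proof.
  intros H; assert (E := f_equal Cmod H); rewrite Cmod_mul, Cmod_C0 in E.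
  destruct (Rmult_integral _ _ E); [left|right]; now apply Cmod_eq0.
Qed.

Lemma Cmul_neq0 z w : z <> C0 -> w <> C0 -> (z * w)%Cx <> C0.
Proof. intros Hz Hw H; destruct (Cmul_integral _ _ H); contradiction. Qed.

Lemma Cpow_neq0 z k : z <> C0 -> (z ^ k)%Cx <> C0.
Proof.
  intros H; induction k; simpl; [apply C1_neq_C0|now apply Cmul_neq0].
Qed.

Lemma Csub_eq0 z w : (z - w)%Cx = C0 -> z = w.
Proof. intros H; replace z with (z - w + w)%Cx by ring; rewrite H; ring. Qed.

Lemma Cconj_mul z w : Cconj (z * w)%Cx = (Cconj z * Cconj w)%Cx.
Proof. unfold Cconj, Cmul; simpl; f_equal; ring. Qed.

Lemma Cconj_add z w : Cconj (z + w)%Cx = (Cconj z + Cconj w)%Cx.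
Proof. unfold Cconj, Cadd; simpl; f_equal; ring. Qed.

Lemma Cconj_pow z k : Cconj (z ^ k)%Cx = (Cconj z ^ k)%Cx.
Proof.
  induction k; simpl; [unfold Cconj, C1; simpl; f_equal; ring|].
  rewrite Cconj_mul, IHk; reflexivity.
Qed.

Lemma Cconj_conj z : Cconj (Cconj z) = z.
Proof. destruct z; unfold Cconj; simpl; f_equal; ring. Qed.

Lemma Cmul_conj z : (z * Cconj z)%Cx = RtoC (Cmod z * Cmod z).
Proof. rewrite Cmod_sqr; unfold Cmul, Cconj, RtoC; simpl; f_equal; ring. Qed.

Lemma Cmul_conj_unit z : Cmod z = 1 -> (z * Cconj z)%Cx = C1.
Proof. intros H; rewrite Cmul_conj, H; unfold RtoC, C1; f_equal; ring. Qed.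

Lemma unit_neq0 z : Cmod z = 1 -> z <> C0.
Proof. intros H; apply Cmod_neq0; lra. Qed.

Lemma Cpow_add z j k : (z ^ (j + k) = z ^ j * z ^ k)%Cx.
Proof. induction j; simpl; [ring|rewrite IHj; ring]. Qed.

Lemma Cpow_mul z w k : ((z * w) ^ k = z ^ k * w ^ k)%Cx.
Proof. induction k; simpl; [ring|rewrite IHk; ring]. Qed.

Lemma Cpow_C1 k : (C1 ^ k)%Cx = C1.
Proof. induction k; simpl; [reflexivity|rewrite IHk; ring]. Qed.

Lemma Cscale_RtoC r z : Cscale r z = (RtoC r * z)%Cx.
Proof. unfold Cscale, Cmul, RtoC; simpl; f_equal; ring. Qed.

Lemma Cmod_scale r z : 0 <= r -> Cmod (Cscale r z) = r * Cmod z.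
Proof.
  intros H; rewrite Cscale_RtoC, Cmod_mul, Cmod_RtoC, Rabs_pos_eq by assumption; reflexivity.
Qed.

Lemma Cscale_1 z : Cscale 1 z = z.
Proof. destruct z; unfold Cscale; simpl; f_equal; ring. Qed.

Lemma Cmod_expi t : Cmod (Cexpi t) = 1.
Proof.
  unfold Cmod, Cexpi; simpl; rewrite <- sqrt_1; f_equal.
  generalize (sin2_cos2 t); unfold Rsqr; lra.
Qed.

Lemma Cexpi_add s t : Cexpi (s + t) = (Cexpi s * Cexpi t)%Cx.
Proof. unfold Cexpi, Cmul; simpl; rewrite cos_plus, sin_plus; f_equal; ring. Qed.

Lemma Cexpi_0 : Cexpi 0 = C1.
Proof. unfold Cexpi; rewrite cos_0, sin_0; reflexivity. Qed.

Lemma Cexpi_2PI : Cexpi (2 * PI) = C1.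
Proof. unfold Cexpi; rewrite cos_2PI, sin_2PI; reflexivity. Qed.

Lemma Cexpi_period t : Cexpi (t + 2 * PI) = Cexpi t.
Proof. rewrite Cexpi_add, Cexpi_2PI; ring. Qed.

Lemma Cexpi_pow t k : (Cexpi t ^ k)%Cx = Cexpi (INR k * t).
Proof.
  induction k; [simpl; rewrite Rmult_0_l, Cexpi_0; reflexivity|].
  rewrite S_INR; simpl; rewrite IHk, <- Cexpi_add; f_equal; ring.
Qed.

Lemma unit_Cexpi z : Cmod z = 1 -> exists t, 0 <= t < 2 * PI /\ z = Cexpi t.
Proof.
  intros H; assert (E := Cmod_sqr z); rewrite H in E; destruct z as [x y]; simpl in E.
  assert (Hx : -1 <= x <= 1) by nra.
  assert (Hy : Rabs y = sqrt (1 - x ^ 2)).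
  { rewrite <- sqrt_Rsqr_abs; f_equal; unfold Rsqr; nra. }
  assert (HA := acos_bound x); assert (HP := PI_RGT_0).
  destruct (Rle_dec 0 y) as [Hy0|Hy0].
  - exists (acos x); split; [lra|]; unfold Cexpi; rewrite cos_acos, sin_acos by lra.
    f_equal; unfold Rsqr; rewrite Rabs_pos_eq in Hy by lra; rewrite Hy; f_equal; ring.
  - exists (2 * PI - acos x).
    assert (C : Cexpi (2 * PI - acos x) = (x, y)).
    { unfold Cexpi; rewrite cos_minus, sin_minus, cos_2PI, sin_2PI, cos_acos, sin_acos by lra.
      rewrite Rabs_left in Hy by lra; f_equal; [ring|].
      replace y with (- - y) by ring; rewrite Hy; unfold Rsqr.
      replace (x ^ 2) with (x * x) by ring; ring. }
    split; [|now rewrite C].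
    (* The angle 2 pi - acos x leaves [0, 2 pi) only if acos x = 0; then the point is 1, against y <
       0. *)
    destruct (Req_dec (acos x) 0) as [E0|]; [|lra].
    rewrite E0, Rminus_0_r, Cexpi_2PI in C; injection C; lra.
Qed.

(** [sin_lb] is x - x^3/6 + x^5/120 - x^7/5040. On [0, 1] the cubic term costs at most x/6 and the
    last two terms together are nonnegative. *)
Lemma sin_half_bound x : 0 <= x <= 1 -> x / 2 <= sin x <= x.
Proof.
  intros H; destruct (Req_dec x 0) as [->|Hx]; [rewrite sin_0; lra|].
  split; [|left; apply sin_lt_x; lra].
  assert (L : sin_lb x <= sin x) by (apply SIN; generalize PI2_1; lra).
  unfold sin_lb, sin_approx, sin_term in L; simpl in L.
  assert (x * x * x <= x) by nra.
  assert (0 <= x * x * x * x * x) by (repeat apply Rmult_le_pos; lra).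
  assert (x * x * x * x * x * x * x <= x * x * x * x * x).
  { replace (x * x * x * x * x * x * x) with (x * x * x * x * x * (x * x)) by ring; nra. }
  lra.
Qed.

(** The chord between the two points is 2 sin(|s - t| / 2). Contact orders are stated with chords
    and integrals are taken in the angle, so the two have to be comparable. *)
Lemma Cmod_expi_sub s t : Rabs (s - t) <= 1 ->
  Rabs (s - t) / 2 <= Cmod (Cexpi s - Cexpi t)%Cx <= Rabs (s - t).
Proof.
  assert (G : forall s t, 0 <= s - t <= 1 ->
    (s - t) / 2 <= Cmod (Cexpi s - Cexpi t)%Cx <= s - t).
  { clear; intros s t H.
    assert (E : Cmod (Cexpi s - Cexpi t)%Cx = 2 * sin ((s - t) / 2)).
    { assert (HB := sin_half_bound ((s - t) / 2)).
      rewrite <- (sqrt_Rsqr (2 * sin ((s - t) / 2))) by lra.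
      unfold Cmod; f_equal; unfold Cexpi, Csub, Cadd, Copp, Rsqr; simpl.
      assert (H1 := sin2_cos2 s); assert (H2 := sin2_cos2 t); unfold Rsqr in *.
      assert (H3 := cos_minus s t).
      assert (H4 := cos_2a_sin ((s - t) / 2)).
      replace (2 * ((s - t) / 2)) with (s - t) in H4 by field; nra. }
    rewrite E; assert (HB := sin_half_bound ((s - t) / 2)); lra. }
  intros H; destruct (Rle_dec 0 (s - t)).
  - rewrite Rabs_pos_eq in * by lra; apply G; lra.
  - rewrite Rabs_left in * by lra; rewrite Cmod_sub_sym.
    assert (HG := G t s); lra.
Qed.

(** * Polynomial functions and their roots *)

Definition cprodl (f : Cx -> Cx) (l : list Cx) : Cx :=
  fold_right (fun x acc => Cmul (f x) acc) C1 l.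

(** The inductive form supports induction over the operations, for continuity, boundedness and
    conjugation on the circle; [polyfun_coefs] recovers coefficients where roots or moments are
    needed. *)
Inductive polyfun : (Cx -> Cx) -> Prop :=
| polyfun_const c : polyfun (fun _ => c)
| polyfun_id : polyfun (fun z => z)
| polyfun_add f g : polyfun f -> polyfun g -> polyfun (fun z => Cadd (f z) (g z))
| polyfun_mul f g : polyfun f -> polyfun g -> polyfun (fun z => Cmul (f z) (g z)).

(* The fundamental theorem of algebra comes from MathComp's closed field R[i], where
   R is the type of Stdlib's real numbers. *)
Module ComplexRoots.
Import all_boot all_algebra complex Rstruct.
Import GRing.Theory Num.Theory.
Local Open Scope ring_scope.
Local Open Scope complex_scope.

Definition iota (z : Cx) : R[i] := (fst z) +i* (snd z).
Definition atoi (z : R[i]) : Cx := (complex.Re z, complex.Im z).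

Lemma iotaK z : atoi (iota z) = z. Proof. by case: z. Qed.
Lemma atoiK z : iota (atoi z) = z. Proof. by case: z. Qed.
Lemma iotaD x y : iota (Cadd x y) = iota x + iota y. Proof. by []. Qed.
Lemma iotaM x y : iota (Cmul x y) = iota x * iota y. Proof. by []. Qed.
Lemma iotaN x : iota (Copp x) = - iota x. Proof. by []. Qed.
Lemma iota0 : iota C0 = 0. Proof. by []. Qed.
Lemma iota_inj : injective iota. Proof. exact: can_inj iotaK. Qed.
Lemma iotaX x k : iota (Cpow x k) = iota x ^+ k.
Proof. by elim: k => [|k IH] //=; rewrite iotaM IH exprS. Qed.

Lemma iota_csum f m : iota (csum f m) = \sum_(i < m.+1) iota (f i).
Proof.
elim: m => [|m IH]; first by rewrite big_ord1.
by rewrite /= iotaD IH [in RHS]big_ord_recr.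
Qed.

Lemma iota_prod z l : iota (cprodl (fun x => Csub z x) l) = \prod_(x <- map iota l) (iota z - x).
Proof.
elim: l => [|x l IH] /=; first by rewrite big_nil.
by rewrite big_cons iotaM IH iotaD iotaN.
Qed.

(** Top coefficients may vanish, as for slices of p, so the list can be shorter than [m]. A nonzero
    [c m] forces full length; this is the case used for slices of the reflected polynomial. *)
Lemma factorization (c : nat -> Cx) (m : nat) :
  (forall i, (i <= m)%coq_nat -> c i = C0) \/
  exists A l, A <> C0 /\ (length l <= m)%coq_nat /\ (c m <> C0 -> A = c m /\ length l = m) /\
    forall z, csum (fun i => Cmul (c i) (Cpow z i)) m = Cmul A (cprodl (fun x => Csub z x) l).
Proof.
set p := \poly_(i < m.+1) iota (c i).
have pE z : iota (csum (fun i => Cmul (c i) (Cpow z i)) m) = p.[iota z].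
  rewrite iota_csum horner_poly; apply: eq_bigr => i _.
  by rewrite iotaM iotaX.
case: (eqVneq p 0) => [p0|pn0].
  left => i /leP im; apply: iota_inj.
  have /(congr1 (fun q : {poly R[i]} => q`_i)) := p0.
  by rewrite coef_poly ltnS im coef0.
right; have [r pr] := closed_field_poly_normal p.
have sr : size p = (size r).+1.
  by rewrite pr size_scale ?lead_coef_eq0 // size_prod_XsubC.
have sp : (size p <= m.+1)%N by exact: size_poly.
exists (atoi (lead_coef p)), (map atoi r).
have L0 : lead_coef p != 0 by rewrite lead_coef_eq0.
have Ls : length (map atoi r) = size r by rewrite -(size_map atoi).
split.
  by move=> /(congr1 iota); rewrite atoiK iota0 => /eqP; rewrite (negbTE L0).
split; first by apply/leP; rewrite Ls -ltnS -sr.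
split.
  move=> cm.
  have pm : p`_m != 0.
    rewrite coef_poly ltnSn; apply/eqP => E; apply: cm; exact: iota_inj.
  have spm : size p = m.+1.
    apply/eqP; rewrite eqn_leq sp /= ltnNge; apply/negP => H.
    by move: pm; rewrite nth_default ?eqxx.
  split; last by rewrite Ls; move: sr; rewrite spm => -[].
  apply: iota_inj; rewrite atoiK lead_coefE spm /= coef_poly ltnSn //.
move=> z; apply: iota_inj; rewrite pE iotaM atoiK iota_prod.
rewrite {1}pr hornerZ horner_prod -map_comp; congr (_ * _).
rewrite big_map; apply: eq_big_seq => x _ /=.
by rewrite hornerXsubC atoiK.
Qed.

Lemma polyfun_coefs f : polyfun f ->
  exists c m, forall z, f z = csum (fun i => Cmul (c i) (Cpow z i)) m.
Proof.
move=> fP; suff [p pE] : exists p : {poly R[i]}, forall z, iota (f z) = p.[iota z].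
  (* [csum] includes its upper index, so the last coefficient listed lies beyond the degree and is
     zero. *)
  exists (fun i => atoi p`_i), (size p) => z; apply: iota_inj.
  rewrite pE iota_csum (horner_coef_wide _ (leqnSn _)).
  by apply: eq_bigr => i _; rewrite iotaM iotaX atoiK.
elim: fP => [c||g h _ [p pE] _ [q qE]|g h _ [p pE] _ [q qE]].
- by exists (iota c)%:P => z; rewrite hornerC.
- by exists 'X => z; rewrite hornerX.
- by exists (p + q) => z; rewrite hornerD -pE -qE.
- by exists (p * q) => z; rewrite hornerM -pE -qE.
Qed.
End ComplexRoots.

(** * Continuity and integrals depending on parameters *)

Lemma ball_R (x e y : R) : ball x e y <-> - e < y - x < e.
Proof. exact (Rabs_lt_between (y - x) e). Qed.

Section RealContinuity.
Context {U : UniformSpace}.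

Lemma cont_add (f g : U -> R) x :
  continuous f x -> continuous g x -> continuous (fun u => f u + g u) x.
Proof. exact (continuous_plus f g x). Qed.

Lemma cont_sub (f g : U -> R) x :
  continuous f x -> continuous g x -> continuous (fun u => f u - g u) x.
Proof. exact (continuous_minus f g x). Qed.

Lemma cont_opp (f : U -> R) x : continuous f x -> continuous (fun u => - f u) x.
Proof. exact (continuous_opp f x). Qed.

Lemma cont_mul (f g : U -> R) x :
  continuous f x -> continuous g x -> continuous (fun u => f u * g u) x.
Proof. exact (continuous_mult f g x). Qed.

Lemma cont_comp (f : U -> R) (g : R -> R) x :
  continuous f x -> continuity_pt g (f x) -> continuous (fun u => g (f u)) x.
Proof.
  intros Hf Hg; apply continuous_comp; [exact Hf|]; now apply continuity_pt_filterlim.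
Qed.

Lemma cont_inv (f : U -> R) x : continuous f x -> f x <> 0 -> continuous (fun u => / f u) x.
Proof.
  intros Hf H0; apply cont_comp; [exact Hf|].
  apply (continuity_pt_inv (fun t => t)); [apply derivable_continuous, derivable_id|exact H0].
Qed.

Lemma cont_div (f g : U -> R) x :
  continuous f x -> continuous g x -> g x <> 0 -> continuous (fun u => f u / g u) x.
Proof. intros; apply cont_mul; [|apply cont_inv]; assumption. Qed.

Definition ccont (f : U -> Cx) (x : U) :=
  continuous (fun u => fst (f u)) x /\ continuous (fun u => snd (f u)) x.

Lemma ccont_const c x : ccont (fun _ => c) x.
Proof. split; apply continuous_const. Qed.

Lemma ccont_add f g x : ccont f x -> ccont g x -> ccont (fun u => f u + g u)%Cx x.
Proof. intros [] []; split; now apply cont_add. Qed.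

Lemma ccont_opp f x : ccont f x -> ccont (fun u => - f u)%Cx x.
Proof. intros []; split; now apply cont_opp. Qed.

Lemma ccont_sub f g x : ccont f x -> ccont g x -> ccont (fun u => f u - g u)%Cx x.
Proof. intros; apply ccont_add; [|apply ccont_opp]; assumption. Qed.

Lemma ccont_mul f g x : ccont f x -> ccont g x -> ccont (fun u => f u * g u)%Cx x.
Proof.
  intros [] []; split; simpl; [apply cont_sub|apply cont_add]; now apply cont_mul.
Qed.

Lemma ccont_pow f k x : ccont f x -> ccont (fun u => f u ^ k)%Cx x.
Proof.
  intros H; induction k; simpl; [apply ccont_const|now apply ccont_mul].
Qed.

Lemma ccont_csum (f : nat -> U -> Cx) n x :
  (forall i, ccont (f i) x) -> ccont (fun u => csum (fun i => f i u) n) x.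
Proof.
  intros H; induction n; simpl; [apply H|apply ccont_add; [exact IHn|apply H]].
Qed.

Lemma cont_Cmod f x : ccont f x -> continuous (fun u => Cmod (f u)) x.
Proof.
  intros []; unfold Cmod; apply (cont_comp _ sqrt).
  - apply cont_add; now apply cont_mul.
  - apply continuity_pt_sqrt; nra.
Qed.

Lemma ccont_inv f x : ccont f x -> f x <> C0 -> ccont (fun u => Cinv (f u)) x.
Proof.
  intros [Hf1 Hf2] Hf0; apply sqr_sum_pos in Hf0.
  split; simpl; apply cont_div; try apply cont_opp; try assumption;
    solve [apply cont_add; now apply cont_mul | lra].
Qed.

Lemma ccont_div f g x :
  ccont f x -> ccont g x -> g x <> C0 -> ccont (fun u => f u / g u)%Cx x.
Proof. intros; apply ccont_mul; [|apply ccont_inv]; assumption. Qed.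

Lemma ccont_expi (f : U -> R) x : continuous f x -> ccont (fun u => Cexpi (f u)) x.
Proof.
  intros H; split; simpl; [apply (cont_comp _ cos)|apply (cont_comp _ sin)]; try exact H;
    [apply continuity_cos|apply continuity_sin].
Qed.

Lemma ccont_scale (r : U -> R) f x :
  continuous r x -> ccont f x -> ccont (fun u => Cscale (r u) (f u)) x.
Proof. intros Hr []; split; simpl; now apply cont_mul. Qed.

Lemma ccont_peval a m n (f g : U -> Cx) x :
  ccont f x -> ccont g x -> ccont (fun u => peval a m n (f u) (g u)) x.
Proof.
  intros Hf Hg; unfold peval.
  apply (ccont_csum
    (fun i u => csum (fun j => (a i j * ((f u) ^ i * (g u) ^ j))%Cx) n)); intros i.
  apply (ccont_csum (fun j u => (a i j * ((f u) ^ i * (g u) ^ j))%Cx)); intros j.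
  apply ccont_mul; [apply ccont_const|apply ccont_mul; now apply ccont_pow].
Qed.
End RealContinuity.

(* Interval form of Heine-Borel: an additive property of intervals that holds
   on all small intervals around each point holds on [a, b]. *)
Lemma cousin (Q : R -> R -> Prop) a b :
  a <= b ->
  (forall c d e, c <= d <= e -> Q c d -> Q d e -> Q c e) ->
  (forall x, a <= x <= b -> exists eta, 0 < eta /\
     forall c d, a <= c <= x -> x <= d <= b -> x - eta < c -> d < x + eta -> Q c d) ->
  Q a b.
Proof.
  intros Hab Hadd Hloc.
  destruct (Hloc a) as [eta0 [He0 H0]]; [lra|].
  assert (Haa : Q a a) by (apply H0; lra).
  destruct (completeness (fun y => a <= y <= b /\ Q a y)) as [M [HM1 HM2]].
  - exists b; intros y [Hy _]; lra.
  - exists a; split; [lra|exact Haa].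
  - assert (HMa : a <= M) by (apply HM1; split; [lra|exact Haa]).
    assert (HMb : M <= b) by (apply HM2; intros y [Hy _]; lra).
    destruct (Hloc M) as [eta [He HM]]; [lra|].
    assert (Hy : exists y, M - eta < y /\ a <= y <= b /\ Q a y).
    { apply NNPP; intros N; assert (M <= M - eta); [|lra].
      apply HM2; intros y [Hy HQ]; destruct (Rle_dec y (M - eta)); [assumption|].
      elim N; exists y; split; [lra|tauto]. }
    destruct Hy as [y [Hy1 [Hy2 Hy3]]].
    assert (HyM : y <= M) by (apply HM1; tauto).
    (* Chaining [a, y] with an interval around M carries [Q] up to [d], hence past the supremum M
       unless [d] is already b. *)
    set (d := Rmin b (M + eta / 2)).
    assert (Hd : M <= d <= b /\ d < M + eta).
    { unfold d; split; [split|]; [apply Rmin_glb; lra|apply Rmin_l|].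
      apply Rle_lt_trans with (M + eta / 2); [apply Rmin_r|lra]. }
    assert (HQ : Q a d) by (apply Hadd with y; [lra|exact Hy3|apply HM; lra]).
    assert (d <= M) by (apply HM1; split; [lra|exact HQ]).
    replace b with d; [exact HQ|].
    unfold d in *; unfold Rmin in *; destruct (Rle_dec b (M + eta / 2)); lra.
Qed.

Lemma ex_RInt_cont (f : R -> R) a b : (forall x, continuous f x) -> ex_RInt f a b.
Proof. intros H; apply (ex_RInt_continuous f); intros; apply H. Qed.

Lemma RInt_Chasles_cont (f : R -> R) a b c :
  (forall x, continuous f x) -> RInt f a b + RInt f b c = RInt f a c.
Proof.
  intros H; apply (RInt_Chasles (V := R_CompleteNormedModule)); now apply ex_RInt_cont.
Qed.

Lemma RInt_le_cont (f g : R -> R) a b : a <= b ->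
  (forall x, continuous f x) -> (forall x, continuous g x) ->
  (forall x, a < x < b -> f x <= g x) -> RInt f a b <= RInt g a b.
Proof. intros; apply RInt_le; try assumption; now apply ex_RInt_cont. Qed.

Lemma RInt_ge0_cont (f : R -> R) a b : a <= b ->
  (forall x, continuous f x) -> (forall x, 0 <= f x) -> 0 <= RInt f a b.
Proof. intros; apply RInt_ge_0; try assumption; [now apply ex_RInt_cont|auto]. Qed.

Lemma RInt_mono_cont (f : R -> R) a c d b : a <= c <= d -> d <= b ->
  (forall x, continuous f x) -> (forall x, 0 <= f x) -> RInt f c d <= RInt f a b.
Proof.
  intros H1 H2 Hf H0.
  rewrite <- (RInt_Chasles_cont f a c b), <- (RInt_Chasles_cont f c d b) by exact Hf.
  assert (0 <= RInt f a c) by (apply RInt_ge0_cont; [lra|exact Hf|exact H0]).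
  assert (0 <= RInt f d b) by (apply RInt_ge0_cont; [lra|exact Hf|exact H0]).
  lra.
Qed.

Lemma RInt_cst (c a b : R) : RInt (fun _ => c) a b = (b - a) * c.
Proof. rewrite RInt_const; reflexivity. Qed.

Lemma RInt_scal_cont (f : R -> R) (k a b : R) : (forall x, continuous f x) ->
  RInt (fun x => k * f x) a b = k * RInt f a b.
Proof. intros H; apply (RInt_scal f a b k); now apply ex_RInt_cont. Qed.

Lemma RInt_add_cont (f g : R -> R) (a b : R) :
  (forall x, continuous f x) -> (forall x, continuous g x) ->
  RInt (fun x => f x + g x) a b = RInt f a b + RInt g a b.
Proof. intros; apply (RInt_plus f g a b); now apply ex_RInt_cont. Qed.

Lemma RInt_dist_le (f g : R -> R) a b e : a <= b ->
  (forall x, continuous f x) -> (forall x, continuous g x) ->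
  (forall x, a <= x <= b -> Rabs (f x - g x) <= e) ->
  Rabs (RInt f a b - RInt g a b) <= (b - a) * e.
Proof.
  intros Hab Hf Hg H.
  replace (RInt f a b - RInt g a b) with (RInt (fun x => f x - g x) a b)
    by (apply (RInt_minus f g a b); now apply ex_RInt_cont).
  apply abs_RInt_le_const; [exact Hab| |exact H].
  apply ex_RInt_cont; intros x; now apply cont_sub.
Qed.

Lemma cont_slice {U : UniformSpace} (f : U -> R -> R) :
  (forall z, continuous (fun z : U * R => f (fst z) (snd z)) z) ->
  forall x s, continuous (f x) s.
Proof.
  intros H x s; apply (continuous_comp_2 (fun _ : R => x) (fun s => s) f).
  - apply continuous_const.
  - apply continuous_id.
  - apply H.
Qed.

(** Tube lemma: compactness of [a, b], through [cousin], makes continuity at [x0] uniform in the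
    second variable. *)
Lemma uniform_slice {U : UniformSpace} (f : U -> R -> R) a b x0 e : a <= b -> 0 < e ->
  (forall z, continuous (fun z : U * R => f (fst z) (snd z)) z) ->
  locally x0 (fun x => forall s, a <= s <= b -> Rabs (f x s - f x0 s) <= e).
Proof.
  intros Hab He Hf.
  refine (cousin (fun c d => locally x0 (fun x => forall s, c <= s <= d ->
                                Rabs (f x s - f x0 s) <= e)) a b Hab _ _).
  - intros c d g H H1 H2; generalize (filter_and _ _ H1 H2); apply filter_imp.
    intros x [K1 K2] s Hs; destruct (Rle_dec s d); [apply K1|apply K2]; lra.
  - intros s0 Hs0.
    assert (HL := Hf (x0, s0)); unfold continuous in HL; rewrite filterlim_locally in HL.
    assert (He2 : 0 < e / 2) by lra.
    specialize (HL (mkposreal _ He2)); destruct HL as [dl HL].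
    exists dl; split; [apply cond_pos|]; intros c d Hc Hd Hc' Hd'.
    exists dl; intros x Hx s Hs.
    assert (B : ball s0 dl s).
    { apply ball_R; lra. }
    assert (H1 := HL (x, s) (conj Hx B)); assert (H2 := HL (x0, s) (conj (ball_center x0 dl) B)).
    apply ball_R in H1; apply ball_R in H2; simpl in H1, H2; apply Rabs_le_between; lra.
Qed.

Lemma RInt_param_cont {U : UniformSpace} (f : U -> R -> R) a b x0 : a <= b ->
  (forall z, continuous (fun z : U * R => f (fst z) (snd z)) z) ->
  continuous (fun x => RInt (f x) a b) x0.
Proof.
  intros Hab Hf; apply filterlim_locally; intros eps.
  assert (He : 0 < eps / (b - a + 1)) by (apply Rdiv_lt_0_compat; [apply cond_pos|lra]).
  generalize (uniform_slice f a b x0 _ Hab He Hf); apply filter_imp; intros x Hx.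
  apply ball_R, Rabs_lt_between.
  assert (H := RInt_dist_le (f x) (f x0) a b _ Hab (cont_slice f Hf x) (cont_slice f Hf x0) Hx).
  apply Rle_lt_trans with (1 := H).
  assert (Hp := cond_pos eps).
  apply Rmult_lt_reg_r with (b - a + 1); [lra|].
  replace ((b - a) * (eps / (b - a + 1)) * (b - a + 1)) with ((b - a) * eps) by (field; lra).
  nra.
Qed.

Definition cont2 (f : R -> R -> R) :=
  forall z : R * R, continuous (fun z => f (fst z) (snd z)) z.

Lemma cont2_swap f : cont2 f -> cont2 (fun t s => f s t).
Proof.
  intros H [t s]; apply (continuous_comp_2 snd fst f (t, s)).
  - apply continuous_snd.
  - apply continuous_fst.
  - apply H.
Qed.

Lemma cont2_l f : cont2 f -> forall s t, continuous (f s) t.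
Proof. exact (cont_slice (U := R_UniformSpace) f). Qed.

Lemma cont2_RInt f a b : a <= b -> cont2 f -> forall s, continuous (fun s => RInt (f s) a b) s.
Proof. intros Hab H s; now apply (RInt_param_cont (U := R_UniformSpace) f). Qed.

(** On a thin strip around s0 both iterated integrals are close to the width times the integral of
    [f s0]. The bound on their difference is proportional to the width, so it adds up over adjacent
    strips and [cousin] extends it to [a, b]. *)
Lemma fubini_cont (f : R -> R -> R) a b c d : a <= b -> c <= d -> cont2 f ->
  RInt (fun s => RInt (f s) c d) a b = RInt (fun t => RInt (fun s => f s t) a b) c d.
Proof.
  intros Hab Hcd Hf; assert (Hf' := cont2_swap f Hf).
  assert (C1' := cont2_RInt f c d Hcd Hf).
  assert (C2 : forall x y, x <= y -> forall t, continuous (fun t => RInt (fun s => f s t) x y) t)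
    by (intros; now apply (cont2_RInt (fun t s => f s t))).
  apply cond_eq; intros e He.
  (* The total error comes to 2 (b - a) (d - c) e', which is at most e; the added ones keep the
     denominator positive for degenerate rectangles. *)
  set (e' := e / (2 * ((b - a + 1) * (d - c + 1)))).
  assert (Hden : 0 < (b - a + 1) * (d - c + 1)) by (apply Rmult_lt_0_compat; lra).
  assert (He' : 0 < e') by (apply Rdiv_lt_0_compat; lra).
  assert (K : Rabs (RInt (fun s => RInt (f s) c d) a b
                    - RInt (fun t => RInt (fun s => f s t) a b) c d)
              <= (b - a) * (2 * ((d - c) * e'))).
  { refine (cousin (fun x y => x <= y -> Rabs (RInt (fun s => RInt (f s) c d) x y
                    - RInt (fun t => RInt (fun s => f s t) x y) c d)
              <= (y - x) * (2 * ((d - c) * e'))) a b Hab _ _ Hab).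
    - intros x y z H H1 H2 _; specialize (H1 ltac:(lra)); specialize (H2 ltac:(lra)).
      rewrite <- (RInt_Chasles_cont _ x y z) by exact C1'.
      rewrite (RInt_ext (fun t => RInt (fun s => f s t) x z)
                (fun t => RInt (fun s => f s t) x y + RInt (fun s => f s t) y z)).
      2:{ intros t _; symmetry; apply RInt_Chasles_cont, (cont2_l _ Hf' t). }
      rewrite RInt_add_cont by (apply C2; lra).
      apply Rabs_le_between in H1; apply Rabs_le_between in H2; apply Rabs_le_between; lra.
    - intros s0 Hs0.
      destruct (uniform_slice (U := R_UniformSpace) f c d s0 e' Hcd He' Hf) as [eta Heta].
      exists eta; split; [apply cond_pos|]; intros x y Hx Hy Hx' Hy' Hxy.
      assert (Hb : forall s, x <= s <= y -> ball s0 eta s).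
      { intros s Hs; apply ball_R; lra. }
      assert (A1 : Rabs (RInt (fun s => RInt (f s) c d) x y - RInt (fun _ => RInt (f s0) c d) x y)
                   <= (y - x) * ((d - c) * e')).
      { apply RInt_dist_le; [exact Hxy|exact C1'|intros; apply continuous_const|].
        intros s Hs; apply RInt_dist_le; [exact Hcd|apply cont2_l, Hf|apply cont2_l, Hf|].
        apply Heta, Hb, Hs. }
      assert (A2 : Rabs (RInt (fun t => RInt (fun s => f s t) x y) c d
                         - RInt (fun t => (y - x) * f s0 t) c d)
                   <= (d - c) * ((y - x) * e')).
      { apply RInt_dist_le; [exact Hcd|apply C2, Hxy| |].
        - intros t; apply cont_mul; [apply continuous_const|apply cont2_l, Hf].
        - intros t Ht; rewrite <- (RInt_cst (f s0 t)).
          apply RInt_dist_le; [exact Hxy|apply (cont2_l _ Hf' t)|intros; apply continuous_const|].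
          intros s Hs; apply (Heta s (Hb s Hs)); exact Ht. }
      rewrite RInt_cst in A1; rewrite RInt_scal_cont in A2 by apply cont2_l, Hf.
      apply Rabs_le_between in A1; apply Rabs_le_between in A2; apply Rabs_le_between; lra. }
  apply Rle_lt_trans with (1 := K).
  replace ((b - a) * (2 * ((d - c) * e')))
    with (e * (((b - a) * (d - c)) / ((b - a + 1) * (d - c + 1)))).
  2:{ unfold e'; field; split; lra. }
  rewrite <- (Rmult_1_r e) at 2; apply Rmult_lt_compat_l; [exact He|].
  apply Rmult_lt_reg_r with ((b - a + 1) * (d - c + 1)); [exact Hden|].
  unfold Rdiv; rewrite Rmult_assoc, Rinv_l by lra; nra.
Qed.

Lemma RInt_shift (f : R -> R) a c d : (forall x, continuous f x) ->
  RInt (fun s => f (s + a)) c d = RInt f (c + a) (d + a).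
Proof.
  intros Hf; rewrite <- (Rmult_1_l c) at 2; rewrite <- (Rmult_1_l d) at 2.
  rewrite <- (RInt_comp_lin f 1 a c d) by now apply ex_RInt_cont.
  apply RInt_ext; intros x _; unfold scal; simpl; unfold mult; simpl.
  rewrite !Rmult_1_l; reflexivity.
Qed.

Lemma RInt_period (f : R -> R) T a : (forall x, continuous f x) -> (forall x, f (x + T) = f x) ->
  RInt (fun s => f (s + a)) 0 T = RInt f 0 T.
Proof.
  intros Hf HT; rewrite RInt_shift, Rplus_0_l by exact Hf.
  assert (E : RInt f (0 + T) (a + T) = RInt f 0 a).
  { rewrite <- RInt_shift by exact Hf; apply RInt_ext; intros; apply HT. }
  rewrite Rplus_0_l in E; rewrite (Rplus_comm T a).
  assert (E1 := RInt_Chasles_cont f 0 a (a + T) Hf).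
  assert (E2 := RInt_Chasles_cont f 0 T (a + T) Hf); lra.
Qed.

(** * Complex derivatives and the Blaschke formula *)

Lemma csum_ext f g n : (forall i, (i <= n)%nat -> f i = g i) -> csum f n = csum g n.
Proof.
  induction n; intros H; simpl; [apply H; lia|].
  rewrite IHn by (intros; apply H; lia); rewrite H by lia; reflexivity.
Qed.

Lemma csum_add f g n : csum (fun i => f i + g i)%Cx n = (csum f n + csum g n)%Cx.
Proof. induction n; simpl; [reflexivity|rewrite IHn; ring]. Qed.

Lemma csum_mul k f n : csum (fun i => k * f i)%Cx n = (k * csum f n)%Cx.
Proof. induction n; simpl; [reflexivity|rewrite IHn; ring]. Qed.

Lemma csum_conj f n : Cconj (csum f n) = csum (fun i => Cconj (f i)) n.
Proof. induction n; simpl; [reflexivity|rewrite Cconj_add, IHn; reflexivity]. Qed.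

Lemma csum_C0 n : csum (fun _ => C0) n = C0.
Proof. induction n; simpl; [reflexivity|rewrite IHn; ring]. Qed.

Lemma csum_recl f n : csum f (S n) = (f O + csum (fun i => f (S i)) n)%Cx.
Proof. induction n; [reflexivity|]. change (csum f (S (S n))) with (csum f (S n) + f (S (S n)))%Cx. rewrite IHn; simpl; ring. Qed.

Lemma csum_rev f n : csum (fun i => f (n - i)%nat) n = csum f n.
Proof.
  induction n; [reflexivity|].
  rewrite csum_recl; simpl; rewrite IHn; ring.
Qed.

Lemma csum_swap f m n :
  csum (fun i => csum (fun j => f i j) n) m = csum (fun j => csum (fun i => f i j) m) n.
Proof. induction m; simpl; [reflexivity|rewrite IHm, csum_add; reflexivity]. Qed.

Lemma Cmod_csum f n : Cmod (csum f n) <= sum_f_R0 (fun i => Cmod (f i)) n.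
Proof.
  induction n; simpl; [lra|]; eapply Rle_trans; [apply Cmod_add|]; lra.
Qed.

Definition poly1 (c : nat -> Cx) (m : nat) (w : Cx) : Cx := csum (fun i => c i * w ^ i)%Cx m.

Definition dpoly1 (c : nat -> Cx) (m : nat) (w : Cx) : Cx :=
  csum (fun i => RtoC (INR i) * c i * w ^ (i - 1))%Cx m.

Definition col (a : nat -> nat -> Cx) (n i : nat) (zeta : Cx) : Cx := poly1 (a i) n zeta.

Definition pd1 a m n (w zeta : Cx) : Cx := dpoly1 (fun i => col a n i zeta) m w.

(** Numerator given by the quotient rule: the first partial derivative of phi is [num] / p^2. *)
Definition num a m n (w zeta : Cx) : Cx :=
  (pd1 (refl_coef a m n) m n w zeta * peval a m n w zeta
   - peval (refl_coef a m n) m n w zeta * pd1 a m n w zeta)%Cx.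

Lemma peval_col a m n w zeta : peval a m n w zeta = poly1 (fun i => col a n i zeta) m w.
Proof.
  apply csum_ext; intros i _; unfold col, poly1.
  replace (csum (fun i0 => (a i i0 * zeta ^ i0)%Cx) n * w ^ i)%Cx
    with (w ^ i * csum (fun i0 => (a i i0 * zeta ^ i0)%Cx) n)%Cx by ring.
  rewrite <- csum_mul; apply csum_ext; intros; ring.
Qed.

Notation CxU := (prod_UniformSpace R_UniformSpace R_UniformSpace).

(** Carathéodory's form of differentiability: the difference quotient extends continuously to [z].
    Sum and product rules become ring identities. *)
Definition cder (f : Cx -> Cx) (z L : Cx) : Prop :=
  exists q : Cx -> Cx, (forall w, f w = f z + (w - z) * q w)%Cx /\ q z = L /\
    ccont (U := CxU) q z.

Lemma ccont_id (z : Cx) : ccont (U := CxU) (fun w => w) z.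
Proof. destruct z; split; [apply continuous_fst|apply continuous_snd]. Qed.

Lemma cder_ccont f z L : cder f z L -> ccont (U := CxU) f z.
Proof.
  intros [q [Hq [_ Hc]]].
  replace f with (fun w => f z + (w - z) * q w)%Cx by (apply functional_extensionality; auto).
  apply ccont_add; [apply ccont_const|apply ccont_mul; [|exact Hc]].
  apply ccont_sub; [apply ccont_id|apply ccont_const].
Qed.

Lemma cder_const c z : cder (fun _ => c) z C0.
Proof. exists (fun _ => C0); split; [intros; ring|split; [reflexivity|apply ccont_const]]. Qed.

Lemma cder_add f g z F G : cder f z F -> cder g z G -> cder (fun w => f w + g w)%Cx z (F + G)%Cx.
Proof.
  intros [q [Hq [<- Hc]]] [r [Hr [<- Hd]]]; exists (fun w => q w + r w)%Cx.
  split; [intros w; rewrite (Hq w), (Hr w); ring|split; [reflexivity|now apply ccont_add]].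
Qed.

Lemma cder_mul f g z F G : cder f z F -> cder g z G ->
  cder (fun w => f w * g w)%Cx z (F * g z + f z * G)%Cx.
Proof.
  intros Hf Hg; assert (Cg := cder_ccont _ _ _ Hg).
  destruct Hf as [q [Hq [<- Hc]]]; destruct Hg as [r [Hr [<- Hd]]].
  exists (fun w => q w * g w + f z * r w)%Cx; split; [|split; [reflexivity|]].
  - intros w; rewrite (Hq w), (Hr w); ring.
  - apply ccont_add; apply ccont_mul; try assumption; apply ccont_const.
Qed.

Lemma cder_id z : cder (fun w => w) z C1.
Proof. exists (fun _ => C1); split; [intros; ring|split; [reflexivity|apply ccont_const]]. Qed.

Lemma cder_pow z k : cder (fun w => w ^ k)%Cx z (RtoC (INR k) * z ^ (k - 1))%Cx.
Proof.
  induction k; [simpl; replace (RtoC 0 * C1)%Cx with C0; [apply cder_const|]|].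
  - unfold RtoC, Cmul, C0, C1; simpl; f_equal; ring.
  - replace (RtoC (INR (S k)) * z ^ (S k - 1))%Cx
      with (C1 * z ^ k + z * (RtoC (INR k) * z ^ (k - 1)))%Cx.
    + apply (cder_mul (fun w => w) (fun w => w ^ k)%Cx); [apply cder_id|exact IHk].
    + rewrite S_INR; replace (RtoC (INR k + 1)) with (RtoC (INR k) + C1)%Cx
        by (unfold RtoC, Cadd, C1; simpl; f_equal; ring).
      replace (S k - 1)%nat with k by lia.
      destruct k; [simpl; replace (RtoC 0) with C0 by reflexivity; ring|].
      replace (S k - 1)%nat with k by lia; simpl; ring.
Qed.

Lemma cder_poly1 c m z : cder (poly1 c m) z (dpoly1 c m z).
Proof.
  unfold poly1, dpoly1.
  assert (H : forall i, cder (fun w => c i * w ^ i)%Cx z (RtoC (INR i) * c i * z ^ (i - 1))%Cx).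
  { intros i; replace (RtoC (INR i) * c i * z ^ (i - 1))%Cx
      with (C0 * z ^ i + c i * (RtoC (INR i) * z ^ (i - 1)))%Cx by ring.
    apply (cder_mul (fun _ => c i)); [apply cder_const|apply cder_pow]. }
  induction m; [apply H|]; apply (cder_add (fun w => csum (fun i => c i * w ^ i)%Cx m)); [exact IHm|apply H].
Qed.

Lemma ccont_eps q (z : Cx) : ccont (U := CxU) q z ->
  forall e, 0 < e -> exists d, 0 < d /\ forall h, Cmod h < d -> Cmod (q (z + h) - q z)%Cx < e.
Proof.
  intros Hq e He.
  assert (Hc : continuous (T := CxU)
                 (fun w => Cmod (q w - q z)%Cx) z).
  { apply cont_Cmod, ccont_sub; [exact Hq|apply ccont_const]. }
  unfold continuous in Hc; rewrite filterlim_locally in Hc.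
  destruct (Hc (mkposreal e He)) as [d Hd].
  exists d; split; [apply cond_pos|]; intros h Hh.
  assert (B : ball (M := CxU) z d (z + h)%Cx).
  { assert (F : Rabs (fst h) <= Cmod h) by apply Cmod_fst.
    assert (G : Rabs (snd h) <= Cmod h).
    { unfold Cmod; rewrite <- sqrt_Rsqr_abs; apply sqrt_le_1; unfold Rsqr; nra. }
    apply Rabs_le_between in F; apply Rabs_le_between in G.
    split; apply ball_R; simpl; lra. }
  specialize (Hd _ B); apply ball_R in Hd; simpl in Hd.
  replace (q z - q z)%Cx with C0 in Hd by ring; rewrite Cmod_C0 in Hd; lra.
Qed.

(** Connects the epsilon-delta limit in [is_partial] with [cder]. As the limit is assumed to exist,
    testing it along small real increments determines its value. *)
Lemma cder_quotient_unique u v z U V L : cder u z U -> cder v z V -> v z <> C0 ->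
  (forall eps, 0 < eps -> exists delta, 0 < delta /\ forall h, 0 < Cmod h < delta ->
    Cmod (((u (z + h) / v (z + h) - u z / v z) / h) - L)%Cx < eps) ->
  L = ((U * v z - u z * V) / (v z * v z))%Cx.
Proof.
  intros Hu Hv Hz HL; assert (Cv := cder_ccont _ _ _ Hv).
  destruct Hu as [q [Hq [Eq Hc]]]; destruct Hv as [r [Hr [Er Hd]]].
  (* The difference quotient of u / v, rewritten through the quotients [q] of u and [r] of v; unlike
     the original it makes sense, and is continuous, at [z] itself. *)
  set (g := fun w => ((q w * v z - u z * r w) / (v w * v z))%Cx).
  assert (Cg : ccont (U := CxU) g z).
  { apply ccont_div; [| |now apply Cmul_neq0].
    - apply ccont_sub; apply ccont_mul; try assumption; apply ccont_const.
    - apply ccont_mul; [exact Cv|apply ccont_const]. }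
  assert (Eg : g z = ((U * v z - u z * V) / (v z * v z))%Cx) by (unfold g; rewrite Eq, Er; reflexivity).
  rewrite <- Eg; apply Csub_eq0, Cmod_eq0.
  destruct (Req_dec (Cmod (L - g z)%Cx) 0) as [|N]; [assumption|exfalso].
  assert (Pos : 0 < Cmod (L - g z)%Cx / 2) by (generalize (Cmod_ge0 (L - g z)%Cx); lra).
  destruct (HL _ Pos) as [d1 [Hd1 K1]].
  destruct (ccont_eps _ _ Cg _ Pos) as [d2 [Hd2 K2]].
  destruct (ccont_eps _ _ Cv (Cmod (v z)) (Cmod_gt0 _ Hz)) as [d3 [Hd3 K3]].
  (* A real increment below all three radii; the third keeps v away from zero at z + x. *)
  set (x := Rmin (Rmin d1 d2) d3 / 2).
  assert (Hx : 0 < x /\ x < d1 /\ x < d2 /\ x < d3).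
  { unfold x, Rmin; destruct (Rle_dec d1 d2), (Rle_dec _ d3); lra. }
  assert (Hm : Cmod (RtoC x) = x) by (rewrite Cmod_RtoC; apply Rabs_pos_eq; lra).
  specialize (K1 (RtoC x)); specialize (K2 (RtoC x)); specialize (K3 (RtoC x)).
  rewrite Hm in *; specialize (K1 ltac:(lra)); specialize (K2 ltac:(lra)); specialize (K3 ltac:(lra)).
  assert (Hv0 : v (z + RtoC x)%Cx <> C0).
  { intros E; rewrite E in K3; replace (C0 - v z)%Cx with (- v z)%Cx in K3 by ring.
    rewrite Cmod_opp in K3; lra. }
  assert (Hx0 : RtoC x <> C0) by (apply Cmod_neq0; rewrite Hm; lra).
  assert (E : ((u (z + RtoC x) / v (z + RtoC x) - u z / v z) / RtoC x)%Cx = g (z + RtoC x)%Cx).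
  { unfold g; rewrite (Hq (z + RtoC x)%Cx); assert (E := Hr (z + RtoC x)%Cx).
    replace (r (z + RtoC x)%Cx) with ((v (z + RtoC x) - v z) / RtoC x)%Cx.
    - field; repeat split; assumption.
    - rewrite E; field; exact Hx0. }
  rewrite E in K1.
  assert (T := Cmod_add (L - g (z + RtoC x))%Cx (g (z + RtoC x) - g z)%Cx).
  rewrite (Cmod_sub_sym L) in T.
  replace (L - g (z + RtoC x) + (g (z + RtoC x) - g z))%Cx with (L - g z)%Cx in T by ring; lra.
Qed.

Lemma cder_unique f z F G : cder f z F -> cder f z G -> F = G.
Proof.
  intros HF HG.
  assert (H : F = ((G * C1 - f z * C0) / (C1 * C1))%Cx).
  { apply (cder_quotient_unique f (fun _ => C1)); [exact HG|apply cder_const|apply C1_neq_C0|].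
    destruct HF as [q [Hq [Eq Hc]]]; intros e He.
    destruct (ccont_eps _ _ Hc e He) as [d [Hd K]]; exists d; split; [exact Hd|].
    intros h Hh; rewrite <- Eq.
    replace ((f (z + h) / C1 - f z / C1) / h)%Cx with (q (z + h)%Cx); [destruct Hh; now apply K|].
    rewrite (Hq (z + h)%Cx); field; repeat split; first [apply C1_neq_C0|apply Cmod_neq0; lra]. }
  rewrite H; field; apply C1_neq_C0.
Qed.

Definition csuml (f : Cx -> Cx) (l : list Cx) : Cx :=
  fold_right (fun x acc => Cadd (f x) acc) C0 l.

Definition rsuml (f : Cx -> R) (l : list Cx) : R := fold_right (fun x acc => f x + acc) 0 l.

Lemma cprodl_neq0 f l : (forall x, In x l -> f x <> C0) <-> cprodl f l <> C0.
Proof.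
  induction l as [|y l IH]; simpl; [split; [intros _; apply C1_neq_C0|tauto]|split].
  - intros H; apply Cmul_neq0; [apply H; auto|apply IH; auto].
  - intros H x [<-|Hx].
    + intros E; apply H; rewrite E; ring.
    + revert x Hx; apply IH; intros E; apply H; rewrite E; ring.
Qed.

Lemma cprodl_eq0 z l : cprodl (fun x => z - x)%Cx l = C0 <-> In z l.
Proof.
  split.
  - intros H; apply NNPP; intros N; revert H; apply cprodl_neq0; intros x Hx E.
    apply Csub_eq0 in E; congruence.
  - intros H; apply NNPP; intros N.
    apply (proj2 (cprodl_neq0 _ _) N z H); ring.
Qed.

Lemma cder_cprodl l w : ~ In w l ->
  cder (fun w => cprodl (fun x => w - x)%Cx l) w
    (cprodl (fun x => w - x)%Cx l * csuml (fun x => Cinv (w - x)%Cx) l)%Cx.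
Proof.
  induction l as [|y l IH]; simpl; intros H.
  - replace (C1 * C0)%Cx with C0 by ring; apply cder_const.
  - assert (Hy : (w - y)%Cx <> C0) by (intros E; apply Csub_eq0 in E; apply H; left; congruence).
    set (p := cprodl (fun x => w - x)%Cx l) in *; set (s := csuml _ l) in *.
    replace ((w - y) * p * (Cinv (w - y) + s))%Cx with ((C1 + C0) * p + (w - y) * (p * s))%Cx
      by (field; exact Hy).
    apply (cder_mul (fun w => w - y)%Cx (fun w => cprodl (fun x => w - x)%Cx l)); [|apply IH; tauto].
    apply (cder_add (fun w => w) (fun _ => - y)%Cx); [apply cder_id|apply cder_const].
Qed.

(** Logarithmic derivative. The product form is differentiated by the product rule and matched with
    the coefficient form by uniqueness of the derivative. *)
Lemma dpoly1_factor c m A l : (forall w, poly1 c m w = A * cprodl (fun x => w - x) l)%Cx ->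
  forall w, ~ In w l -> dpoly1 c m w = (poly1 c m w * csuml (fun x => Cinv (w - x)) l)%Cx.
Proof.
  intros H w Hw; apply (cder_unique (poly1 c m) w); [apply cder_poly1|].
  rewrite H; replace (poly1 c m) with (fun w => A * cprodl (fun x => w - x) l)%Cx
    by (apply functional_extensionality; intros; now rewrite H).
  set (p := cprodl (fun x => w - x)%Cx l); set (s := csuml _ l).
  replace (A * p * s)%Cx with (C0 * p + A * (p * s))%Cx by ring.
  apply (cder_mul (fun _ => A)); [apply cder_const|now apply cder_cprodl].
Qed.

Lemma unit_pow_sub w m i : Cmod w = 1 -> (i <= m)%nat -> (w ^ (m - i) = w ^ m * Cconj (w ^ i))%Cx.
Proof.
  intros Hw Hi; replace m with (m - i + i)%nat at 2 by lia.
  rewrite Cpow_add.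
  assert (E : (w ^ i * Cconj (w ^ i))%Cx = C1) by (apply Cmul_conj_unit; rewrite Cmod_pow, Hw, pow1; reflexivity).
  replace (w ^ (m - i) * w ^ i * Cconj (w ^ i))%Cx with (w ^ (m - i) * (w ^ i * Cconj (w ^ i)))%Cx by ring.
  rewrite E; ring.
Qed.

Lemma col_refl a m n i zeta : Cmod zeta = 1 ->
  col (refl_coef a m n) n i zeta = (zeta ^ n * Cconj (col a n (m - i) zeta))%Cx.
Proof.
  intros Hz; unfold col, poly1; rewrite csum_conj, <- csum_mul, <- csum_rev.
  apply csum_ext; intros j Hj; unfold refl_coef.
  replace (n - (n - j))%nat with j by lia.
  rewrite unit_pow_sub, Cconj_mul by assumption; ring.
Qed.

Lemma peval_refl a m n w zeta : Cmod w = 1 -> Cmod zeta = 1 ->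
  peval (refl_coef a m n) m n w zeta = (w ^ m * zeta ^ n * Cconj (peval a m n w zeta))%Cx.
Proof.
  intros Hw Hz; rewrite !peval_col; unfold poly1.
  rewrite csum_conj, <- csum_mul, <- csum_rev.
  apply csum_ext; intros i Hi.
  rewrite col_refl, unit_pow_sub, Cconj_mul by assumption.
  replace (m - (m - i))%nat with i by lia; ring.
Qed.

Lemma mul_dpoly1 c m w : (w * dpoly1 c m w)%Cx = csum (fun i => RtoC (INR i) * (c i * w ^ i))%Cx m.
Proof.
  unfold dpoly1; rewrite <- csum_mul; apply csum_ext; intros i _.
  destruct i; [simpl; replace (RtoC 0) with C0 by reflexivity; ring|].
  replace (S i - 1)%nat with i by lia; simpl (w ^ S i)%Cx; ring.
Qed.

(** The Euler operator w d/dw multiplies the coefficient of w^i by i, and reflection exchanges i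
    with m - i; the constant m produces the first term on the right. *)
Lemma pd1_refl a m n w zeta : Cmod w = 1 -> Cmod zeta = 1 ->
  (w * pd1 (refl_coef a m n) m n w zeta
   = RtoC (INR m) * peval (refl_coef a m n) m n w zeta
     - w ^ m * zeta ^ n * Cconj (w * pd1 a m n w zeta))%Cx.
Proof.
  intros Hw Hz; unfold pd1; rewrite !mul_dpoly1, peval_col; unfold poly1.
  rewrite csum_conj, <- !csum_mul.
  replace (csum (fun i => w ^ m * zeta ^ n * Cconj (RtoC (INR i) * (col a n i zeta * w ^ i)))%Cx m)
    with (csum (fun i => w ^ m * zeta ^ n
            * Cconj (RtoC (INR (m - i)) * (col a n (m - i) zeta * w ^ (m - i))))%Cx m)
    by apply (csum_rev (fun i => w ^ m * zeta ^ n * Cconj (RtoC (INR i) * (col a n i zeta * w ^ i)))%Cx).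
  match goal with |- _ = (?x - ?y)%Cx => replace (x - y)%Cx with (x + RtoC (-1) * y)%Cx end.
  2:{ replace (RtoC (-1)) with (- C1)%Cx by (unfold RtoC, Copp, C1; simpl; f_equal; ring); ring. }
  rewrite <- csum_mul, <- csum_add; apply csum_ext; intros i Hi.
  rewrite col_refl, !Cconj_mul by assumption.
  assert (E : (w ^ m * Cconj (w ^ (m - i)))%Cx = (w ^ i)%Cx).
  { rewrite <- unit_pow_sub by (assumption || lia); f_equal; lia. }
  rewrite minus_INR by assumption.
  replace (Cconj (RtoC (INR m - INR i))) with (RtoC (INR m) + RtoC (-1) * RtoC (INR i))%Cx
    by (unfold Cconj, RtoC, Cadd, Cmul; simpl; f_equal; ring).
  replace (w ^ m * zeta ^ n * ((RtoC (INR m) + RtoC (-1) * RtoC (INR i))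
            * (Cconj (col a n (m - i) zeta) * Cconj (w ^ (m - i)))))%Cx
    with ((w ^ m * Cconj (w ^ (m - i))) * (zeta ^ n * ((RtoC (INR m) + RtoC (-1) * RtoC (INR i))
            * (Cconj (col a n (m - i) zeta)))))%Cx by ring.
  rewrite E.
  replace (RtoC (-1)) with (- C1)%Cx by (unfold RtoC, Copp, C1; simpl; f_equal; ring).
  ring.
Qed.

Definition poisson (x w : Cx) : R := (1 - Cmod x * Cmod x) / (Cmod (w - x)%Cx * Cmod (w - x)%Cx).

(** This is 2 Re(w / (w - x)) - 1 = (1 - |x|^2) / |w - x|^2 on the unit circle. *)
Lemma poisson_Re x w : Cmod w = 1 -> w <> x ->
  (w * Cinv (w - x) + Cconj (w * Cinv (w - x)) - C1)%Cx = RtoC (poisson x w).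
Proof.
  intros Hw Hx; unfold poisson; rewrite !Cmod_sqr.
  assert (E := Cmod_sqr w); rewrite Hw in E.
  assert (N : (w - x)%Cx <> C0) by (intros K; apply Hx, Csub_eq0, K).
  apply sqr_sum_pos in N; destruct w as [w1 w2], x as [x1 x2]; simpl in *.
  unfold RtoC, Cmul, Cinv, Cconj, Csub, Cadd, Copp, C1; simpl.
  f_equal; [|ring].
  apply Rmult_eq_reg_r with ((w1 + - x1) * (w1 + - x1) + (w2 + - x2) * (w2 + - x2)); [|lra].
  field_simplify; [|lra..]; nra.
Qed.

(** With q = p~(w, zeta), S = w p~'/p~ and a unimodular u, the reflection formulas collapse w [num]
    to u |q|^2 (S + conj S - m), while |p| = |q| on the torus. The absolute value is there because
    the roots are not yet known to lie in the disk. *)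
Lemma num_poisson a m n zeta A l : Cmod zeta = 1 -> length l = m ->
  (forall w, peval (refl_coef a m n) m n w zeta = A * cprodl (fun x => w - x) l)%Cx ->
  forall w, Cmod w = 1 -> peval a m n w zeta <> C0 ->
  Cmod (num a m n w zeta) / (Cmod (peval a m n w zeta) * Cmod (peval a m n w zeta))
  = Rabs (rsuml (fun x => poisson x w) l).
Proof.
  intros Hz Hl HA w Hw Hp.
  set (p := peval a m n w zeta) in *; set (u := (w ^ m * zeta ^ n)%Cx).
  assert (Hu : Cmod u = 1) by (unfold u; rewrite Cmod_mul, !Cmod_pow, Hw, Hz, !pow1; ring).
  assert (Ept := peval_refl a m n w zeta Hw Hz); fold u p in Ept.
  set (q := peval (refl_coef a m n) m n w zeta) in *.
  assert (Mq : Cmod q = Cmod p) by (rewrite Ept, Cmod_mul, Cmod_conj, Hu; ring).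
  assert (Ep : p = (u * Cconj q)%Cx).
  { rewrite Ept, Cconj_mul, Cconj_conj.
    replace (u * (Cconj u * p))%Cx with ((u * Cconj u) * p)%Cx by ring.
    rewrite Cmul_conj_unit by exact Hu; ring. }
  assert (Hq : q <> C0) by (apply Cmod_neq0; rewrite Mq; now apply Cmod_gt0).
  assert (Nl : ~ In w l).
  { intros K; apply cprodl_eq0 in K; apply Hq; unfold q; rewrite HA, K; ring. }
  set (T := (w * pd1 (refl_coef a m n) m n w zeta)%Cx).
  assert (ET : T = (q * (w * csuml (fun x => Cinv (w - x)) l))%Cx).
  { unfold T, pd1; rewrite (dpoly1_factor _ m A l); [|intros w'; rewrite <- peval_col; apply HA|exact Nl].
    rewrite <- peval_col; fold q; ring. }
  set (S := (w * csuml (fun x => Cinv (w - x)) l)%Cx) in *.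
  set (D := (w * pd1 a m n w zeta)%Cx).
  assert (EP := pd1_refl a m n w zeta Hw Hz); fold T u q D in EP.
  assert (ED : D = (u * Cconj (RtoC (INR m) * q - T))%Cx).
  { rewrite EP; replace (RtoC (INR m) * q - (RtoC (INR m) * q - u * Cconj D))%Cx with (u * Cconj D)%Cx by ring.
    rewrite Cconj_mul, Cconj_conj.
    replace (u * (Cconj u * D))%Cx with ((u * Cconj u) * D)%Cx by ring.
    rewrite Cmul_conj_unit by exact Hu; ring. }
  assert (EN : (w * num a m n w zeta)%Cx = (u * (q * Cconj q) * (S + Cconj S - RtoC (INR m)))%Cx).
  { unfold num; fold p q.
    replace (w * (pd1 (refl_coef a m n) m n w zeta * p - q * pd1 a m n w zeta))%Cx
      with (T * p - q * D)%Cx by (unfold T, D; ring).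
    rewrite ED, Ep, ET; unfold Csub at 2; rewrite !Cconj_add.
    replace (Cconj (- (q * S)))%Cx with (- (Cconj q * Cconj S))%Cx
      by (unfold Cconj, Copp, Cmul; simpl; f_equal; ring).
    rewrite Cconj_mul; replace (Cconj (RtoC (INR m))) with (RtoC (INR m))
      by (unfold Cconj, RtoC; simpl; f_equal; ring).
    ring. }
  (* Since the list has length m, the constant m supplies one -1 for each root, as [poisson_Re]
     requires. *)
  assert (ES : (S + Cconj S - RtoC (INR m))%Cx = RtoC (rsuml (fun x => poisson x w) l)).
  { unfold S; rewrite <- Hl; clear - Nl Hw; induction l as [|y l IH]; simpl csuml; simpl rsuml.
    - simpl; unfold Cmul, Cconj, RtoC, Csub, Cadd, Copp, C0; simpl; f_equal; ring.
    - simpl length; rewrite S_INR.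
      replace (RtoC (INR (length l) + 1)) with (RtoC (INR (length l)) + C1)%Cx
        by (unfold RtoC, Cadd, C1; simpl; f_equal; ring).
      replace (RtoC (poisson y w + rsuml (fun x => poisson x w) l))
        with (RtoC (poisson y w) + RtoC (rsuml (fun x => poisson x w) l))%Cx
        by (unfold RtoC, Cadd; simpl; f_equal; ring).
      rewrite <- IH by (intros K; apply Nl; right; exact K).
      rewrite <- (poisson_Re y w Hw) by (intros K; apply Nl; left; congruence).
      replace (w * (Cinv (w - y) + csuml (fun x => Cinv (w - x)) l))%Cx
        with (w * Cinv (w - y) + w * csuml (fun x => Cinv (w - x)%Cx) l)%Cx by ring.
      rewrite Cconj_add; ring. }
  assert (EM := f_equal Cmod EN); rewrite ES, !Cmod_mul, Hw, Hu, Cmod_conj, Cmod_RtoC, Mq in EM.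
  replace (Cmod (num a m n w zeta)) with (Cmod p * Cmod p * Rabs (rsuml (fun x => poisson x w) l)) by lra.
  apply Cmod_gt0 in Hp; field; lra.
Qed.

(** * Zeros on the boundary of the bidisk *)

Definition stable (a : nat -> nat -> Cx) (m n : nat) : Prop :=
  (forall z1 z2, Cmod z1 < 1 -> Cmod z2 < 1 -> peval a m n z1 z2 <> C0) /\
  (exists l : list (Cx * Cx), forall z1 z2, Cmod z1 = 1 -> Cmod z2 = 1 ->
     peval a m n z1 z2 = C0 -> In (z1, z2) l).

(** Exchanges the two variables: it carries the results on D x T to T x D and the criterion for z_1
    to z_2. *)
Definition tr (a : nat -> nat -> Cx) : nat -> nat -> Cx := fun i j => a j i.

Lemma peval_tr a m n z1 z2 : peval (tr a) n m z1 z2 = peval a m n z2 z1.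
Proof.
  unfold peval; rewrite csum_swap; apply csum_ext; intros i _; apply csum_ext; intros j _.
  unfold tr; ring.
Qed.

Lemma stable_tr a m n : stable a m n -> stable (tr a) n m.
Proof.
  intros [H [l Hl]]; split.
  - intros; rewrite peval_tr; now apply H.
  - exists (map (fun z => (snd z, fst z)) l); intros z1 z2 H1 H2; rewrite peval_tr; intros E.
    apply in_map_iff; exists (z2, z1); split; [reflexivity|now apply Hl].
Qed.

Lemma poly1_factor c m :
  (forall i, (i <= m)%nat -> c i = C0) \/
  exists A l, A <> C0 /\ (length l <= m)%nat /\ (c m <> C0 -> A = c m /\ length l = m) /\
    forall z, poly1 c m z = (A * cprodl (fun x => z - x) l)%Cx.
Proof. exact (ComplexRoots.factorization c m). Qed.

Lemma poly1_0 c m : poly1 c m C0 = c O.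
Proof.
  destruct m; unfold poly1; [simpl; ring|].
  rewrite csum_recl; simpl.
  replace (csum (fun i => c (S i) * (C0 * C0 ^ i))%Cx m) with (csum (fun _ => C0) m)
    by (apply csum_ext; intros; ring).
  rewrite csum_C0; ring.
Qed.

Lemma limit_from_below (F : R -> R) : continuous F 1 -> (forall r, 0 < r < 1 -> F r <= 0) -> F 1 <= 0.
Proof.
  intros Hc H; apply Rnot_lt_le; intros Hp.
  unfold continuous in Hc; rewrite filterlim_locally in Hc.
  destruct (Hc (mkposreal _ Hp)) as [d Hd]; assert (Pd := cond_pos d).
  set (r := Rmax (1 / 2) (1 - d / 2)).
  assert (Hr : 0 < r < 1 /\ 1 - r < d).
  { unfold r, Rmax; destruct (Rle_dec (1 / 2) (1 - d / 2)); lra. }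
  assert (B : ball (1 : R) d r).
  { apply ball_R; lra. }
  specialize (Hd r B); apply ball_R in Hd; simpl in Hd; specialize (H r ltac:(lra)); lra.
Qed.

(** The points with angles 1/(k + 1) are distinct by the lower chord bound, so more of them can be
    taken than the list has entries. *)
Lemma circle_infinite (zeta : Cx) (l : list (Cx * Cx)) : exists t, ~ In (Cexpi t, zeta) l.
Proof.
  apply NNPP; intros N.
  assert (H : forall t, In (Cexpi t, zeta) l) by (intros t; apply NNPP; intros K; apply N; eauto).
  set (f := fun k => (Cexpi (/ (INR k + 1)), zeta)).
  assert (Inj : forall j k, f j = f k -> j = k).
  { intros j k E; injection E as E1 E2.
    assert (B : forall i, 0 < / (INR i + 1) <= 1).
    { intros i; assert (Hi := pos_INR i); split; [apply Rinv_0_lt_compat; lra|].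
      rewrite <- Rinv_1; apply Rinv_le_contravar; lra. }
    assert (Bj := B j); assert (Bk := B k).
    assert (Cj : Rabs (/ (INR j + 1) - / (INR k + 1)) <= 1) by (apply Rabs_le_between; lra).
    apply Cmod_expi_sub in Cj.
    replace (Cexpi (/ (INR j + 1)) - Cexpi (/ (INR k + 1)))%Cx with C0 in Cj.
    2:{ unfold Cexpi; rewrite E1, E2; ring. }
    rewrite Cmod_C0 in Cj.
    assert (Z : Rabs (/ (INR j + 1) - / (INR k + 1)) = 0)
      by (generalize (Rabs_pos (/ (INR j + 1) - / (INR k + 1))); lra).
    assert (E : / (INR j + 1) = / (INR k + 1)).
    { destruct (Req_dec (/ (INR j + 1) - / (INR k + 1)) 0) as [|Nz]; [lra|].
      apply Rabs_no_R0 in Nz; lra. }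
    apply INR_eq; apply Rinv_eq_reg in E; lra. }
  assert (ND : NoDup (map f (seq 0 (S (length l))))).
  { apply Injective_map_NoDup; [exact Inj|apply seq_NoDup]. }
  apply (NoDup_incl_length (l' := l)) in ND.
  - rewrite length_map, length_seq in ND; lia.
  - intros z Hz; apply in_map_iff in Hz; destruct Hz as [k [<- _]]; apply H.
Qed.

(** For |x| >= 1 one factor satisfies |w' - x| (1 - |w|)/2 <= (1 + |x|)(1 - |w|)/2 <= |x| - |w| <=
    |w - x|. *)
Lemma cprodl_harnack l w w' : Cmod w < 1 -> Cmod w' <= 1 -> (forall x, In x l -> 1 <= Cmod x) ->
  Cmod (cprodl (fun x => w' - x)%Cx l) * ((1 - Cmod w) / 2) ^ length l
  <= Cmod (cprodl (fun x => w - x)%Cx l).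
Proof.
  intros Hw Hw' Hl; induction l as [|x l IH]; simpl; [lra|].
  rewrite !Cmod_mul.
  specialize (IH (fun y Hy => Hl y (or_intror Hy))); specialize (Hl x (or_introl eq_refl)).
  assert (A1 : Cmod (w' - x)%Cx * ((1 - Cmod w) / 2) <= Cmod (w - x)%Cx).
  { assert (T1 := Cmod_sub w' x); assert (T2 := Cmod_sub_ge x w); rewrite Cmod_sub_sym in T2.
    assert (W0 := Cmod_ge0 w); nra. }
  set (p := Cmod (cprodl (fun x => w' - x)%Cx l)) in *.
  set (q := ((1 - Cmod w) / 2) ^ length l) in *.
  replace (Cmod (w' - x)%Cx * p * ((1 - Cmod w) / 2 * q))
    with ((Cmod (w' - x)%Cx * ((1 - Cmod w) / 2)) * (p * q)) by ring.
  apply Rmult_le_compat; [| |exact A1|exact IH].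
  - apply Rmult_le_pos; [apply Cmod_ge0|lra].
  - apply Rmult_le_pos; [apply Cmod_ge0|apply pow_le; lra].
Qed.

(** The constant depends on [w] and [m] but not on the coefficients, so the inequality survives a
    limit in the coefficients: a quantitative form of Hurwitz's theorem. *)
Lemma poly1_harnack c m w w' : Cmod w < 1 -> Cmod w' <= 1 ->
  (forall z, Cmod z < 1 -> poly1 c m z <> C0) ->
  Cmod (poly1 c m w') * ((1 - Cmod w) / 2) ^ m <= Cmod (poly1 c m w).
Proof.
  intros Hw Hw' Hz; destruct (poly1_factor c m) as [Z|[A [l [HA [Hl [_ E]]]]]].
  - elim (Hz w Hw); unfold poly1; rewrite <- (csum_C0 m); apply csum_ext.
    intros i Hi; rewrite Z by exact Hi; ring.
  - rewrite !E, !Cmod_mul, Rmult_assoc; apply Rmult_le_compat_l; [apply Cmod_ge0|].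
    assert (W0 := Cmod_ge0 w).
    apply Rle_trans with (Cmod (cprodl (fun x => w' - x)%Cx l) * ((1 - Cmod w) / 2) ^ length l).
    + apply Rmult_le_compat_l; [apply Cmod_ge0|].
      (* If the degree drops, each missing root contributes a factor (1 - |w|)/2 <= 1, so the
         exponent may be raised to m. *)
      replace m with (length l + (m - length l))%nat by lia; rewrite pow_add.
      rewrite <- (Rmult_1_r (((1 - Cmod w) / 2) ^ length l)) at 2.
      apply Rmult_le_compat_l; [apply pow_le; lra|].
      apply Rle_trans with (1 ^ (m - length l)); [apply pow_incr; lra|rewrite pow1; lra].
    + apply cprodl_harnack; [exact Hw|exact Hw'|].
      intros x Hx; apply Rnot_lt_le; intros Hx1; apply (Hz x Hx1); rewrite E.
      replace (cprodl (fun x0 => x - x0)%Cx l) with C0; [ring|].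
      symmetry; now apply cprodl_eq0.
Qed.

(** The Harnack inequality on the slices r zeta passes to r = 1. A zero at an interior [w] would
    then make p(w', zeta) vanish for every unimodular w', against finiteness of the zeros on the
    torus. *)
Lemma peval_disk_circle a m n w zeta : stable a m n -> Cmod w < 1 -> Cmod zeta = 1 ->
  peval a m n w zeta <> C0.
Proof.
  intros [Hz [l Hl]] Hw Hzeta E.
  destruct (circle_infinite zeta l) as [t Ht]; apply Ht, Hl; [apply Cmod_expi|exact Hzeta|].
  set (w' := Cexpi t); assert (Hw' : Cmod w' = 1) by apply Cmod_expi.
  set (k := ((1 - Cmod w) / 2) ^ m).
  assert (Hk : 0 < k) by (apply pow_lt; lra).
  set (F := fun r => Cmod (peval a m n w' (Cscale r zeta)) * k - Cmod (peval a m n w (Cscale r zeta))).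
  assert (HF : F 1 <= 0).
  { apply limit_from_below.
    - unfold F; apply cont_sub; [apply cont_mul; [|apply continuous_const]|];
        apply cont_Cmod, ccont_peval; try apply ccont_const;
        (apply ccont_scale; [apply continuous_id|apply ccont_const]).
    - intros r Hr; unfold F; rewrite !peval_col.
      assert (H := poly1_harnack (fun i => col a n i (Cscale r zeta)) m w w' Hw ltac:(lra)).
      fold k in H; apply Rle_minus, H; intros z Hz1; rewrite <- peval_col; apply Hz; [exact Hz1|].
      rewrite Cmod_scale, Hzeta; lra. }
  unfold F in HF; rewrite !Cscale_1, E, Cmod_C0, Rminus_0_r in HF.
  apply Cmod_eq0; assert (P := Cmod_ge0 (peval a m n w' zeta)); nra.
Qed.

Lemma peval_circle_disk a m n w zeta : stable a m n -> Cmod w = 1 -> Cmod zeta < 1 ->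
  peval a m n w zeta <> C0.
Proof.
  intros H Hw Hz; rewrite <- peval_tr; apply peval_disk_circle; [now apply stable_tr|..]; assumption.
Qed.

Lemma peval_refl_inv a m n w zeta : w <> C0 -> Cmod zeta = 1 ->
  peval (refl_coef a m n) m n w zeta
  = (w ^ m * zeta ^ n * Cconj (peval a m n (Cinv (Cconj w)) zeta))%Cx.
Proof.
  intros Hw Hz; rewrite !peval_col; unfold poly1.
  rewrite csum_conj, <- csum_mul, <- csum_rev; apply csum_ext; intros i Hi.
  rewrite col_refl by assumption; replace (m - (m - i))%nat with i by lia.
  assert (E : (w ^ (m - i))%Cx = (w ^ m * Cconj (Cinv (Cconj w) ^ i))%Cx).
  { rewrite Cconj_pow.
    replace (Cconj (Cinv (Cconj w))) with (Cinv w).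
    2:{ unfold Cinv, Cconj; simpl; f_equal; replace (- snd w * - snd w) with (snd w * snd w) by ring;
          unfold Rdiv; ring. }
    replace m with (m - i + i)%nat at 2 by lia; rewrite Cpow_add.
    replace (w ^ (m - i) * w ^ i * Cinv w ^ i)%Cx with (w ^ (m - i) * (w ^ i * Cinv w ^ i))%Cx by ring.
    rewrite <- Cpow_mul; replace (w * Cinv w)%Cx with C1 by (field; exact Hw).
    rewrite Cpow_C1; ring. }
  rewrite E, Cconj_mul; ring.
Qed.

Definition good (a : nat -> nat -> Cx) (m n : nat) (zeta : Cx) : Prop :=
  forall w, Cmod w = 1 -> peval a m n w zeta <> C0.

(** Zeros of the slice of p~ with multiplicity. The count m is required at every point of the
    circle, while the roots are required to lie in the open disk only off the singular coordinates,
    where p and p~ have no common zero. *)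
Definition root_spec (a : nat -> nat -> Cx) (m n : nat) (zeta : Cx) (l : list Cx) : Prop :=
  length l = m /\
  (forall w, peval (refl_coef a m n) m n w zeta
             = (col (refl_coef a m n) n m zeta * cprodl (fun x => w - x) l)%Cx) /\
  (good a m n zeta -> forall x, In x l -> Cmod x < 1).

(** The leading coefficient of p~ in its first variable is zeta^n conj(p(0, zeta)), and (0, zeta)
    lies in D x T, where p has no zeros. *)
Lemma lead_refl_neq0 a m n zeta : stable a m n -> Cmod zeta = 1 ->
  col (refl_coef a m n) n m zeta <> C0.
Proof.
  intros H Hz; rewrite col_refl, Nat.sub_diag by exact Hz.
  apply Cmul_neq0; [apply Cpow_neq0, unit_neq0, Hz|].
  rewrite <- (poly1_0 (fun i => col a n i zeta) m), <- peval_col.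
  intros E; apply (f_equal Cconj) in E; rewrite Cconj_conj in E.
  apply (peval_disk_circle a m n C0 zeta H); [rewrite Cmod_C0; lra|exact Hz|].
  rewrite E; unfold Cconj, C0; simpl; f_equal; ring.
Qed.

(** A root x of p~ with |x| >= 1 reflects to the zero 1/conj(x) of p. For |x| > 1 this lies in D x
    T, which is impossible; for |x| = 1 it contradicts [good]. *)
Lemma root_list a m n zeta : stable a m n -> Cmod zeta = 1 -> exists l, root_spec a m n zeta l.
Proof.
  intros H Hz; assert (HA := lead_refl_neq0 a m n zeta H Hz).
  destruct (poly1_factor (fun i => col (refl_coef a m n) n i zeta) m)
    as [Z|[A [l [_ [_ [HAl E]]]]]].
  - elim HA; apply (Z m); lia.
  - destruct (HAl HA) as [-> Hl]; exists l; split; [exact Hl|split].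
    + intros w; rewrite peval_col; apply E.
    + intros Hg x Hx.
      assert (Ex : peval (refl_coef a m n) m n x zeta = C0).
      { rewrite peval_col, E; apply cprodl_eq0 in Hx; rewrite Hx; ring. }
      apply Rnot_le_lt; intros Hx1.
      assert (Hx0 : x <> C0) by (apply Cmod_neq0; lra).
      assert (Hc0 : Cconj x <> C0) by (apply Cmod_neq0; rewrite Cmod_conj; lra).
      rewrite peval_refl_inv in Ex by assumption.
      assert (Em := f_equal Cmod Ex); rewrite !Cmod_mul, !Cmod_pow, Hz, pow1, Cmod_conj, Cmod_C0 in Em.
      assert (Hp : 0 < Cmod x ^ m) by (apply pow_lt; lra).
      assert (Ep : peval a m n (Cinv (Cconj x)) zeta = C0) by (apply Cmod_eq0; nra).
      assert (Hm : Cmod (Cinv (Cconj x)) = / Cmod x) by (rewrite Cmod_inv, Cmod_conj by assumption; reflexivity).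
      destruct (Rle_lt_or_eq_dec _ _ Hx1) as [Hlt|Heq].
      * apply (peval_disk_circle a m n (Cinv (Cconj x)) zeta H); [|exact Hz|exact Ep].
        rewrite Hm, <- Rinv_1; apply Rinv_lt_contravar; lra.
      * apply (Hg (Cinv (Cconj x))); [|exact Ep]; rewrite Hm, <- Heq; apply Rinv_1.
Qed.

Lemma good_isolated a m n tau : stable a m n ->
  exists d, 0 < d /\ forall zeta, Cmod zeta = 1 -> 0 < Cmod (tau - zeta)%Cx < d -> good a m n zeta.
Proof.
  intros [_ [l Hl]].
  (* The least positive distance from tau to the listed second coordinates; tau itself may be among
     them. *)
  assert (D : exists d, 0 < d /\ forall z, In z l -> Cmod (tau - snd z)%Cx < d -> tau = snd z).
  { clear Hl; induction l as [|y l [d [Hd IH]]]; [exists 1; split; [lra|intros z []]|].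
    destruct (classic (tau = snd y)) as [E|E].
    - exists d; split; [exact Hd|]; intros z [<-|Hz]; [intros; exact E|now apply IH].
    - assert (P : 0 < Cmod (tau - snd y)%Cx)
        by (apply Cmod_gt0; intros K; apply E, Csub_eq0, K).
      exists (Rmin d (Cmod (tau - snd y)%Cx)); split; [apply Rmin_glb_lt; assumption|].
      intros z [<-|Hz] Hlt.
      + assert (K := Rmin_r d (Cmod (tau - snd y)%Cx)); lra.
      + apply IH; [exact Hz|]; assert (K := Rmin_l d (Cmod (tau - snd y)%Cx)); lra. }
  destruct D as [d [Hd HD]]; exists d; split; [exact Hd|]; intros zeta Hz Hlt w Hw E.
  assert (K := HD (w, zeta) (Hl w zeta Hw Hz E)); simpl in K; rewrite K in Hlt by lra.
  replace (zeta - zeta)%Cx with C0 in Hlt by ring; rewrite Cmod_C0 in Hlt; lra.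
Qed.

(** * Symmetric functions of the roots *)

Definition sg (k : nat) : Cx := ((- C1) ^ k)%Cx.

(** Elementary symmetric polynomial e_k of the list; below, [ps] gives its power sums. *)
Fixpoint es (l : list Cx) (k : nat) : Cx :=
  match k, l with
  | O, _ => C1
  | S _, nil => C0
  | S k', x :: l' => (es l' (S k') + x * es l' k')%Cx
  end.

Definition ps (l : list Cx) (k : nat) : Cx := csuml (fun x => x ^ k)%Cx l.

Lemma es_0 l : es l 0 = C1.
Proof. destruct l; reflexivity. Qed.

Lemma es_over l k : (length l < k)%nat -> es l k = C0.
Proof.
  revert k; induction l as [|x l IH]; intros [|k] H; simpl in *; try lia; [reflexivity|].
  rewrite !IH by lia; ring.
Qed.

Lemma es_length l : es l (length l) = cprodl (fun x => x) l.
Proof.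
  induction l as [|x l IH]; simpl; [reflexivity|].
  rewrite es_over, IH by lia; ring.
Qed.

Lemma sg_sqr k : (sg k * sg k)%Cx = C1.
Proof.
  unfold sg; rewrite <- Cpow_mul; replace (- C1 * - C1)%Cx with C1 by ring; apply Cpow_C1.
Qed.

Lemma cprodl_es l w :
  cprodl (fun x => w - x)%Cx l = csum (fun k => sg k * es l k * w ^ (length l - k))%Cx (length l).
Proof.
  induction l as [|y l IH]; [simpl; unfold sg; simpl; ring|].
  simpl length; simpl cprodl; rewrite IH; clear IH; set (N := length l).
  rewrite csum_recl.
  rewrite (csum_ext (fun i => sg (S i) * es (y :: l) (S i) * w ^ (S N - S i))%Cx
            (fun i => sg (S i) * es l (S i) * w ^ (S N - S i)
                      + (- y) * (sg i * es l i * w ^ (N - i)))%Cx).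
  2:{ intros i _; unfold sg; simpl; ring. }
  rewrite csum_add, csum_mul.
  assert (E := csum_recl (fun k => sg k * es l k * w ^ (S N - k))%Cx N).
  change (csum (fun k => sg k * es l k * w ^ (S N - k))%Cx (S N))
    with (csum (fun k => sg k * es l k * w ^ (S N - k))%Cx N
          + sg (S N) * es l (S N) * w ^ (S N - S N))%Cx in E.
  rewrite (es_over l (S N)) in E by (unfold N; lia).
  assert (F : csum (fun k => sg k * es l k * w ^ (S N - k))%Cx N
              = (w * csum (fun k => sg k * es l k * w ^ (N - k)) N)%Cx).
  { rewrite <- csum_mul; apply csum_ext; intros i Hi.
    replace (S N - i)%nat with (S (N - i)) by lia; simpl; ring. }
  rewrite F in E; rewrite es_0 in E; rewrite es_0.
  replace (csum (fun i => sg (S i) * es l (S i) * w ^ (S N - S i))%Cx N)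
    with (w * csum (fun k => sg k * es l k * w ^ (N - k)) N - sg 0 * C1 * w ^ (S N - 0))%Cx
    by (replace (w * csum (fun k => sg k * es l k * w ^ (N - k)) N)%Cx
          with (w * csum (fun k => sg k * es l k * w ^ (N - k)) N + sg (S N) * C0 * w ^ (S N - S N))%Cx
          by ring; rewrite E; ring).
  ring.
Qed.

(** By e_k(y :: l) = e_k(l) + y e_(k-1)(l) consecutive terms of the alternating sum cancel, leaving
    y e_k(l). *)
Lemma newton_telescope y l k :
  csum (fun i => sg i * y ^ S i * es (y :: l) (k - i))%Cx k = (y * es l k)%Cx.
Proof.
  induction k; [simpl; rewrite es_0; unfold sg; simpl; ring|].
  rewrite csum_recl.
  rewrite (csum_ext _ (fun i => (- y) * (sg i * y ^ S i * es (y :: l) (k - i)))%Cx).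
  - rewrite csum_mul, IHk; simpl; unfold sg; simpl; ring.
  - intros i _; replace (S k - S i)%nat with (k - i)%nat by lia; unfold sg; simpl; ring.
Qed.

Lemma RtoC_S k : RtoC (INR (S k)) = (RtoC (INR k) + C1)%Cx.
Proof. rewrite S_INR; unfold RtoC, Cadd, C1; simpl; f_equal; ring. Qed.

(** Induction on the list: the powers of the new root [y] give the telescoping sum, and the
    recursion of [es] splits the remainder into the identities for [l] at k and at k - 1. *)
Lemma newton_identity l k :
  (RtoC (INR (S k)) * es l (S k) = csum (fun i => sg i * es l (k - i) * ps l (S i)) k)%Cx.
Proof.
  revert k; induction l as [|y l IH]; intros k.
  - simpl es at 1; rewrite (csum_ext _ (fun _ => C0)).
    + rewrite csum_C0; ring.
    + intros i _; unfold ps; simpl; ring.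
  - rewrite (csum_ext _ (fun i => sg i * es (y :: l) (k - i) * ps l (S i)
                                + sg i * y ^ S i * es (y :: l) (k - i))%Cx).
    2:{ intros i _; unfold ps; simpl; ring. }
    rewrite csum_add, newton_telescope.
    destruct k as [|j].
    + assert (E := IH O); simpl csum in *; rewrite es_0 in *.
      replace (es (y :: l) 1) with (es l 1 + y * es l 0)%Cx by reflexivity.
      rewrite es_0; rewrite <- E, RtoC_S; simpl INR.
      replace (RtoC 0) with C0 by reflexivity; ring.
    + assert (E : csum (fun i => sg i * es (y :: l) (S j - i) * ps l (S i))%Cx (S j)
                  = (csum (fun i => sg i * es l (S j - i) * ps l (S i)) (S j)
                     + y * csum (fun i => sg i * es l (j - i) * ps l (S i)) j)%Cx).
      { rewrite <- csum_mul; simpl csum; rewrite Nat.sub_diag, !es_0.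
        rewrite (csum_ext (fun i => sg i * es (y :: l) match i with 0 => S j | S l0 => j - l0 end * ps l (S i))%Cx
                  (fun i => sg i * es l (match i with 0 => S j | S l0 => j - l0 end) * ps l (S i)
                            + y * (sg i * es l (j - i) * ps l (S i)))%Cx).
        - rewrite csum_add; ring.
        - intros i Hi; replace (match i with 0 => S j | S l0 => j - l0 end)%nat with (S (j - i))
            by (destruct i; lia); simpl es; ring. }
      rewrite E, <- !IH.
      replace (es (y :: l) (S (S j))) with (es l (S (S j)) + y * es l (S j))%Cx by reflexivity.
      rewrite (RtoC_S (S j)); ring.
Qed.

(** * Rational functions on the unit circle *)

Lemma polyfun_pow f k : polyfun f -> polyfun (fun z => f z ^ k)%Cx.
Proof.
  intros H; induction k; simpl; [apply polyfun_const|now apply (polyfun_mul f)].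
Qed.

Lemma polyfun_csum (f : nat -> Cx -> Cx) n :
  (forall i, polyfun (f i)) -> polyfun (fun z => csum (fun i => f i z) n).
Proof.
  intros H; induction n; simpl; [apply H|].
  apply (polyfun_add (fun z => csum (fun i => f i z) n)); [exact IHn|apply H].
Qed.

Lemma polyfun_poly1 c m : polyfun (poly1 c m).
Proof.
  apply (polyfun_csum (fun i z => c i * z ^ i)%Cx); intros i.
  apply (polyfun_mul (fun _ => c i)); [apply polyfun_const|apply (polyfun_pow (fun z => z)), polyfun_id].
Qed.

(** On the circle conj(z) = 1/z, so a large enough power z^d clears the denominators of
    conj(f(z)). *)
Lemma polyfun_conj f : polyfun f ->
  exists g d, polyfun g /\ forall z, Cmod z = 1 -> g z = (z ^ d * Cconj (f z))%Cx.
Proof.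
  intros H; induction H as [c| |f g _ [f' [d [Hf Ef]]] _ [g' [e [Hg Eg]]]
                           |f g _ [f' [d [Hf Ef]]] _ [g' [e [Hg Eg]]]].
  - exists (fun _ => Cconj c), O; split; [apply polyfun_const|intros; simpl; ring].
  - exists (fun _ => C1), 1%nat; split; [apply polyfun_const|].
    intros z Hz; transitivity (z * Cconj z)%Cx; [symmetry; now apply Cmul_conj_unit|simpl; ring].
  - exists (fun z => f' z * z ^ e + g' z * z ^ d)%Cx, (d + e)%nat; split.
    + apply (polyfun_add (fun z => f' z * z ^ e)%Cx); apply polyfun_mul; try assumption;
        apply (polyfun_pow (fun z => z)), polyfun_id.
    + intros z Hz; rewrite Ef, Eg, Cconj_add, Cpow_add by exact Hz; ring.
  - exists (fun z => f' z * g' z)%Cx, (d + e)%nat; split; [now apply polyfun_mul|].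
    intros z Hz; rewrite Ef, Eg, Cconj_mul, Cpow_add by exact Hz; ring.
Qed.

(* Restrictions to the unit circle of rational functions without poles there. *)
Definition ratT (f : Cx -> Cx) : Prop :=
  exists N D, polyfun N /\ polyfun D /\
    forall z, Cmod z = 1 -> D z <> C0 /\ (f z * D z)%Cx = N z.

Lemma ratT_ext f g : (forall z, Cmod z = 1 -> f z = g z) -> ratT f -> ratT g.
Proof.
  intros E [N [D [HN [HD H]]]]; exists N, D; repeat split; try assumption; [apply H; assumption|].
  rewrite <- E by assumption; now apply H.
Qed.

Lemma ratT_poly f : polyfun f -> ratT f.
Proof.
  intros H; exists f, (fun _ => C1); repeat split; [exact H|apply polyfun_const|apply C1_neq_C0|ring].
Qed.

Lemma ratT_const c : ratT (fun _ => c).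
Proof. apply ratT_poly, polyfun_const. Qed.

Lemma ratT_add f g : ratT f -> ratT g -> ratT (fun z => f z + g z)%Cx.
Proof.
  intros [N [D [HN [HD H]]]] [N' [D' [HN' [HD' H']]]].
  exists (fun z => N z * D' z + N' z * D z)%Cx, (fun z => D z * D' z)%Cx.
  split; [apply (polyfun_add (fun z => N z * D' z)%Cx); now apply polyfun_mul|].
  split; [now apply polyfun_mul|]; intros z Hz.
  destruct (H z Hz) as [K E], (H' z Hz) as [K' E']; split; [now apply Cmul_neq0|].
  rewrite <- E, <- E'; ring.
Qed.

Lemma ratT_mul f g : ratT f -> ratT g -> ratT (fun z => f z * g z)%Cx.
Proof.
  intros [N [D [HN [HD H]]]] [N' [D' [HN' [HD' H']]]].
  exists (fun z => N z * N' z)%Cx, (fun z => D z * D' z)%Cx.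
  split; [now apply polyfun_mul|].
  split; [now apply polyfun_mul|]; intros z Hz.
  destruct (H z Hz) as [K E], (H' z Hz) as [K' E']; split; [now apply Cmul_neq0|].
  rewrite <- E, <- E'; ring.
Qed.

Lemma ratT_sub f g : ratT f -> ratT g -> ratT (fun z => f z - g z)%Cx.
Proof.
  intros Hf Hg; apply (ratT_ext (fun z => f z + (- C1) * g z)%Cx); [intros; ring|].
  apply ratT_add; [exact Hf|apply (ratT_mul (fun _ => - C1)%Cx); [apply ratT_const|exact Hg]].
Qed.

Lemma ratT_csum (f : nat -> Cx -> Cx) n :
  (forall i, (i <= n)%nat -> ratT (f i)) -> ratT (fun z => csum (fun i => f i z) n).
Proof.
  intros H; induction n; simpl; [apply H; lia|].
  apply (ratT_add (fun z => csum (fun i => f i z) n)); [apply IHn; intros; apply H; lia|apply H; lia].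
Qed.

Lemma ratT_conj f : ratT f -> ratT (fun z => Cconj (f z)).
Proof.
  intros [N [D [HN [HD H]]]].
  destruct (polyfun_conj N HN) as [N' [d [HN' EN]]]; destruct (polyfun_conj D HD) as [D' [e [HD' ED]]].
  exists (fun z => N' z * z ^ e)%Cx, (fun z => D' z * z ^ d)%Cx.
  split; [apply polyfun_mul; [exact HN'|apply (polyfun_pow (fun z => z)), polyfun_id]|].
  split; [apply polyfun_mul; [exact HD'|apply (polyfun_pow (fun z => z)), polyfun_id]|].
  intros z Hz; destruct (H z Hz) as [K E]; rewrite EN, ED by exact Hz; split.
  - apply Cmul_neq0; [apply Cmul_neq0|]; try (apply Cpow_neq0, unit_neq0, Hz).
    intros F; apply K, Cmod_eq0; rewrite <- Cmod_conj, F; apply Cmod_C0.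
  - rewrite <- E, Cconj_mul; ring.
Qed.

(** Newton's identity has coefficient plus or minus 1 at the highest power sum and can be solved for
    it. *)
Lemma ratT_ps_of_es (L : Cx -> list Cx) :
  (forall k, ratT (fun z => es (L z) k)) -> forall k, ratT (fun z => ps (L z) (S k)).
Proof.
  intros H k; enough (G : forall i, (i <= k)%nat -> ratT (fun z => ps (L z) (S i))) by (apply G; lia).
  induction k as [|k IH]; intros i Hi.
  - replace i with O by lia; apply (ratT_ext (fun z => es (L z) 1)); [|apply H].
    intros z _; assert (E := newton_identity (L z) 0); simpl csum in E; rewrite es_0, RtoC_S in E.
    simpl INR in E; replace (RtoC 0) with C0 in E by reflexivity; unfold sg in E; simpl in E.
    replace (es (L z) 1) with ((C0 + C1) * es (L z) 1)%Cx by ring; rewrite E; ring.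
  - destruct (Nat.eq_dec i (S k)) as [->|]; [|apply IH; lia].
    apply (ratT_ext (fun z => sg (S k) * (RtoC (INR (S (S k))) * es (L z) (S (S k))
             - csum (fun i => sg i * es (L z) (S k - i) * ps (L z) (S i)) k))%Cx).
    + intros z _; rewrite newton_identity.
      change (csum (fun i0 => sg i0 * es (L z) (S k - i0) * ps (L z) (S i0))%Cx (S k))
        with (csum (fun i0 => sg i0 * es (L z) (S k - i0) * ps (L z) (S i0))%Cx k
              + sg (S k) * es (L z) (S k - S k) * ps (L z) (S (S k)))%Cx.
      rewrite Nat.sub_diag, es_0.
      transitivity ((sg (S k) * sg (S k)) * ps (L z) (S (S k)))%Cx; [ring|rewrite sg_sqr; ring].
    + apply (ratT_mul (fun _ => sg (S k))); [apply ratT_const|apply ratT_sub].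
      * apply (ratT_mul (fun _ => RtoC (INR (S (S k))))); [apply ratT_const|apply H].
      * apply (ratT_csum (fun i z => sg i * es (L z) (S k - i) * ps (L z) (S i))%Cx).
        intros j Hj; apply ratT_mul; [|now apply IH].
        apply (ratT_mul (fun _ => sg j)); [apply ratT_const|apply H].
Qed.

(** Newton's identity solved for the highest e_k, dividing by the index, which is invertible in
    characteristic zero. *)
Lemma ratT_es_of_ps (L : Cx -> list Cx) :
  (forall k, ratT (fun z => ps (L z) (S k))) -> forall k, ratT (fun z => es (L z) k).
Proof.
  intros H k; enough (G : forall i, (i <= k)%nat -> ratT (fun z => es (L z) i)) by (apply G; lia).
  induction k as [|k IH]; intros i Hi.
  - replace i with O by lia; apply (ratT_ext (fun _ => C1)); [intros; symmetry; apply es_0|apply ratT_const].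
  - destruct (Nat.eq_dec i (S k)) as [->|]; [|apply IH; lia].
    apply (ratT_ext (fun z => RtoC (/ INR (S k))
             * csum (fun i => sg i * es (L z) (k - i) * ps (L z) (S i)) k)%Cx).
    + intros z _; rewrite <- newton_identity.
      transitivity ((RtoC (/ INR (S k)) * RtoC (INR (S k))) * es (L z) (S k))%Cx; [ring|].
      replace (RtoC (/ INR (S k)) * RtoC (INR (S k)))%Cx with C1; [ring|].
      assert (N : INR (S k) <> 0) by (apply not_0_INR; lia).
      unfold RtoC, Cmul, C1; cbn [fst snd]; f_equal; field; exact N.
    + apply (ratT_mul (fun _ => RtoC (/ INR (S k)))); [apply ratT_const|].
      apply (ratT_csum (fun i z => sg i * es (L z) (k - i) * ps (L z) (S i))%Cx).
      intros j Hj; apply ratT_mul; [|apply H].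
      apply (ratT_mul (fun _ => sg j)); [apply ratT_const|apply IH; lia].
Qed.

(** * Symmetric functions of the numbers 1 - x conj(y) *)

Lemma csuml_add f g l : csuml (fun x => f x + g x)%Cx l = (csuml f l + csuml g l)%Cx.
Proof. induction l; simpl; [ring|rewrite IHl; ring]. Qed.

Lemma csuml_mul k f l : csuml (fun x => k * f x)%Cx l = (k * csuml f l)%Cx.
Proof. induction l; simpl; [ring|rewrite IHl; ring]. Qed.

Lemma csuml_ext f g l : (forall x, f x = g x) -> csuml f l = csuml g l.
Proof. intros H; induction l; simpl; [reflexivity|rewrite IHl, H; reflexivity]. Qed.

Lemma csuml_app f l l' : csuml f (l ++ l') = (csuml f l + csuml f l')%Cx.
Proof. induction l; simpl; [ring|rewrite IHl; ring]. Qed.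

Lemma csuml_conj f l : Cconj (csuml f l) = csuml (fun x => Cconj (f x)) l.
Proof.
  induction l; simpl; [unfold Cconj, C0; simpl; f_equal; ring|rewrite Cconj_add, IHl; reflexivity].
Qed.

Lemma csuml_map f (g : Cx -> Cx) l : csuml f (map g l) = csuml (fun x => f (g x)) l.
Proof. induction l; simpl; [reflexivity|rewrite IHl; reflexivity]. Qed.

Lemma csuml_flat_map f (g : Cx -> list Cx) l :
  csuml f (flat_map g l) = csuml (fun x => csuml f (g x)) l.
Proof. induction l; simpl; [reflexivity|rewrite csuml_app, IHl; reflexivity]. Qed.

Definition pairs (l : list Cx) : list Cx :=
  flat_map (fun x => map (fun y => C1 - x * Cconj y)%Cx l) l.

Lemma in_pairs l z : In z (pairs l) <-> exists x y, In x l /\ In y l /\ z = (C1 - x * Cconj y)%Cx.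
Proof.
  unfold pairs; rewrite in_flat_map; split.
  - intros [x [Hx K]]; apply in_map_iff in K; destruct K as [y [E Hy]]; exists x, y; auto.
  - intros [x [y [Hx [Hy E]]]]; exists x; split; [exact Hx|]; apply in_map_iff; exists y; auto.
Qed.

Lemma length_pairs l : length (pairs l) = (length l * length l)%nat.
Proof.
  unfold pairs; generalize l at 2 3; intros l'; induction l' as [|x l' IH]; simpl; [reflexivity|].
  rewrite length_app, length_map, IH; reflexivity.
Qed.

(** A double sum of x^a conj(y)^b factors into a power sum times a conjugate power sum. The
    exponents a and b are general so that expanding one factor 1 - x conj(y) shifts both and the
    induction on k closes. *)
Lemma ratT_ps_pairs (L : Cx -> list Cx) :
  (forall k, ratT (fun z => ps (L z) k)) -> forall k, ratT (fun z => ps (pairs (L z)) k).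
Proof.
  intros H k.
  assert (G : forall a b, ratT (fun z => csuml (fun x => csuml (fun y =>
            (x ^ a * (Cconj y) ^ b) * (C1 - x * Cconj y) ^ k)%Cx (L z)) (L z))).
  { induction k as [|k IH]; intros a b.
    - apply (ratT_ext (fun z => ps (L z) a * Cconj (ps (L z) b))%Cx).
      + intros z _; unfold ps; rewrite csuml_conj.
        transitivity (csuml (fun x => csuml (fun y => Cconj (y ^ b)) (L z) * x ^ a)%Cx (L z)).
        * rewrite csuml_mul; ring.
        * apply csuml_ext; intros x.
          replace (csuml (fun y => Cconj (y ^ b)%Cx) (L z) * x ^ a)%Cx
            with (x ^ a * csuml (fun y => Cconj (y ^ b)%Cx) (L z))%Cx by ring.
          rewrite <- csuml_mul; apply csuml_ext; intros y; rewrite Cconj_pow; simpl; ring.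
      + apply ratT_mul; [apply H|apply ratT_conj, H].
    - apply (ratT_ext _ _ (fun z _ => eq_refl)).
      eapply ratT_ext; [|apply (ratT_sub _ _ (IH a b) (IH (S a) (S b)))].
      intros z _; simpl.
      match goal with |- (?x - ?y)%Cx = _ => replace (x - y)%Cx with (x + (- C1) * y)%Cx by ring end.
      rewrite <- csuml_mul, <- csuml_add; apply csuml_ext; intros x.
      rewrite <- csuml_mul, <- csuml_add; apply csuml_ext; intros y; ring. }
  eapply ratT_ext; [|apply (G O O)].
  intros z _; unfold ps, pairs; rewrite csuml_flat_map; apply csuml_ext; intros x.
  rewrite csuml_map; apply csuml_ext; intros y; simpl; ring.
Qed.

Lemma poly1_all0 c m : (forall w, poly1 c m w = C0) -> forall i, (i <= m)%nat -> c i = C0.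
Proof.
  intros H; destruct (poly1_factor c m) as [Z|[A [l [HA [_ [_ E]]]]]]; [exact Z|exfalso].
  (* [M] exceeds the modulus of every root, so the factored polynomial cannot vanish there. *)
  set (M := fold_right (fun x acc => Cmod x + acc) 1 l).
  assert (HM : 1 <= M /\ forall x, In x l -> Cmod x < M).
  { unfold M; clear; induction l as [|y l [I1 I2]]; simpl; [split; [lra|tauto]|].
    assert (Hy := Cmod_ge0 y); split; [lra|]; intros x [<-|Hx]; [lra|specialize (I2 x Hx); lra]. }
  specialize (H (RtoC M)); rewrite E in H; apply Cmul_integral in H; destruct H as [H|H]; [contradiction|].
  apply cprodl_eq0 in H; apply HM in H; rewrite Cmod_RtoC, Rabs_pos_eq in H; lra.
Qed.

Lemma poly1_ident c d m : (forall w, poly1 c m w = poly1 d m w) ->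
  forall i, (i <= m)%nat -> c i = d i.
Proof.
  intros H i Hi; apply Csub_eq0; revert i Hi; apply (poly1_all0 (fun i => c i - d i)%Cx).
  intros w; specialize (H w); unfold poly1 in *.
  transitivity (csum (fun i => c i * w ^ i)%Cx m + (- C1) * csum (fun i => d i * w ^ i) m)%Cx.
  - rewrite <- csum_mul, <- csum_add; apply csum_ext; intros; ring.
  - rewrite H; ring.
Qed.

(** Vieta: e_k is, up to sign, a coefficient of p~ over the leading one, and the latter has no zero
    on the circle by [lead_refl_neq0]. *)
Lemma ratT_es_roots a m n (L : Cx -> list Cx) : stable a m n ->
  (forall z, Cmod z = 1 -> root_spec a m n z (L z)) -> forall k, ratT (fun z => es (L z) k).
Proof.
  intros Hs HL k; destruct (Compare_dec.le_dec k m) as [Hk|Hk].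
  - exists (fun z => sg k * col (refl_coef a m n) n (m - k) z)%Cx, (col (refl_coef a m n) n m).
    split; [apply (polyfun_mul (fun _ => sg k)); [apply polyfun_const|apply polyfun_poly1]|].
    split; [apply polyfun_poly1|]; intros z Hz; split; [now apply lead_refl_neq0|].
    destruct (HL z Hz) as [Hl [E _]].
    set (A := col (refl_coef a m n) n m z) in *.
    assert (K : col (refl_coef a m n) n (m - k) z = (A * (sg (m - (m - k)) * es (L z) (m - (m - k))))%Cx).
    { apply (poly1_ident (fun i => col (refl_coef a m n) n i z)
               (fun i => A * (sg (m - i) * es (L z) (m - i)))%Cx m); [|lia].
      intros w; rewrite <- peval_col, E, cprodl_es, Hl, <- csum_mul, <- csum_rev.
      apply csum_ext; intros i Hi; replace (m - (m - i))%nat with i by lia; ring. }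
    rewrite K; replace (m - (m - k))%nat with k by lia.
    transitivity ((sg k * sg k) * (A * es (L z) k))%Cx; [rewrite sg_sqr; ring|ring].
  - apply (ratT_ext (fun _ => C0)); [|apply ratT_const].
    intros z Hz; destruct (HL z Hz) as [Hl _]; symmetry; apply es_over; lia.
Qed.

(** The passage from the roots to the pairs is easy for power sums only, so Newton's identities are
    used once in each direction. *)
Lemma ratT_es_pairs a m n (L : Cx -> list Cx) : stable a m n ->
  (forall z, Cmod z = 1 -> root_spec a m n z (L z)) -> forall k, ratT (fun z => es (pairs (L z)) k).
Proof.
  intros Hs HL; apply ratT_es_of_ps; intros k; apply ratT_ps_pairs; intros [|j].
  - apply (ratT_ext (fun _ => RtoC (INR m))); [|apply ratT_const].
    intros z Hz; destruct (HL z Hz) as [Hl _]; rewrite <- Hl; unfold ps.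
    clear; induction (L z) as [|x l IH]; [reflexivity|].
    simpl length; rewrite RtoC_S, IH; simpl; ring.
  - apply ratT_ps_of_es; now apply (ratT_es_roots a m n).
Qed.

(** * Orders of vanishing *)

Definition has_order (tau : Cx) (f : Cx -> Cx) (v : nat) : Prop :=
  exists c C d, 0 < c /\ 0 < C /\ 0 < d /\ forall z, Cmod (z - tau)%Cx < d ->
    c * Cmod (z - tau)%Cx ^ v <= Cmod (f z) <= C * Cmod (z - tau)%Cx ^ v.

Lemma has_order_mul tau f g v w : has_order tau f v -> has_order tau g w ->
  has_order tau (fun z => f z * g z)%Cx (v + w).
Proof.
  intros [c [C [d [Hc [HC [Hd H]]]]]] [c' [C' [d' [Hc' [HC' [Hd' H']]]]]].
  exists (c * c'), (C * C'), (Rmin d d').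
  repeat split; try (apply Rmult_lt_0_compat; assumption); try (apply Rmin_glb_lt; assumption);
    specialize (H z (Rlt_le_trans _ _ _ H0 (Rmin_l _ _)));
    specialize (H' z (Rlt_le_trans _ _ _ H0 (Rmin_r _ _)));
    rewrite Cmod_mul, pow_add; set (t := Cmod (z - tau)%Cx) in *;
    assert (T1 : 0 <= t ^ v) by (apply pow_le, Cmod_ge0);
    assert (T2 : 0 <= t ^ w) by (apply pow_le, Cmod_ge0).
  - replace (c * c' * (t ^ v * t ^ w)) with ((c * t ^ v) * (c' * t ^ w)) by ring.
    apply Rmult_le_compat; try apply Rmult_le_pos; lra.
  - replace (C * C' * (t ^ v * t ^ w)) with ((C * t ^ v) * (C' * t ^ w)) by ring.
    apply Rmult_le_compat; try apply Cmod_ge0; lra.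
Qed.

Lemma has_order_const tau c : c <> C0 -> has_order tau (fun _ => c) 0.
Proof.
  intros H; apply Cmod_gt0 in H; exists (Cmod c), (Cmod c), 1; repeat split; simpl; lra.
Qed.

Lemma has_order_linear tau x : exists v, has_order tau (fun z => z - x)%Cx v.
Proof.
  destruct (classic (x = tau)) as [->|N].
  - exists 1%nat, 1, 1, 1; repeat split; simpl; lra.
  - assert (P : 0 < Cmod (tau - x)%Cx) by (apply Cmod_gt0; intros E; apply N; symmetry; apply Csub_eq0, E).
    exists O, (Cmod (tau - x)%Cx / 2), (2 * Cmod (tau - x)%Cx), (Cmod (tau - x)%Cx / 2).
    repeat split; try lra; simpl.
    + assert (T := Cmod_sub_ge (tau - x)%Cx (tau - z)%Cx).
      replace (tau - x - (tau - z))%Cx with (z - x)%Cx in T by ring; rewrite (Cmod_sub_sym tau z) in T; lra.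
    + assert (T := Cmod_add (z - tau)%Cx (tau - x)%Cx).
      replace (z - tau + (tau - x))%Cx with (z - x)%Cx in T by ring; lra.
Qed.

Lemma polyfun_order tau f : polyfun f -> (forall z, f z = C0) \/ exists v, has_order tau f v.
Proof.
  intros H; destruct (ComplexRoots.polyfun_coefs f H) as [c [m E]].
  destruct (poly1_factor c m) as [Z|[A [l [HA [_ [_ F]]]]]].
  - left; intros z; rewrite E, <- (csum_C0 m); apply csum_ext; intros i Hi; rewrite Z by exact Hi; ring.
  - right; replace f with (fun z => A * cprodl (fun x => z - x) l)%Cx
      by (apply functional_extensionality; intros z; rewrite E; symmetry; apply F).
    assert (K : exists v, has_order tau (fun z => cprodl (fun x => z - x)%Cx l) v).
    { clear; induction l as [|x l [v IH]]; [exists O; apply (has_order_const tau C1), C1_neq_C0|].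
      destruct (has_order_linear tau x) as [w Hw]; exists (w + v)%nat; simpl; now apply has_order_mul. }
    destruct K as [v Hv]; exists (0 + v)%nat; apply has_order_mul; [now apply has_order_const|exact Hv].
Qed.

Definition circ_order (tau : Cx) (f : Cx -> Cx) (v : nat) : Prop :=
  exists c C d, 0 < c /\ 0 < C /\ 0 < d /\ forall z, Cmod z = 1 -> Cmod (z - tau)%Cx < d ->
    c * Cmod (z - tau)%Cx ^ v <= Cmod (f z) <= C * Cmod (z - tau)%Cx ^ v.

(** The denominator does not vanish at [tau] and so has order 0 there; the order of the quotient is
    that of the numerator. *)
Lemma ratT_order tau f : Cmod tau = 1 -> ratT f ->
  (forall z, Cmod z = 1 -> f z = C0) \/ exists v, circ_order tau f v.
Proof.
  intros Ht [N [D [HN [HD H]]]].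
  destruct (polyfun_order tau N HN) as [Z|[v Hv]].
  - left; intros z Hz; destruct (H z Hz) as [K E]; rewrite Z in E.
    apply Cmul_integral in E; tauto.
  - right; exists v; destruct Hv as [c [C [d [Hc [HC [Hd K]]]]]].
    destruct (H tau Ht) as [Dt _].
    destruct (polyfun_order tau D HD) as [Z|[w Hw]]; [elim Dt; apply Z|].
    destruct Hw as [c' [C' [d' [Hc' [HC' [Hd' K']]]]]].
    destruct w as [|w].
    2:{ elim Dt; apply Cmod_eq0; specialize (K' tau); replace (tau - tau)%Cx with C0 in K' by ring.
        rewrite Cmod_C0 in K'; specialize (K' Hd'); simpl in K'.
        assert (P := Cmod_ge0 (D tau)); lra. }
    exists (c / C'), (C / c'), (Rmin d d').
    split; [apply Rdiv_lt_0_compat; assumption|split; [apply Rdiv_lt_0_compat; assumption|]].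
    split; [apply Rmin_glb_lt; assumption|]; intros z Hz Hlt.
    specialize (K z (Rlt_le_trans _ _ _ Hlt (Rmin_l _ _)));
      specialize (K' z (Rlt_le_trans _ _ _ Hlt (Rmin_r _ _))); simpl in K'.
    destruct (H z Hz) as [_ E]; rewrite <- E, Cmod_mul in K.
    set (t := Cmod (z - tau)%Cx ^ v) in *.
    assert (F := Cmod_ge0 (f z)); split.
    + apply Rmult_le_reg_r with C'; [lra|]; replace (c / C' * t * C') with (c * t) by (field; lra); nra.
    + apply Rmult_le_reg_r with c'; [lra|]; replace (C / c' * t * c') with (C * t) by (field; lra); nra.
Qed.

(** * Existence of the contact order *)

(** Divided by the product of all entries, e_k becomes e_j of the reciprocals: at most 2^N products
    of j numbers of modulus at most 1/mu, with N the length. The induction is arranged without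
    division. *)
Lemma es_bound l mu : 0 <= mu -> (forall x, In x l -> mu <= Cmod x) ->
  forall k j, (k + j = length l)%nat ->
  Cmod (es l k) * mu ^ j <= 2 ^ length l * Cmod (cprodl (fun x => x) l).
Proof.
  intros Hmu; induction l as [|x l IH]; intros Hl k j Hk; simpl in Hk.
  - destruct k, j; try lia; simpl; rewrite Cmod_C1; lra.
  - specialize (IH (fun y Hy => Hl y (or_intror Hy))); specialize (Hl x (or_introl eq_refl)).
    simpl length; simpl cprodl; simpl pow; rewrite Cmod_mul.
    set (P := 2 ^ length l * Cmod (cprodl (fun x => x) l)) in *.
    assert (HP : 0 <= P) by (apply Rmult_le_pos; [apply pow_le; lra|apply Cmod_ge0]).
    replace (2 * 2 ^ length l * (Cmod x * Cmod (cprodl (fun x0 => x0) l)))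
      with (2 * (Cmod x * P)) by (unfold P; ring).
    assert (T1 : forall k' j', (k' + j' = length l)%nat -> Cmod (es l k') * mu ^ S j' <= Cmod x * P).
    { intros k' j' E; replace (Cmod (es l k') * mu ^ S j') with (mu * (Cmod (es l k') * mu ^ j')) by (simpl; ring).
      apply Rmult_le_compat; [exact Hmu| |exact Hl|now apply IH].
      apply Rmult_le_pos; [apply Cmod_ge0|now apply pow_le]. }
    assert (HxP : 0 <= Cmod x * P) by (apply Rmult_le_pos; [apply Cmod_ge0|exact HP]).
    destruct k as [|k].
    + rewrite es_0; rewrite <- (es_0 l); destruct j; [lia|].
      specialize (T1 O j ltac:(lia)); lra.
    + simpl es.
      assert (T2 : Cmod (x * es l k)%Cx * mu ^ j <= Cmod x * P).
      { rewrite Cmod_mul, Rmult_assoc; apply Rmult_le_compat_l; [apply Cmod_ge0|apply IH; lia]. }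
      assert (T3 : Cmod (es l (S k)) * mu ^ j <= Cmod x * P).
      { destruct j; [rewrite es_over, Cmod_C0 by lia; simpl; lra|apply T1; lia]. }
      assert (T4 := Cmod_add (es l (S k)) (x * es l k)%Cx).
      assert (T5 : 0 <= mu ^ j) by now apply pow_le.
      nra.
Qed.

(** Evaluating the monic polynomial with these roots at the root [x0] expresses e_N through the
    lower e_j. Together with [es_bound] this determines the smallest modulus up to constants from
    the sizes |e_j|. *)
Lemma es_root_bound l M x0 : length l = S M -> In x0 l ->
  Cmod (es l (S M)) <= sum_f_R0 (fun j => Cmod (es l j) * Cmod x0 ^ (S M - j)) M.
Proof.
  intros Hl Hx; apply cprodl_eq0 in Hx; rewrite cprodl_es, Hl in Hx.
  change (csum (fun k => sg k * es l k * x0 ^ (S M - k))%Cx M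
          + sg (S M) * es l (S M) * x0 ^ (S M - S M) = C0)%Cx in Hx.
  rewrite Nat.sub_diag in Hx; simpl (x0 ^ 0)%Cx in Hx.
  assert (Hs : forall k, Cmod (sg k) = 1).
  { intros k; unfold sg; rewrite Cmod_pow, Cmod_opp, Cmod_C1; apply pow1. }
  assert (E : (sg (S M) * es l (S M))%Cx
              = (- csum (fun k => sg k * es l k * x0 ^ (S M - k)) M)%Cx).
  { set (c := csum _ M) in *; replace (- c)%Cx with (- c + C0)%Cx by ring; rewrite <- Hx; ring. }
  apply (f_equal Cmod) in E; rewrite Cmod_mul, Hs, Rmult_1_l, Cmod_opp in E; rewrite E.
  eapply Rle_trans; [apply Cmod_csum|]; right; apply sum_eq; intros i _.
  rewrite !Cmod_mul, Hs, Cmod_pow; ring.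
Qed.

Lemma Rpower_pos x y : 0 < Rpower x y.
Proof. apply exp_pos. Qed.

Lemma Rpower_decr t x y : 0 < t < 1 -> y <= x -> Rpower t x <= Rpower t y.
Proof.
  intros Ht H; assert (L : ln t < 0) by (rewrite <- ln_1; apply ln_increasing; lra).
  unfold Rpower; destruct (Req_dec x y) as [->|]; [lra|]; left; apply exp_increasing; nra.
Qed.

Lemma root_le x y k : 0 < x -> (1 <= k)%nat -> x ^ k <= y -> x <= Rpower y (/ INR k).
Proof.
  intros Hx Hk H; assert (Pk : 0 < INR k) by (apply lt_0_INR; lia).
  replace x with (Rpower (x ^ k) (/ INR k)).
  - apply Rle_Rpower_l; [left; now apply Rinv_0_lt_compat|split; [now apply pow_lt|exact H]].
  - rewrite <- Rpower_pow, Rpower_mult by exact Hx.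
    replace (INR k * / INR k) with 1 by (field; lra); now apply Rpower_1.
Qed.

(* Newton polygon: if the coefficients have orders v_j at tau, the smallest root has
   the order max_j (v_N - v_j) / (N - j); K is this maximum over the indices treated so far. *)
Lemma newton_polygon tau M (E : nat -> Cx -> Cx) (mu : Cx -> R) B d0 :
  Cmod tau = 1 -> 0 < B -> 0 < d0 -> (forall z, E O z = C1) -> (forall j, ratT (E j)) ->
  (forall z, Cmod z = 1 -> 0 < Cmod (z - tau)%Cx < d0 ->
     0 < mu z /\ E (S M) z <> C0 /\
     (forall j, (j <= M)%nat -> Cmod (E j z) * mu z ^ (S M - j) <= B * Cmod (E (S M) z)) /\
     Cmod (E (S M) z) <= B * sum_f_R0 (fun j => Cmod (E j z) * mu z ^ (S M - j)) M) ->
  exists K c C d, 0 < c /\ 0 < C /\ 0 < d /\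
    forall z, Cmod z = 1 -> 0 < Cmod (z - tau)%Cx < d ->
      c * Rpower (Cmod (z - tau)%Cx) K <= mu z <= C * Rpower (Cmod (z - tau)%Cx) K.
Proof.
  intros Ht HB Hd0 E0 HE H; set (N := S M) in *.
  destruct (ratT_order tau (E N) Ht (HE N)) as [Z|[v0 [c0 [C0' [d1 [Hc0 [HC0 [Hd1 HN]]]]]]]].
  (* If the last coefficient vanished on the whole circle, the hypothesis that it is nonzero near
     tau would have no instance, so any constants serve. *)
  { exists 0, 1, 1, d0; repeat split; try lra; intros; exfalso; now apply (H z H0 H1), Z. }
  (* Invariant: the slope K found so far bounds [mu] from above, and with this K each treated term
     |E_i| t^((N-i)K) is dominated by |E_N|. *)
  set (P := fun j => exists K C C' d, 0 < C /\ 0 < C' /\ 0 < d <= 1 /\ d <= d0 /\ d <= d1 /\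
    forall z, Cmod z = 1 -> 0 < Cmod (z - tau)%Cx < d ->
      mu z <= C * Rpower (Cmod (z - tau)%Cx) K /\
      forall i, (i <= j)%nat -> Cmod (E i z) * Rpower (Cmod (z - tau)%Cx) (INR (N - i) * K)
                                <= C' * Cmod (E N z)).
  assert (HP : forall j, (j <= M)%nat -> P j).
  { induction j as [|j IH]; intros Hj.
    (* The constant coefficient E_0 = 1 gives the first slope v0 / N. *)
    - exists (INR v0 / INR N), (Rpower (B * C0') (/ INR N)), (/ c0), (Rmin 1 (Rmin d0 d1)).
      assert (HN0 : 0 < INR N) by (apply lt_0_INR; unfold N; lia).
      split; [apply Rpower_pos|split; [now apply Rinv_0_lt_compat|]].
      split; [split; [repeat apply Rmin_glb_lt; lra|apply Rmin_l]|].
      split; [eapply Rle_trans; [apply Rmin_r|apply Rmin_l]|].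
      split; [eapply Rle_trans; [apply Rmin_r|apply Rmin_r]|].
      intros z Hz [Hz1 Hz2].
      assert (Z0 : Cmod (z - tau)%Cx < d0)
        by (eapply Rlt_le_trans; [exact Hz2|eapply Rle_trans; [apply Rmin_r|apply Rmin_l]]).
      assert (Z1 : Cmod (z - tau)%Cx < d1)
        by (eapply Rlt_le_trans; [exact Hz2|eapply Rle_trans; [apply Rmin_r|apply Rmin_r]]).
      destruct (H z Hz (conj Hz1 Z0)) as [Hmu [HEN [H1 H2]]]; specialize (HN z Hz Z1).
      set (t := Cmod (z - tau)%Cx) in *; split.
      + assert (K := H1 O ltac:(lia)); rewrite E0, Cmod_C1, Nat.sub_0_r, Rmult_1_l in K.
        replace (Rpower (B * C0') (/ INR N) * Rpower t (INR v0 / INR N))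
          with (Rpower (B * C0' * t ^ v0) (/ INR N)).
        * apply root_le; [exact Hmu|unfold N; lia|]; eapply Rle_trans; [exact K|].
          rewrite Rmult_assoc; apply Rmult_le_compat_l; lra.
        * rewrite <- Rpower_mult_distr; [|nra|now apply pow_lt].
          rewrite <- (Rpower_pow v0 t) by exact Hz1; rewrite Rpower_mult; reflexivity.
      + intros i Hi; replace i with O by lia; rewrite E0, Cmod_C1, Nat.sub_0_r, Rmult_1_l.
        replace (INR N * (INR v0 / INR N)) with (INR v0) by (field; lra).
        rewrite Rpower_pow by exact Hz1.
        apply Rmult_le_reg_l with c0; [lra|].
        replace (c0 * (/ c0 * Cmod (E N z))) with (Cmod (E N z)) by (field; lra); lra.
    - destruct (IH ltac:(lia)) as [K [C [C' [d [HC [HC' [Hd [Hdd0 [Hdd1 HK]]]]]]]]].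
      destruct (ratT_order tau (E (S j)) Ht (HE (S j))) as [Z|[v [cv [Cv [d2 [Hcv [HCv [Hd2 Hv]]]]]]]].
      (* A coefficient that is identically zero on the circle leaves the slope unchanged. *)
      { exists K, C, C', d; repeat split; try tauto; destruct (HK z H0 H1) as [G1 G2]; [exact G1|].
        intros i Hi; destruct (Nat.eq_dec i (S j)) as [->|]; [|apply G2; lia].
        rewrite Z, Cmod_C0, Rmult_0_l by exact H0; apply Rmult_le_pos; [lra|apply Cmod_ge0]. }
      set (k := (N - S j)%nat); assert (Hk : (1 <= k)%nat) by (unfold k, N; lia).
      assert (Pk : 0 < INR k) by (apply lt_0_INR; lia).
      (* Slope at which the term of index [S j] balances the last one: v + (N - S j) K' = v0. *)
      set (K' := (INR v0 - INR v) / INR k).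
      assert (EK : INR v + INR k * K' = INR v0) by (unfold K'; field; lra).
      assert (Top : forall z, Cmod z = 1 -> 0 < Cmod (z - tau)%Cx < Rmin d d2 -> forall K1, K' <= K1 ->
                Cmod (E (S j) z) * Rpower (Cmod (z - tau)%Cx) (INR k * K1) <= Cv / c0 * Cmod (E N z)).
      { intros z Hz [Hz1 Hz2] K1 HK1.
        assert (Zd : Cmod (z - tau)%Cx < d) by (eapply Rlt_le_trans; [exact Hz2|apply Rmin_l]).
        specialize (HN z Hz ltac:(lra)).
        specialize (Hv z Hz (Rlt_le_trans _ _ _ Hz2 (Rmin_r _ _))).
        set (t := Cmod (z - tau)%Cx) in *.
        apply Rle_trans with (Cv * t ^ v * Rpower t (INR k * K')).
        - apply Rmult_le_compat; [apply Cmod_ge0|left; apply Rpower_pos|lra|].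
          apply Rpower_decr; [lra|]; apply Rmult_le_compat_l; lra.
        - rewrite Rmult_assoc, <- (Rpower_pow v t), <- Rpower_plus, EK, Rpower_pow by exact Hz1.
          apply Rmult_le_reg_l with c0; [lra|].
          replace (c0 * (Cv / c0 * Cmod (E N z))) with (Cv * Cmod (E N z)) by (field; lra).
          replace (c0 * (Cv * t ^ v0)) with (Cv * (c0 * t ^ v0)) by ring.
          apply Rmult_le_compat_l; lra. }
      assert (Hmax : forall z, C' * Cmod (E N z) <= Rmax C' (Cv / c0) * Cmod (E N z) /\
                               Cv / c0 * Cmod (E N z) <= Rmax C' (Cv / c0) * Cmod (E N z)).
      { intros z; split; apply Rmult_le_compat_r; try apply Cmod_ge0; [apply Rmax_l|apply Rmax_r]. }
      (* The larger slope is kept. Raising the exponent only shrinks powers of t < 1, so the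
         domination of the earlier terms persists; the new upper bound on [mu] comes from the
         inequality at index [S j]. *)
      destruct (Rle_dec K' K) as [HKK|HKK].
      + exists K, C, (Rmax C' (Cv / c0)), (Rmin d d2).
        split; [exact HC|split; [apply Rlt_le_trans with C'; [exact HC'|apply Rmax_l]|]].
        split; [split; [apply Rmin_glb_lt; lra|eapply Rle_trans; [apply Rmin_l|lra]]|].
        split; [eapply Rle_trans; [apply Rmin_l|lra]|split; [eapply Rle_trans; [apply Rmin_l|lra]|]].
        intros z Hz Hz1; destruct (HK z Hz) as [G1 G2].
        { split; [tauto|eapply Rlt_le_trans; [apply Hz1|apply Rmin_l]]. }
        split; [exact G1|]; intros i Hi; destruct (Hmax z) as [M1 M2].
        destruct (Nat.eq_dec i (S j)) as [->|].
        * eapply Rle_trans; [apply Top; assumption|exact M2].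
        * eapply Rle_trans; [apply G2; lia|exact M1].
      + exists K', (Rpower (B * C0' / cv) (/ INR k)), (Rmax C' (Cv / c0)), (Rmin d d2).
        split; [apply Rpower_pos|split; [apply Rlt_le_trans with C'; [exact HC'|apply Rmax_l]|]].
        split; [split; [apply Rmin_glb_lt; lra|eapply Rle_trans; [apply Rmin_l|lra]]|].
        split; [eapply Rle_trans; [apply Rmin_l|lra]|split; [eapply Rle_trans; [apply Rmin_l|lra]|]].
        intros z Hz Hz1; assert (Zd : Cmod (z - tau)%Cx < d)
          by (eapply Rlt_le_trans; [apply Hz1|apply Rmin_l]).
        destruct (HK z Hz) as [G1 G2]; [tauto|].
        destruct (H z Hz) as [Hmu [HEN [H1 H2]]]; [split; [tauto|lra]|].
        assert (Hvz := Hv z Hz (Rlt_le_trans _ _ _ (proj2 Hz1) (Rmin_r _ _))).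
        assert (HNz := HN z Hz ltac:(lra)).
        assert (Topz := Top z Hz Hz1 K' ltac:(lra)); destruct (Hmax z) as [M1 M2].
        destruct Hz1 as [Hz1 _]; set (t := Cmod (z - tau)%Cx) in *; split.
        * replace (Rpower (B * C0' / cv) (/ INR k) * Rpower t K')
            with (Rpower (B * C0' / cv * Rpower t (INR v0 - INR v)) (/ INR k)).
          -- apply root_le; [exact Hmu|exact Hk|].
             assert (Q := H1 (S j) ltac:(lia)); fold k in Q.
             assert (Tv : 0 < t ^ v) by now apply pow_lt.
             apply Rmult_le_reg_l with (cv * t ^ v); [nra|].
             replace (cv * t ^ v * (B * C0' / cv * Rpower t (INR v0 - INR v)))
               with (B * (C0' * (t ^ v * Rpower t (INR v0 - INR v)))) by (field; lra).
             rewrite <- (Rpower_pow v t), <- Rpower_plus by exact Hz1.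
             replace (INR v + (INR v0 - INR v)) with (INR v0) by ring.
             rewrite !Rpower_pow by exact Hz1.
             apply Rle_trans with (Cmod (E (S j) z) * mu z ^ k).
             ++ apply Rmult_le_compat_r; [apply pow_le|]; lra.
             ++ eapply Rle_trans; [exact Q|]; apply Rmult_le_compat_l; lra.
          -- rewrite <- Rpower_mult_distr, Rpower_mult; [reflexivity| |apply Rpower_pos].
             apply Rdiv_lt_0_compat; [nra|lra].
        * intros i Hi; destruct (Nat.eq_dec i (S j)) as [->|].
          -- eapply Rle_trans; [exact Topz|exact M2].
          -- eapply Rle_trans; [|eapply Rle_trans; [apply (G2 i); lia|exact M1]].
             apply Rmult_le_compat_l; [apply Cmod_ge0|]; apply Rpower_decr; [lra|].
             apply Rmult_le_compat_l; [apply pos_INR|lra]. }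
  destruct (HP M (le_n M)) as [K [C [C' [d [HC [HC' [Hd [Hdd0 [Hdd1 HK]]]]]]]]].
  (* With x = mu / t^K < 1 every power x^(N-j) is at most x, so the root inequality reads |E_N| <= B
     C' N x |E_N|; hence x cannot fall below 1/(B C' N). *)
  set (cc := Rmin 1 (/ (B * C' * INR N))).
  assert (HN0 : 0 < INR N) by (apply lt_0_INR; unfold N; lia).
  assert (Hpos : 0 < B * C' * INR N) by (repeat apply Rmult_lt_0_compat; assumption).
  exists K, cc, C, d; split; [unfold cc; apply Rmin_glb_lt; [lra|now apply Rinv_0_lt_compat]|].
  split; [exact HC|split; [lra|]]; intros z Hz Hz1; destruct (HK z Hz Hz1) as [G1 G2].
  split; [|exact G1].
  destruct (H z Hz) as [Hmu [HEN [_ H2]]]; [lra|].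
  set (t := Cmod (z - tau)%Cx) in *; set (x := mu z / Rpower t K).
  assert (PK := Rpower_pos t K).
  assert (Hx : 0 < x) by (apply Rdiv_lt_0_compat; assumption).
  assert (Ex : mu z = x * Rpower t K) by (unfold x; field; lra).
  rewrite Ex; apply Rmult_le_compat_r; [lra|].
  apply Rnot_lt_le; intros Hlt.
  assert (x < 1) by (eapply Rlt_le_trans; [exact Hlt|apply Rmin_l]).
  assert (Hx2 : x < / (B * C' * INR N)) by (eapply Rlt_le_trans; [exact Hlt|apply Rmin_r]).
  assert (PE : 0 < Cmod (E N z)) by now apply Cmod_gt0.
  assert (S1 : sum_f_R0 (fun j => Cmod (E j z) * mu z ^ (N - j)) M
               <= sum_f_R0 (fun _ => C' * Cmod (E N z) * x) M).
  { apply sum_Rle; intros j Hj; specialize (G2 j Hj).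
    rewrite Ex, Rpow_mult_distr.
    replace (Rpower t K ^ (N - j)) with (Rpower t (INR (N - j) * K)).
    2:{ rewrite <- Rpower_pow, Rpower_mult by exact PK; f_equal; ring. }
    replace (Cmod (E j z) * (x ^ (N - j) * Rpower t (INR (N - j) * K)))
      with (Cmod (E j z) * Rpower t (INR (N - j) * K) * x ^ (N - j)) by ring.
    apply Rmult_le_compat; [apply Rmult_le_pos; [apply Cmod_ge0|left; apply Rpower_pos]|
      apply pow_le; lra|exact G2|].
    replace (N - j)%nat with (S (M - j)) by (unfold N; lia); simpl.
    rewrite <- (Rmult_1_r x) at 3; apply Rmult_le_compat_l; [lra|].
    rewrite <- (pow1 (M - j)); apply pow_incr; lra. }
  rewrite sum_cte in S1; fold N in S1.
  assert (S2 : Cmod (E N z) <= B * (C' * Cmod (E N z) * x * INR N)).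
  { eapply Rle_trans; [exact H2|]; apply Rmult_le_compat_l; lra. }
  assert (S3 : B * C' * INR N * x < 1).
  { apply Rmult_lt_reg_l with (/ (B * C' * INR N)); [now apply Rinv_0_lt_compat|].
    rewrite <- Rmult_assoc, Rinv_l by lra; lra. }
  nra.
Qed.

Lemma max_modulus_root l : l <> nil -> exists x, In x l /\ forall y, In y l -> Cmod y <= Cmod x.
Proof.
  induction l as [|x l IH]; [congruence|intros _].
  destruct l as [|y l]; [exists x; simpl; split; [tauto|intros z [<-|[]]; lra]|].
  destruct IH as [u [Hu Hmax]]; [discriminate|].
  destruct (Rle_dec (Cmod x) (Cmod u)).
  - exists u; split; [now right|]; intros z [<-|Hz]; [lra|now apply Hmax].
  - exists x; split; [now left|]; intros z [<-|Hz]; [lra|specialize (Hmax z Hz); lra].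
Qed.

Definition maxmod (l : list Cx) : R := fold_right (fun x acc => Rmax (Cmod x) acc) 0 l.

Lemma maxmod_ub l x : In x l -> Cmod x <= maxmod l.
Proof.
  induction l as [|y l IH]; [intros []|]; intros [<-|H]; simpl; [apply Rmax_l|].
  eapply Rle_trans; [now apply IH|apply Rmax_r].
Qed.

Lemma maxmod_attained l : l <> nil -> exists x, In x l /\ Cmod x = maxmod l.
Proof.
  intros H; destruct (max_modulus_root l H) as [x [Hx Hm]]; exists x; split; [exact Hx|].
  apply Rle_antisym; [now apply maxmod_ub|].
  clear Hx H; induction l as [|y l IH]; simpl; [apply Cmod_ge0|].
  apply Rmax_lub; [apply Hm; now left|apply IH; intros; apply Hm; now right].
Qed.

Lemma is_eps_roots a m n zeta l : stable a m n -> Cmod zeta = 1 -> root_spec a m n zeta l -> l <> nil ->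
  is_eps a m n 1 zeta (1 - maxmod l).
Proof.
  intros Hs Hz [Hl [E _]] Hn; assert (HA := lead_refl_neq0 a m n zeta Hs Hz); split; simpl.
  - destruct (maxmod_attained l Hn) as [x [Hx <-]]; exists x; split; [|reflexivity].
    unfold eval_i; simpl; rewrite E; apply cprodl_eq0 in Hx; rewrite Hx; ring.
  - intros w Hw; unfold eval_i in Hw; simpl in Hw; rewrite E in Hw.
    apply Cmul_integral in Hw; destruct Hw as [|Hw]; [contradiction|].
    apply cprodl_eq0, maxmod_ub in Hw; lra.
Qed.

(** With mu = 1 - max |x_j|, each pair satisfies |1 - x conj(y)| >= 1 - |x| >= mu, and the diagonal
    pair of a root of maximal modulus is at most 2 mu; these give the two families of inequalities
    for [newton_polygon]. *)
Lemma contact_order_exists a m n tau : stable a m n -> m <> O -> Cmod tau = 1 ->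
  exists K, contact_order_at a m n 1 tau K.
Proof.
  intros Hs Hm Ht.
  (* An arbitrary choice of root list at each point; only quantities symmetric in the roots are
     formed from it. *)
  set (L := fun z => epsilon (inhabits nil) (root_spec a m n z)).
  assert (HL : forall z, Cmod z = 1 -> root_spec a m n z (L z)).
  { intros z Hz; apply epsilon_spec; now apply root_list. }
  assert (Nn : forall z, Cmod z = 1 -> L z <> nil).
  { intros z Hz E; destruct (HL z Hz) as [K _]; rewrite E in K; simpl in K; congruence. }
  destruct (good_isolated a m n tau Hs) as [d0 [Hd0 Hg]].
  assert (EM : exists M, (m * m = S M)%nat).
  { destruct m as [|j]; [congruence|]; exists (j + j * S j)%nat; reflexivity. }
  destruct EM as [M EM].
  destruct (newton_polygon tau M (fun j z => es (pairs (L z)) j) (fun z => 1 - maxmod (L z))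
              (* One constant for both families: it is the factor of [es_bound], and it absorbs the
                 powers of 2 in (2 mu)^(N-j). *)
              (2 ^ S M) d0) as [K [c [C [d [Hc [HC [Hd H]]]]]]].
  - exact Ht.
  - apply pow_lt; lra.
  - exact Hd0.
  - intros z; apply es_0.
  - now apply (ratT_es_pairs a m n).
  - intros z Hz Hz1; rewrite Cmod_sub_sym in Hz1.
    destruct (HL z Hz) as [Hl [_ Hin]]; specialize (Hin (Hg z Hz Hz1)).
    destruct (maxmod_attained (L z) (Nn z Hz)) as [x [Hx Ex]].
    assert (Hx1 := Hin x Hx).
    assert (Hlen : length (pairs (L z)) = S M) by (rewrite length_pairs, Hl; exact EM).
    assert (Hlow : forall y, In y (pairs (L z)) -> 1 - maxmod (L z) <= Cmod y).
    { intros y Hy; apply in_pairs in Hy; destruct Hy as [u [v [Hu [Hv ->]]]].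
      assert (T := Cmod_sub_ge C1 (u * Cconj v)%Cx); rewrite Cmod_mul, Cmod_conj, Cmod_C1 in T.
      assert (U1 := maxmod_ub _ _ Hu); assert (V1 := Hin v Hv).
      assert (U0 := Cmod_ge0 u); assert (V0 := Cmod_ge0 v); nra. }
    repeat split.
    + lra.
    + rewrite <- Hlen, es_length; apply cprodl_neq0; intros y Hy; apply Cmod_neq0.
      specialize (Hlow y Hy); lra.
    + intros j Hj; rewrite <- Hlen at 2; rewrite <- Hlen at 2; rewrite es_length.
      apply es_bound; [lra|exact Hlow|lia].
    + set (x0 := (C1 - x * Cconj x)%Cx).
      assert (Hx0 : In x0 (pairs (L z))) by (apply in_pairs; exists x, x; auto).
      assert (Mx0 : Cmod x0 <= 2 * (1 - maxmod (L z))).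
      { unfold x0; rewrite Cmul_conj.
        replace (C1 - RtoC (Cmod x * Cmod x))%Cx with (RtoC (1 - Cmod x * Cmod x))
          by (unfold C1, RtoC, Csub, Cadd, Copp; simpl; f_equal; ring).
        assert (X0 := Cmod_ge0 x); rewrite Cmod_RtoC, Rabs_pos_eq by nra; nra. }
      eapply Rle_trans; [apply (es_root_bound _ M x0 Hlen Hx0)|].
      rewrite scal_sum; apply sum_Rle; intros j Hj.
      rewrite Rmult_assoc; apply Rmult_le_compat_l; [apply Cmod_ge0|].
      apply Rle_trans with ((2 * (1 - maxmod (L z))) ^ (S M - j)).
      * apply pow_incr; split; [apply Cmod_ge0|exact Mx0].
      * rewrite Rpow_mult_distr, Rmult_comm; apply Rmult_le_compat_l; [apply pow_le; lra|].
        apply Rle_pow; [lra|lia].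
  - exists K, c, C, (Rmin d d0); split; [exact Hc|split; [exact HC|split; [now apply Rmin_glb_lt|]]].
    intros z Hz Hz1; exists (1 - maxmod (L z)).
    split; [apply (is_eps_roots a m n z (L z)); auto|].
    rewrite Cmod_sub_sym in *; destruct (H z Hz) as [H1 H2].
    { split; [tauto|eapply Rlt_le_trans; [apply Hz1|apply Rmin_l]]. }
    unfold rpow; destruct (Rle_dec (Cmod (z - tau)%Cx) 0); [lra|split; assumption].
Qed.

(** * Powers and the Poisson kernel *)

Lemma rpow_Rpower x P : 0 < x -> rpow x P = Rpower x P.
Proof. intros H; unfold rpow; destruct (Rle_dec x 0); [lra|reflexivity]. Qed.

Lemma rpow_nonpos x P : x <= 0 -> rpow x P = 0.
Proof. intros H; unfold rpow; destruct (Rle_dec x 0); [reflexivity|lra]. Qed.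

Lemma rpow_ge0 x P : 0 <= rpow x P.
Proof.
  destruct (Rle_dec x 0); [rewrite rpow_nonpos; lra|].
  rewrite rpow_Rpower by lra; left; apply Rpower_pos.
Qed.

Lemma rpow_le x y P : 0 <= P -> x <= y -> rpow x P <= rpow y P.
Proof.
  intros HP H; destruct (Rle_dec x 0); [rewrite rpow_nonpos by lra; apply rpow_ge0|].
  rewrite !rpow_Rpower by lra; apply Rle_Rpower_l; lra.
Qed.

Lemma rpow_mul x y P : 0 <= x -> 0 <= y -> rpow (x * y) P = rpow x P * rpow y P.
Proof.
  intros Hx Hy; destruct (Req_dec x 0) as [->|]; [rewrite Rmult_0_l, !(rpow_nonpos 0) by lra; ring|].
  destruct (Req_dec y 0) as [->|]; [rewrite Rmult_0_r, !(rpow_nonpos 0) by lra; ring|].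
  rewrite !rpow_Rpower by (try apply Rmult_lt_0_compat; lra).
  symmetry; apply Rpower_mult_distr; lra.
Qed.

Lemma rpow_le_linear x y P : 1 <= P -> 0 <= x <= y -> 0 < y -> rpow x P <= Rpower y (P - 1) * x.
Proof.
  intros HP H Hy; destruct (Req_dec x 0) as [->|]; [rewrite rpow_nonpos by lra; lra|].
  rewrite rpow_Rpower by lra; replace P with (P - 1 + 1) at 1 by ring.
  rewrite Rpower_plus, Rpower_1 by lra; apply Rmult_le_compat_r; [lra|].
  apply Rle_Rpower_l; lra.
Qed.

Lemma rpow_cont P x : 1 <= P -> continuous (fun y => rpow y P) x.
Proof.
  intros HP; destruct (Rtotal_order x 0) as [Hx|[->|Hx]].
  - apply (continuous_ext_loc _ (fun _ => 0)); [|apply continuous_const].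
    assert (Hd : 0 < - x) by lra; exists (mkposreal _ Hd); intros y Hy.
    apply ball_R in Hy; simpl in Hy; rewrite rpow_nonpos; lra.
  - unfold continuous; rewrite filterlim_locally; intros eps.
    assert (Hd : 0 < Rmin eps 1) by (apply Rmin_glb_lt; [apply cond_pos|lra]).
    exists (mkposreal _ Hd); intros y Hy.
    apply ball_R in Hy; apply ball_R; simpl in *.
    assert (M1 := Rmin_l eps 1); assert (M2 := Rmin_r eps 1); assert (Pe := cond_pos eps).
    rewrite (rpow_nonpos 0) by lra.
    assert (H0 := rpow_ge0 y P).
    destruct (Rle_dec y 0); [rewrite rpow_nonpos by lra; lra|].
    assert (H1 := rpow_le_linear y 1 P HP ltac:(lra) ltac:(lra)).
    replace (Rpower 1 (P - 1)) with 1 in H1 by (unfold Rpower; rewrite ln_1, Rmult_0_r, exp_0; reflexivity); lra.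
  - apply (continuous_ext_loc _ (fun y => exp (P * ln y))).
    + exists (mkposreal _ Hx); intros y Hy.
      apply ball_R in Hy; simpl in Hy; rewrite rpow_Rpower by lra; reflexivity.
    + apply (cont_comp (fun y => P * ln y) exp).
      * apply cont_mul; [apply continuous_const|].
        apply continuity_pt_filterlim, derivable_continuous_pt; exists (/ x); now apply derivable_pt_lim_ln.
      * apply derivable_continuous, derivable_exp.
Qed.

Lemma cont_rpow {U : UniformSpace} (f : U -> R) P x : 1 <= P -> continuous f x ->
  continuous (fun u => rpow (f u) P) x.
Proof. intros HP Hf; apply (continuous_comp f (fun y => rpow y P)); [exact Hf|now apply rpow_cont]. Qed.

Lemma ln_le_sub x : 0 < x -> ln x <= x - 1.
Proof.
  intros H; assert (E := exp_ineq1_le (ln x)); rewrite exp_ln in E by exact H; lra.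
Qed.

Lemma bernoulli_real x P : 1 <= P -> 0 <= x -> 1 + P * (x - 1) <= rpow x P.
Proof.
  intros HP Hx; destruct (Req_dec x 0) as [->|Nx]; [rewrite rpow_nonpos; lra|].
  rewrite rpow_Rpower by lra; set (y := 1 + P * (x - 1)).
  destruct (Rle_dec y 0); [apply Rle_trans with 0; [lra|left; apply Rpower_pos]|].
  rewrite <- (exp_ln y) by lra; unfold Rpower.
  (* From ln(y/x) <= y/x - 1 = (P - 1)(1 - 1/x) and 1 - 1/x <= ln x follows ln y <= P ln x. *)
  assert (L : ln y <= P * ln x).
  { assert (L1 := ln_le_sub (y / x) ltac:(apply Rdiv_lt_0_compat; lra)).
    assert (L2 := ln_le_sub (/ x) ltac:(apply Rinv_0_lt_compat; lra)).
    unfold Rdiv in L1; rewrite ln_mult, ln_Rinv in L1 by (try apply Rinv_0_lt_compat; lra).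
    rewrite ln_Rinv in L2 by lra.
    assert (E : y * / x - 1 = (P - 1) * (1 - / x)) by (unfold y; field; lra).
    nra. }
  destruct L as [L|L]; [left; now apply exp_increasing|right; now rewrite L].
Qed.

Lemma rpow_tangent x X P : 1 <= P -> 0 <= x -> 0 < X ->
  rpow X P + P * (rpow X P / X) * (x - X) <= rpow x P.
Proof.
  intros HP Hx HX; assert (B := bernoulli_real (x / X) P HP).
  assert (Hq : 0 <= x / X) by (apply Rmult_le_pos; [lra|left; now apply Rinv_0_lt_compat]).
  specialize (B Hq); replace x with (X * (x / X)) at 2 by (field; lra).
  rewrite rpow_mul by lra; assert (H0 := rpow_ge0 X P).
  replace (rpow X P + P * (rpow X P / X) * (x - X)) with (rpow X P * (1 + P * (x / X - 1))) by (field; lra).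
  now apply Rmult_le_compat_l.
Qed.

Lemma sum_scal_l k f n : sum_f_R0 (fun i => k * f i) n = k * sum_f_R0 f n.
Proof. rewrite scal_sum; apply sum_eq; intros; ring. Qed.

(** The tangent line at the mean X lies below the power; the weighted sum of its values is exactly
    X^P. *)
Lemma jensen_rpow P w x n : 1 <= P -> (forall k, 0 <= w k) -> (forall k, 0 <= x k) -> sum_f_R0 w n = 1 ->
  rpow (sum_f_R0 (fun k => w k * x k) n) P <= sum_f_R0 (fun k => w k * rpow (x k) P) n.
Proof.
  intros HP Hw Hx Hs; set (X := sum_f_R0 (fun k => w k * x k) n).
  destruct (Rle_dec X 0) as [H|H].
  - rewrite rpow_nonpos by exact H; apply cond_pos_sum; intros; apply Rmult_le_pos; [apply Hw|apply rpow_ge0].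
  - apply Rle_trans with (sum_f_R0 (fun k => w k * (rpow X P - P * rpow X P)
                                    + P * (rpow X P / X) * (w k * x k)) n).
    + rewrite sum_plus, sum_scal_l; fold X.
      rewrite (sum_eq (fun l => w l * (rpow X P - P * rpow X P)) (fun l => (rpow X P - P * rpow X P) * w l))
        by (intros; ring).
      rewrite sum_scal_l, Hs; right; field; lra.
    + apply sum_Rle; intros k _.
      assert (T := rpow_tangent (x k) X P HP (Hx k) ltac:(lra)).
      replace (w k * (rpow X P - P * rpow X P) + P * (rpow X P / X) * (w k * x k))
        with (w k * (rpow X P + P * (rpow X P / X) * (x k - X))) by (field; lra).
      apply Rmult_le_compat_l; [apply Hw|exact T].
Qed.

(* Truncation 1 + 2 (u + ... + u^N) of (1 + u) / (1 - u). *)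
Definition ker (N : nat) (u : Cx) : Cx := (RtoC 2 * csum (fun k => u ^ k) N - C1)%Cx.

Lemma geometric u N : ((C1 - u) * csum (fun k => u ^ k) N = C1 - u ^ S N)%Cx.
Proof.
  induction N; [simpl; ring|].
  change (csum (fun k => u ^ k)%Cx (S N)) with (csum (fun k => u ^ k) N + u ^ S N)%Cx.
  replace ((C1 - u) * (csum (fun k => u ^ k) N + u ^ S N))%Cx
    with ((C1 - u) * csum (fun k => u ^ k) N + (C1 - u) * u ^ S N)%Cx by ring.
  rewrite IHN; simpl; ring.
Qed.

Lemma RtoC_2 : RtoC 2 = (C1 + C1)%Cx.
Proof. unfold RtoC, C1, Cadd; simpl; f_equal; ring. Qed.

(** The truncated kernel differs from (1 + u)/(1 - u) by 2 u^(N+1)/(1 - u), and the real part of (1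
    + u)/(1 - u) is the Poisson quotient. *)
Lemma ker_bound N u : Cmod u < 1 ->
  Rabs (fst (ker N u) - (1 - Cmod u * Cmod u) / (Cmod (C1 - u)%Cx * Cmod (C1 - u)%Cx))
  <= 2 * Cmod u ^ S N / (1 - Cmod u).
Proof.
  intros Hu; assert (N1 : (C1 - u)%Cx <> C0).
  { intros E; apply Csub_eq0 in E; rewrite <- E, Cmod_C1 in Hu; lra. }
  assert (E : ker N u = ((C1 + u) / (C1 - u) - RtoC 2 * (u ^ S N / (C1 - u)))%Cx).
  { unfold ker; rewrite RtoC_2.
    replace (csum (fun k => u ^ k)%Cx N) with ((C1 - u ^ S N) / (C1 - u))%Cx
      by (rewrite <- geometric; field; exact N1).
    field; exact N1. }
  assert (F : fst ((C1 + u) / (C1 - u))%Cx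
              = (1 - Cmod u * Cmod u) / (Cmod (C1 - u)%Cx * Cmod (C1 - u)%Cx)).
  { rewrite !Cmod_sqr; apply sqr_sum_pos in N1; destruct u as [x y].
    unfold Cdiv, Cmul, Cinv, Csub, Cadd, Copp, C1 in *; simpl in *; field; lra. }
  replace (fst (ker N u) - (1 - Cmod u * Cmod u) / (Cmod (C1 - u)%Cx * Cmod (C1 - u)%Cx))
    with (fst (- (RtoC 2 * (u ^ S N / (C1 - u))))%Cx) by (rewrite <- F, E; simpl; ring).
  eapply Rle_trans; [apply Cmod_fst|].
  rewrite Cmod_opp, Cmod_mul, Cmod_RtoC, Cmod_div, Cmod_pow by exact N1.
  rewrite Rabs_pos_eq by lra; unfold Rdiv; rewrite Rmult_assoc.
  apply Rmult_le_compat_l; [lra|]; apply Rmult_le_compat_l; [apply pow_le, Cmod_ge0|].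
  assert (T := Cmod_sub_ge C1 u); rewrite Cmod_C1 in T.
  apply Rinv_le_contravar; lra.
Qed.

Lemma pow_small x e : 0 <= x < 1 -> 0 < e -> exists N, forall k, (N <= k)%nat -> x ^ k <= e.
Proof.
  intros Hx He; destruct (pow_lt_1_zero x ltac:(rewrite Rabs_pos_eq; lra) e He) as [N HN].
  exists N; intros k Hk; specialize (HN k Hk); apply Rabs_lt_between in HN; lra.
Qed.

Lemma ccont_expi_id s : ccont (U := R_UniformSpace) (fun s => Cexpi s) s.
Proof. apply ccont_expi, continuous_id. Qed.

Lemma RInt_pow_expi c k :
  RInt (fun s => fst ((c * Cexpi s) ^ S k)%Cx) 0 (2 * PI) = 0.
Proof.
  set (K := INR (S k)); assert (HK : 0 < K) by (apply lt_0_INR; lia).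
  set (x := fst (c ^ S k)%Cx); set (y := snd (c ^ S k)%Cx).
  rewrite (RInt_ext _ (fun s => x * cos (K * s) - y * sin (K * s))).
  2:{ intros s _; rewrite Cpow_mul, Cexpi_pow; fold K.
      unfold x, y; simpl; ring. }
  apply is_RInt_unique.
  assert (E : Cexpi (K * (2 * PI)) = C1) by (unfold K; rewrite <- Cexpi_pow, Cexpi_2PI; apply Cpow_C1).
  injection E as Ec Es.
  replace 0 with (minus ((fun s => (x * sin (K * s) + y * cos (K * s)) / K) (2 * PI))
                        ((fun s => (x * sin (K * s) + y * cos (K * s)) / K) 0)) at 2.
  - apply (is_RInt_derive (V := R_CompleteNormedModule) (fun s => (x * sin (K * s) + y * cos (K * s)) / K)
             (fun s => x * cos (K * s) - y * sin (K * s))).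
    + intros s _; auto_derive; [auto|field; lra].
    + intros s _.
      assert (Cs : continuous (fun s : R => K * s) s) by (apply cont_mul; [apply continuous_const|apply continuous_id]).
      apply cont_sub; apply cont_mul; try apply continuous_const.
      * apply (cont_comp _ cos); [exact Cs|apply continuity_cos].
      * apply (cont_comp _ sin); [exact Cs|apply continuity_sin].
  - unfold minus, plus, opp; simpl; rewrite Ec, Es, (Rmult_0_r K), sin_0, cos_0; field; lra.
Qed.

Lemma ccont_ker {U : UniformSpace} N (f : U -> Cx) x : ccont f x -> ccont (fun u => ker N (f u)) x.
Proof.
  intros H; apply ccont_sub; [|apply ccont_const]; apply ccont_mul; [apply ccont_const|].
  apply (ccont_csum (fun k u => (f u ^ k)%Cx)); intros; now apply ccont_pow.
Qed.

Lemma ccont_mul_expi c s : ccont (U := R_UniformSpace) (fun s => c * Cexpi s)%Cx s.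
Proof. apply ccont_mul; [apply ccont_const|apply ccont_expi_id]. Qed.

Lemma cont_ker_expi N c s : continuous (fun s => fst (ker N (c * Cexpi s)%Cx)) s.
Proof. exact (proj1 (ccont_ker (U := R_UniformSpace) N _ s (ccont_mul_expi c s))). Qed.

Lemma ccont_pow_expi c k s : ccont (U := R_UniformSpace) (fun s => (c * Cexpi s) ^ k)%Cx s.
Proof. exact (ccont_pow (U := R_UniformSpace) _ k s (ccont_mul_expi c s)). Qed.

Lemma RInt_ker N c : RInt (fun s => fst (ker N (c * Cexpi s)%Cx)) 0 (2 * PI) = 2 * PI.
Proof.
  assert (Cc : forall N s, continuous (fun s => fst (csum (fun k => (c * Cexpi s) ^ k)%Cx N)) s).
  { intros K s; exact (proj1 (ccont_csum (U := R_UniformSpace) (fun k s => ((c * Cexpi s) ^ k)%Cx) K s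
                               (fun k => ccont_pow_expi c k s))). }
  assert (H : RInt (fun s => fst (csum (fun k => (c * Cexpi s) ^ k)%Cx N)) 0 (2 * PI) = 2 * PI).
  { induction N as [|N IH].
    - simpl; rewrite RInt_cst; ring.
    - change (fun s => fst (csum (fun k => (c * Cexpi s) ^ k)%Cx (S N)))
        with (fun s => fst (csum (fun k => (c * Cexpi s) ^ k)%Cx N) + fst ((c * Cexpi s) ^ S N)%Cx).
      rewrite RInt_add_cont, IH, RInt_pow_expi; [exact (Rplus_0_r _)|apply Cc|].
      intros s; exact (proj1 (ccont_pow_expi c (S N) s)). }
  rewrite (RInt_ext _ (fun s => 2 * fst (csum (fun k => (c * Cexpi s) ^ k)%Cx N) + -1)).
  2:{ intros s _; unfold ker; simpl; ring. }
  rewrite RInt_add_cont, RInt_scal_cont, H, RInt_cst; [|apply Cc| |intros; apply continuous_const].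
  { change (2 * (2 * PI) + (2 * PI - 0) * -1 = 2 * PI); ring. }
  intros s; apply cont_mul; [apply continuous_const|apply Cc].
Qed.

Lemma poisson_ker x w : Cmod w = 1 ->
  poisson x w = (1 - Cmod (Cconj x * w)%Cx * Cmod (Cconj x * w)%Cx)
                / (Cmod (C1 - Cconj x * w)%Cx * Cmod (C1 - Cconj x * w)%Cx).
Proof.
  intros Hw; unfold poisson; rewrite !Cmod_mul, Cmod_conj, Hw, Rmult_1_r.
  replace (Cmod (C1 - Cconj x * w)%Cx) with (Cmod (w - x)%Cx); [reflexivity|].
  rewrite <- (Cmod_conj (C1 - _)%Cx), <- (Rmult_1_l (Cmod (Cconj _))), <- Hw, <- Cmod_mul; f_equal.
  transitivity (w - (w * Cconj w) * x)%Cx; [rewrite Cmul_conj_unit by exact Hw; ring|].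
  unfold Csub; rewrite Cconj_add.
  replace (Cconj (- (Cconj x * w)))%Cx with (- (x * Cconj w))%Cx
    by (unfold Cconj, Copp, Cmul; simpl; f_equal; ring).
  replace (Cconj C1) with C1 by (unfold Cconj, C1; simpl; f_equal; ring); ring.
Qed.

Lemma poisson_cont x s : Cmod x < 1 -> continuous (fun s => poisson x (Cexpi s)) s.
Proof.
  intros Hx; assert (C : forall s, continuous (fun s => Cmod (Cexpi s - x)%Cx) s).
  { intros; apply (cont_Cmod (U := R_UniformSpace)), ccont_sub; [apply ccont_expi_id|apply ccont_const]. }
  apply cont_div; [apply continuous_const|apply cont_mul; apply C|].
  assert (P : 0 < Cmod (Cexpi s - x)%Cx)
    by (assert (T := Cmod_sub_ge (Cexpi s) x); rewrite Cmod_expi in T; lra).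
  nra.
Qed.

(** Constants do not matter, so the kernel is replaced by a truncation with pointwise error at most
    1: that costs 2 pi on top of the integral 2 pi of the truncation. *)
Lemma RInt_poisson x : Cmod x < 1 -> RInt (fun s => poisson x (Cexpi s)) 0 (2 * PI) <= 4 * PI.
Proof.
  intros Hx; assert (X0 := Cmod_ge0 x); assert (HPI := PI_RGT_0).
  destruct (pow_small (Cmod x) ((1 - Cmod x) / 2) ltac:(lra) ltac:(lra)) as [N HN].
  specialize (HN (S N) ltac:(lia)).
  apply Rle_trans with (RInt (fun s => fst (ker N (Cconj x * Cexpi s)%Cx) + 1) 0 (2 * PI)).
  - apply RInt_le_cont; [lra|intros; now apply poisson_cont| |].
    + intros s; apply cont_add; [|apply continuous_const].
      apply cont_ker_expi.
    + intros s _; rewrite poisson_ker by apply Cmod_expi.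
      assert (M : Cmod (Cconj x * Cexpi s)%Cx = Cmod x) by (rewrite Cmod_mul, Cmod_conj, Cmod_expi; ring).
      assert (B := ker_bound N (Cconj x * Cexpi s)%Cx ltac:(lra)); rewrite M in *.
      assert (2 * Cmod x ^ S N / (1 - Cmod x) <= 1).
      { apply Rmult_le_reg_r with (1 - Cmod x); [lra|].
        unfold Rdiv; rewrite Rmult_assoc, Rinv_l by lra; lra. }
      apply Rabs_le_between in B; lra.
  - rewrite RInt_add_cont, RInt_ker, RInt_cst; [lra| |intros; apply continuous_const].
    intros s; apply cont_ker_expi.
Qed.

(** * Monotonicity of integral means *)

Lemma csum_delta (g : nat -> Cx) j N : (j <= N)%nat ->
  csum (fun l => if Nat.eqb l j then g l else C0) N = g j.
Proof.
  induction N; intros H; [replace j with O by lia; reflexivity|].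
  change (csum (fun l => if Nat.eqb l j then g l else C0) (S N))
    with (csum (fun l => if Nat.eqb l j then g l else C0) N + (if Nat.eqb (S N) j then g (S N) else C0))%Cx.
  destruct (Nat.eq_dec j (S N)) as [->|Hj].
  - rewrite (csum_ext _ (fun _ => C0)), csum_C0.
    + destruct (Nat.eqb_spec (S N) (S N)); [ring|congruence].
    + intros i Hi; destruct (Nat.eqb_spec i (S N)); [lia|reflexivity].
  - rewrite IHN by lia; destruct (Nat.eqb_spec (S N) j); [lia|ring].
Qed.

Lemma RtoC_add x y : RtoC (x + y) = (RtoC x + RtoC y)%Cx.
Proof. unfold RtoC, Cadd; simpl; f_equal; ring. Qed.

Lemma RtoC_mul x y : RtoC (x * y) = (RtoC x * RtoC y)%Cx.
Proof. unfold RtoC, Cmul; simpl; f_equal; ring. Qed.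

Lemma RtoC_pow x k : RtoC (x ^ k) = (RtoC x ^ k)%Cx.
Proof. induction k; simpl; [reflexivity|rewrite RtoC_mul, IHk; reflexivity]. Qed.

Lemma RtoC_sum f n : RtoC (sum_f_R0 f n) = csum (fun k => RtoC (f k)) n.
Proof. induction n; simpl; [reflexivity|rewrite RtoC_add, IHn; reflexivity]. Qed.

Lemma RtoC_inj x y : RtoC x = RtoC y -> x = y.
Proof. intros H; injection H; auto. Qed.

Lemma csum_one n : csum (fun _ => C1) n = RtoC (INR (S n)).
Proof.
  induction n; [reflexivity|]; rewrite RtoC_S, <- IHn; reflexivity.
Qed.

(** The (M + 1)-th roots of unity. *)
Definition om (M k : nat) : Cx := Cexpi (INR k * (2 * PI / INR (S M))).

Lemma om_sum M p : (p <= M)%nat ->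
  csum (fun k => om M k ^ p)%Cx M = if Nat.eqb p 0 then RtoC (INR (S M)) else C0.
Proof.
  intros Hp; destruct (Nat.eqb_spec p 0) as [->|N]; [simpl; apply csum_one|].
  set (th := 2 * PI / INR (S M)); assert (HM : 0 < INR (S M)) by (apply lt_0_INR; lia).
  set (u := Cexpi (INR p * th)).
  assert (HPI := PI_RGT_0).
  rewrite (csum_ext _ (fun k => u ^ k)%Cx).
  2:{ intros k _; unfold om, u; rewrite !Cexpi_pow; f_equal; fold th; ring. }
  assert (G := geometric u M).
  assert (E : (u ^ S M)%Cx = C1).
  { unfold u; rewrite Cexpi_pow; replace (INR (S M) * (INR p * th)) with (INR p * (2 * PI))
      by (unfold th; field; lra).
    rewrite <- Cexpi_pow, Cexpi_2PI; apply Cpow_C1. }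
  rewrite E in G; replace (C1 - C1)%Cx with C0 in G by ring.
  apply Cmul_integral in G; destruct G as [G|G]; [exfalso|exact G].
  apply Csub_eq0 in G; unfold u in G; injection G as G1 _.
  set (y := INR p * th / 2).
  assert (Hy : 0 < y < PI).
  { assert (Pp : 0 < INR p) by (apply lt_0_INR; lia).
    assert (Hlt : INR p < INR (S M)) by (apply lt_INR; lia).
    replace y with (PI * (INR p / INR (S M))) by (unfold y, th; field; lra).
    assert (0 < INR p / INR (S M)) by now apply Rdiv_lt_0_compat.
    assert (INR p / INR (S M) < 1).
    { apply Rmult_lt_reg_r with (INR (S M)); [lra|]; unfold Rdiv; rewrite Rmult_assoc, Rinv_l; lra. }
    nra. }
  assert (S0 := sin_gt_0 y ltac:(lra) ltac:(lra)).
  assert (C2 := cos_2a_sin y); replace (2 * y) with (INR p * th) in C2 by (unfold y; field).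
  rewrite <- G1 in C2; nra.
Qed.

Lemma om_orth M l j : (l <= M)%nat -> (j <= M)%nat ->
  csum (fun k => Cconj (om M k ^ l) * om M k ^ j)%Cx M
  = if Nat.eqb l j then RtoC (INR (S M)) else C0.
Proof.
  intros Hl Hj.
  assert (U : forall k p, (om M k ^ p * Cconj (om M k ^ p))%Cx = C1).
  { intros k p; apply Cmul_conj_unit; unfold om; rewrite Cexpi_pow; apply Cmod_expi. }
  destruct (Nat.le_gt_cases l j) as [H|H].
  - rewrite (csum_ext _ (fun k => om M k ^ (j - l))%Cx).
    + rewrite om_sum by lia; destruct (Nat.eqb_spec (j - l) 0), (Nat.eqb_spec l j); try lia; reflexivity.
    + intros k _; replace j with (l + (j - l))%nat at 1 by lia; rewrite Cpow_add.
      transitivity ((om M k ^ l * Cconj (om M k ^ l)) * om M k ^ (j - l))%Cx; [ring|rewrite U; ring].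
  - rewrite (csum_ext _ (fun k => Cconj (om M k ^ (l - j)))%Cx).
    + rewrite <- csum_conj, om_sum by lia.
      destruct (Nat.eqb_spec (l - j) 0), (Nat.eqb_spec l j); try lia.
      unfold Cconj, C0; simpl; f_equal; ring.
    + intros k _; replace l with (j + (l - j))%nat at 1 by lia; rewrite Cpow_add, Cconj_mul.
      transitivity ((om M k ^ j * Cconj (om M k ^ j)) * Cconj (om M k ^ (l - j)))%Cx; [ring|rewrite U; ring].
Qed.

Lemma ker_fst N u : RtoC (fst (ker N u)) = (csum (fun l => u ^ l + Cconj (u ^ l)) N - C1)%Cx.
Proof.
  rewrite csum_add, <- csum_conj; unfold ker; destruct (csum (fun l => u ^ l)%Cx N) as [x y].
  unfold Csub, RtoC, Cadd, Copp, Cmul, Cconj, C1; simpl; f_equal; ring.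
Qed.

(** Orthogonality of the roots of unity picks out r^j from the expanded kernel. The bound N + j <= M
    prevents aliasing: no product of kernel frequency and monomial wraps around. *)
Lemma ker_moment r N M j : (j <= N)%nat -> (N + j <= M)%nat ->
  csum (fun k => RtoC (fst (ker N (RtoC r * om M k)%Cx)) * om M k ^ j)%Cx M
  = (RtoC (INR (S M)) * RtoC r ^ j)%Cx.
Proof.
  intros Hj HM; set (n := RtoC (INR (S M))).
  assert (Cr : forall l, Cconj (RtoC r ^ l)%Cx = (RtoC r ^ l)%Cx).
  { intros l; rewrite <- RtoC_pow; unfold Cconj, RtoC; simpl; f_equal; ring. }
  rewrite (csum_ext _ (fun k => csum (fun l => RtoC r ^ l * (om M k ^ (l + j))
                         + RtoC r ^ l * (Cconj (om M k ^ l) * om M k ^ j)) N + (- C1) * om M k ^ j)%Cx).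
  2:{ intros k _; rewrite ker_fst.
      transitivity (om M k ^ j * csum (fun l => (RtoC r * om M k) ^ l + Cconj ((RtoC r * om M k) ^ l)) N
                    + (- C1) * om M k ^ j)%Cx; [ring|].
      rewrite <- csum_mul; f_equal; apply csum_ext; intros l _.
      rewrite Cpow_mul, Cconj_mul, Cr, Cpow_add; ring. }
  rewrite csum_add, csum_mul, om_sum by lia; fold n.
  rewrite csum_swap.
  rewrite (csum_ext _ (fun l => (if Nat.eqb l 0 then (if Nat.eqb j 0 then n else C0) else C0)
                                + (if Nat.eqb l j then RtoC r ^ l * n else C0))%Cx).
  2:{ intros l Hl; rewrite csum_add, !csum_mul, om_sum, om_orth by lia; fold n.
      destruct (Nat.eqb_spec (l + j) 0), (Nat.eqb_spec l 0), (Nat.eqb_spec l j), (Nat.eqb_spec j 0);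
        try lia; subst; simpl; ring. }
  rewrite csum_add, (csum_delta (fun l => RtoC r ^ l * n)%Cx) by exact Hj.
  rewrite (csum_delta (fun l => if Nat.eqb j 0 then n else C0) 0) by lia.
  destruct (Nat.eqb j 0); ring.
Qed.

(* Discretized Poisson formula: the kernel is the truncated one, positive for N large. *)
Lemma polyfun_average q r : polyfun q -> 0 <= r < 1 ->
  exists M w th, (forall k, 0 <= w k) /\ sum_f_R0 w M = 1 /\
    forall z, Cmod (q (Cscale r z)) <= sum_f_R0 (fun k => w k * Cmod (q (z * Cexpi (th k))%Cx)) M.
Proof.
  intros Hq Hr; destruct (ComplexRoots.polyfun_coefs q Hq) as [c [d Ed]].
  (* Makes the truncation error at most (1 - r)/2, which is a lower bound for the Poisson kernel at
     radius r; the weights are then nonnegative. *)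
  destruct (pow_small r ((1 - r) * (1 - r) / 4) Hr ltac:(nra)) as [N0 HN0].
  (* N >= d lets the kernel reproduce every monomial of [q]; M = N + d rules out aliasing. *)
  set (N := (N0 + d)%nat); set (M := (N + d)%nat).
  assert (HM : 0 < INR (S M)) by (apply lt_0_INR; lia).
  assert (Hpos : forall k, 0 <= fst (ker N (RtoC r * om M k)%Cx) / INR (S M)).
  { intros k; apply Rmult_le_pos; [|left; now apply Rinv_0_lt_compat].
    set (u := (RtoC r * om M k)%Cx).
    assert (Mu : Cmod u = r).
    { unfold u, om; rewrite Cmod_mul, Cmod_expi, Cmod_RtoC, Rabs_pos_eq; lra. }
    assert (B := ker_bound N u ltac:(lra)); rewrite Mu in B.
    specialize (HN0 (S N) ltac:(unfold N; lia)).
    assert (B1 : 2 * r ^ S N / (1 - r) <= (1 - r) / 2).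
    { apply Rmult_le_reg_r with (1 - r); [lra|]; unfold Rdiv at 1; rewrite Rmult_assoc, Rinv_l by lra; lra. }
    assert (T1 := Cmod_sub C1 u); assert (T2 := Cmod_sub_ge C1 u); rewrite Cmod_C1, Mu in T1, T2.
    assert (B2 : (1 - r) / 2 <= (1 - r * r) / (Cmod (C1 - u)%Cx * Cmod (C1 - u)%Cx)).
    { set (D := Cmod (C1 - u)%Cx) in *; apply Rmult_le_reg_r with (D * D); [nra|].
      assert (DD : D * D <= (1 + r) * 2) by nra.
      replace ((1 - r * r) / (D * D) * (D * D)) with (1 - r * r) by (field; nra).
      apply Rmult_le_compat_l with (r := (1 - r) / 2) in DD; [nra|lra]. }
    apply Rabs_le_between in B; lra. }
  exists M, (fun k => fst (ker N (RtoC r * om M k)%Cx) / INR (S M)),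
    (fun k => INR k * (2 * PI / INR (S M))); split; [exact Hpos|split].
  - apply RtoC_inj; rewrite RtoC_sum.
    rewrite (csum_ext _ (fun k => RtoC (/ INR (S M)) * (RtoC (fst (ker N (RtoC r * om M k)%Cx)) * om M k ^ 0))%Cx).
    2:{ intros k _; unfold Rdiv; rewrite RtoC_mul; simpl; ring. }
    rewrite csum_mul, ker_moment by (unfold M, N; lia); simpl Cpow.
    transitivity (RtoC (/ INR (S M)) * RtoC (INR (S M)))%Cx; [ring|].
    rewrite <- RtoC_mul; f_equal; field; lra.
  - intros z.
    assert (E : q (Cscale r z) = csum (fun k => RtoC (fst (ker N (RtoC r * om M k)%Cx) / INR (S M))
                                               * q (z * om M k)%Cx)%Cx M).
    { rewrite Ed.
      rewrite (csum_ext (fun k => RtoC (fst (ker N (RtoC r * om M k)%Cx) / INR (S M)) * q (z * om M k)%Cx)%Cx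
        (fun k => csum (fun i => (RtoC (/ INR (S M)) * c i * z ^ i)
             * (RtoC (fst (ker N (RtoC r * om M k)%Cx)) * om M k ^ i)) d)%Cx).
      2:{ intros k _; rewrite Ed, <- csum_mul; apply csum_ext; intros i _.
          unfold Rdiv; rewrite RtoC_mul, Cpow_mul; ring. }
      rewrite csum_swap; apply csum_ext; intros i Hi.
      rewrite csum_mul, ker_moment, Cscale_RtoC, Cpow_mul by (unfold M, N; lia).
      transitivity ((RtoC (/ INR (S M)) * RtoC (INR (S M))) * (c i * (RtoC r ^ i * z ^ i)))%Cx; [|ring].
      rewrite <- RtoC_mul; replace (/ INR (S M) * INR (S M)) with 1 by (field; lra).
      replace (RtoC 1) with C1 by reflexivity; ring. }
    rewrite E; eapply Rle_trans; [apply Cmod_csum|].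
    apply sum_Rle; intros k _; rewrite Cmod_mul, Cmod_RtoC, Rabs_pos_eq by apply Hpos; unfold om; lra.
Qed.

(** Membership in the disk algebra. The discrete averages reproduce polynomials only; U / D^2 with D
    zero-free on the closed disk is reached as a uniform limit. *)
Definition approximable (f : Cx -> Cx) : Prop :=
  forall e, 0 < e -> exists q, polyfun q /\ forall z, Cmod z <= 1 -> Cmod (f z - q z)%Cx <= e.

Lemma polyfun_bounded q : polyfun q -> exists B, 0 < B /\ forall z, Cmod z <= 1 -> Cmod (q z) <= B.
Proof.
  induction 1 as [c| |f g _ [B [HB H1]] _ [B' [HB' H2]]|f g _ [B [HB H1]] _ [B' [HB' H2]]].
  - exists (Cmod c + 1); split; [generalize (Cmod_ge0 c); lra|intros; lra].
  - exists 1; split; [lra|auto].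
  - exists (B + B'); split; [lra|]; intros z Hz; eapply Rle_trans; [apply Cmod_add|].
    specialize (H1 z Hz); specialize (H2 z Hz); lra.
  - exists (B * B'); split; [nra|]; intros z Hz; rewrite Cmod_mul.
    apply Rmult_le_compat; try apply Cmod_ge0; auto.
Qed.

Lemma approximable_poly q : polyfun q -> approximable q.
Proof.
  intros H e He; exists q; split; [exact H|]; intros z _.
  replace (q z - q z)%Cx with C0 by ring; rewrite Cmod_C0; lra.
Qed.

Lemma approximable_ext f g : (forall z, Cmod z <= 1 -> f z = g z) -> approximable f -> approximable g.
Proof.
  intros E H e He; destruct (H e He) as [q [Hq K]]; exists q; split; [exact Hq|].
  intros z Hz; rewrite <- E by exact Hz; now apply K.
Qed.

Lemma approximable_mul f g : approximable f -> approximable g -> approximable (fun z => f z * g z)%Cx.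
Proof.
  intros Hf Hg e He.
  destruct (Hf 1 ltac:(lra)) as [f1 [Pf1 Kf1]]; destruct (polyfun_bounded f1 Pf1) as [B [HB HB1]].
  assert (Bf : forall z, Cmod z <= 1 -> Cmod (f z) <= B + 1).
  { intros z Hz; assert (T := Cmod_add (f z - f1 z)%Cx (f1 z)).
    replace (f z - f1 z + f1 z)%Cx with (f z) in T by ring.
    specialize (Kf1 z Hz); specialize (HB1 z Hz); lra. }
  destruct (Hg (e / (2 * (B + 1)))) as [q [Pq Kq]]; [apply Rdiv_lt_0_compat; lra|].
  destruct (polyfun_bounded q Pq) as [C [HC HC1]].
  destruct (Hf (e / (2 * C))) as [p [Pp Kp]]; [apply Rdiv_lt_0_compat; lra|].
  exists (fun z => p z * q z)%Cx; split; [now apply polyfun_mul|]; intros z Hz.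
  replace (f z * g z - p z * q z)%Cx with (f z * (g z - q z) + (f z - p z) * q z)%Cx by ring.
  eapply Rle_trans; [apply Cmod_add|]; rewrite !Cmod_mul.
  assert (A1 : Cmod (f z) * Cmod (g z - q z)%Cx <= (B + 1) * (e / (2 * (B + 1))))
    by (apply Rmult_le_compat; try apply Cmod_ge0; auto).
  assert (A2 : Cmod (f z - p z)%Cx * Cmod (q z) <= e / (2 * C) * C)
    by (apply Rmult_le_compat; try apply Cmod_ge0; auto).
  replace ((B + 1) * (e / (2 * (B + 1)))) with (e / 2) in A1 by (field; lra).
  replace (e / (2 * C) * C) with (e / 2) in A2 by (field; lra); lra.
Qed.

Lemma approximable_inv_linear b : 1 < Cmod b -> approximable (fun z => Cinv (z - b)%Cx).
Proof.
  intros Hb e He; assert (Hb0 : b <> C0) by (apply Cmod_neq0; lra).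
  assert (Hi : 0 <= / Cmod b < 1).
  { split; [left; apply Rinv_0_lt_compat; lra|rewrite <- Rinv_1; apply Rinv_lt_contravar; lra]. }
  (* After truncation of the geometric series in z / b the remainder has modulus at most
     |b|^(-(N+1)) / (|b| - 1). *)
  destruct (pow_small (/ Cmod b) (e * (Cmod b - 1)) Hi ltac:(nra)) as [N HN].
  exists (fun z => - Cinv b * csum (fun k => (Cinv b * z) ^ k) N)%Cx; split.
  - apply (polyfun_mul (fun _ => - Cinv b)%Cx); [apply polyfun_const|].
    apply (polyfun_csum (fun k z => (Cinv b * z) ^ k)%Cx); intros k; apply (polyfun_pow (fun z => Cinv b * z)%Cx).
    apply (polyfun_mul (fun _ => Cinv b)); [apply polyfun_const|apply polyfun_id].
  - intros z Hz; assert (Hzb : (z - b)%Cx <> C0).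
    { intros E; apply Csub_eq0 in E; subst; lra. }
    assert (G := geometric (Cinv b * z)%Cx N).
    assert (Hub : (C1 - Cinv b * z)%Cx <> C0).
    { intros E; apply Hzb; transitivity ((- b) * (C1 - Cinv b * z))%Cx; [field; exact Hb0|rewrite E; ring]. }
    assert (Hbz : (b - z)%Cx <> C0) by (intros E; apply Hzb; apply Csub_eq0 in E; subst; ring).
    replace (Cinv (z - b) - - Cinv b * csum (fun k => (Cinv b * z) ^ k) N)%Cx
      with ((Cinv b * z) ^ S N * Cinv (z - b))%Cx.
    + rewrite Cmod_mul, Cmod_pow, Cmod_mul, !Cmod_inv by assumption.
      assert (T := Cmod_sub_ge b z); rewrite Cmod_sub_sym in T.
      apply Rle_trans with (e * (Cmod b - 1) * / (Cmod b - 1)); [|right; field; lra].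
      apply Rmult_le_compat.
      * apply pow_le, Rmult_le_pos; [lra|apply Cmod_ge0].
      * left; apply Rinv_0_lt_compat; lra.
      * eapply Rle_trans; [|apply (HN (S N)); lia]; apply pow_incr; split.
        -- apply Rmult_le_pos; [lra|apply Cmod_ge0].
        -- rewrite <- (Rmult_1_r (/ Cmod b)) at 2; apply Rmult_le_compat_l; lra.
      * apply Rinv_le_contravar; lra.
    + replace (csum (fun k => (Cinv b * z) ^ k)%Cx N) with ((C1 - (Cinv b * z) ^ S N) / (C1 - Cinv b * z))%Cx
        by (rewrite <- G; field; split; assumption).
      set (v := ((Cinv b * z) ^ S N)%Cx).
      field; repeat split; assumption.
Qed.

Lemma Cinv_mul z w : z <> C0 -> w <> C0 -> Cinv (z * w)%Cx = (Cinv z * Cinv w)%Cx.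
Proof. intros; field; split; assumption. Qed.

Lemma approximable_inv D : polyfun D -> (forall z, Cmod z <= 1 -> D z <> C0) ->
  approximable (fun z => Cinv (D z)).
Proof.
  intros HD H0; destruct (ComplexRoots.polyfun_coefs D HD) as [c [m E]].
  destruct (poly1_factor c m) as [Z|[A [l [HA [_ [_ F]]]]]].
  - elim (H0 C0); [rewrite Cmod_C0; lra|]; rewrite E, <- (csum_C0 m).
    apply csum_ext; intros i Hi; rewrite Z by exact Hi; ring.
  - assert (Ef : forall z, D z = (A * cprodl (fun x => z - x) l)%Cx) by (intros z; rewrite E; apply F).
    assert (Hl : forall x, In x l -> 1 < Cmod x).
    { intros x Hx; apply Rnot_le_lt; intros K; apply (H0 x K); rewrite Ef.
      apply cprodl_eq0 in Hx; rewrite Hx; ring. }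
    apply (approximable_ext (fun z => Cinv A * Cinv (cprodl (fun x => z - x) l))%Cx).
    + intros z Hz; rewrite Ef, Cinv_mul; [reflexivity|exact HA|].
      intros K; apply (H0 z Hz); rewrite Ef, K; ring.
    + apply approximable_mul; [apply approximable_poly, polyfun_const|].
      clear - Hl; induction l as [|x l IH]; [apply (approximable_poly (fun _ => Cinv C1)), polyfun_const|].
      assert (K : forall z y, Cmod z <= 1 -> In y (x :: l) -> (z - y)%Cx <> C0).
      { intros z y Hz Hy N; apply Csub_eq0 in N; subst; specialize (Hl y Hy); lra. }
      apply (approximable_ext (fun z => Cinv (z - x) * Cinv (cprodl (fun x => z - x) l))%Cx).
      * intros z Hz; simpl; rewrite Cinv_mul; [reflexivity|apply K; [exact Hz|now left]|].
        apply cprodl_neq0; intros y Hy; apply K; [exact Hz|now right].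
      * apply approximable_mul; [apply approximable_inv_linear, Hl; now left|].
        apply IH; intros; apply Hl; now right.
Qed.

Lemma ccont_polyfun {U : UniformSpace} q (f : U -> Cx) x : polyfun q -> ccont f x -> ccont (fun u => q (f u)) x.
Proof.
  intros Hq Hf; induction Hq; [apply ccont_const|exact Hf|now apply ccont_add|now apply ccont_mul].
Qed.

Lemma RInt_sum (f : nat -> R -> R) a b n : (forall k s, continuous (f k) s) ->
  RInt (fun s => sum_f_R0 (fun k => f k s) n) a b = sum_f_R0 (fun k => RInt (f k) a b) n /\
  forall s, continuous (fun s => sum_f_R0 (fun k => f k s) n) s.
Proof.
  intros H; induction n as [|n [IH1 IH2]]; simpl; [split; [reflexivity|apply H]|].
  split; [|intros s; apply cont_add; [apply IH2|apply H]].
  rewrite RInt_add_cont, IH1; [reflexivity|exact IH2|apply H].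
Qed.

(** Up to an error, |f(rz)| is at most a convex combination of |f| at rotations of z. Jensen's
    inequality moves the power inside, rotation invariance gives all rotated integrals the same
    value, and the error tends to zero. *)
Lemma hardy_mean P U D r : 1 <= P -> polyfun U -> polyfun D -> 0 <= r < 1 ->
  (forall z, Cmod z <= 1 -> D z <> C0) ->
  RInt (fun s => rpow (Cmod (U (Cscale r (Cexpi s))) / (Cmod (D (Cscale r (Cexpi s))) * Cmod (D (Cscale r (Cexpi s))))) P) 0 (2 * PI)
  <= RInt (fun s => rpow (Cmod (U (Cexpi s)) / (Cmod (D (Cexpi s)) * Cmod (D (Cexpi s)))) P) 0 (2 * PI).
Proof.
  intros HP HU HD Hr H0; assert (HPI := PI_RGT_0).
  set (g := fun z => Cmod (U z) / (Cmod (D z) * Cmod (D z))).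
  set (f := fun z => (U z * (Cinv (D z) * Cinv (D z)))%Cx).
  assert (Ef : forall z, Cmod z <= 1 -> Cmod (f z) = g z).
  { intros z Hz; specialize (H0 z Hz); unfold f, g; rewrite !Cmod_mul, !Cmod_inv by exact H0.
    apply Cmod_gt0 in H0; field; lra. }
  assert (Af : approximable f).
  { apply approximable_mul; [now apply approximable_poly|]; apply approximable_mul; now apply approximable_inv. }
  assert (g0 : forall z, Cmod z <= 1 -> 0 <= g z) by (intros z Hz; rewrite <- Ef by exact Hz; apply Cmod_ge0).
  assert (Cg : forall (V : UniformSpace) (h : V -> Cx) x, ccont h x -> Cmod (h x) <= 1 ->
             continuous (fun u => g (h u)) x).
  { intros V h x Hh Hx; specialize (H0 _ Hx); apply Cmod_gt0 in H0; unfold g.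
    apply cont_div; [now apply cont_Cmod, ccont_polyfun|apply cont_mul; now apply cont_Cmod, ccont_polyfun|nra]. }
  assert (Cr : forall s, continuous (fun s => rpow (g (Cscale r (Cexpi s))) P) s).
  { intros s; apply cont_rpow; [exact HP|]; apply Cg.
    - apply ccont_scale; [apply continuous_const|apply ccont_expi_id].
    - rewrite Cmod_scale, Cmod_expi; lra. }
  (* The approximation error enters twice, at r z and at the rotated points, hence 2 e. *)
  set (F := fun e s => rpow (g (Cexpi s) + 2 * e) P).
  assert (CF : cont2 F).
  { intros [e s]; unfold F; apply cont_rpow; [exact HP|]; apply cont_add.
    - apply Cg; [apply ccont_expi, continuous_snd|rewrite Cmod_expi; lra].
    - apply cont_mul; [apply continuous_const|apply continuous_fst]. }
  assert (Main : forall e, 0 < e ->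
     RInt (fun s => rpow (g (Cscale r (Cexpi s))) P) 0 (2 * PI) <= RInt (F e) 0 (2 * PI)).
  { intros e He; destruct (Af e He) as [q [Hq Kq]].
    destruct (polyfun_average q r Hq Hr) as [M [w [th [Hw [Hs Hav]]]]].
    assert (Pt : forall s, rpow (g (Cscale r (Cexpi s))) P <= sum_f_R0 (fun k => w k * F e (s + th k)) M).
    { intros s; eapply Rle_trans; [|apply (jensen_rpow P w (fun k => g (Cexpi (s + th k)) + 2 * e) M HP Hw); [|exact Hs]].
      - apply rpow_le; [lra|].
        assert (B : Cmod (Cscale r (Cexpi s)) <= 1) by (rewrite Cmod_scale, Cmod_expi; lra).
        rewrite <- Ef by exact B.
        assert (T := Cmod_add (f (Cscale r (Cexpi s)) - q (Cscale r (Cexpi s)))%Cx (q (Cscale r (Cexpi s)))).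
        replace (f (Cscale r (Cexpi s)) - q (Cscale r (Cexpi s)) + q (Cscale r (Cexpi s)))%Cx
          with (f (Cscale r (Cexpi s))) in T by ring.
        specialize (Kq _ B) as K1.
        assert (S1 : sum_f_R0 (fun k => w k * Cmod (q (Cexpi s * Cexpi (th k))%Cx)) M
                     <= sum_f_R0 (fun k => w k * (g (Cexpi (s + th k)) + e)) M).
        { apply sum_Rle; intros k _; apply Rmult_le_compat_l; [apply Hw|].
          rewrite <- Cexpi_add; assert (B' : Cmod (Cexpi (s + th k)) <= 1) by (rewrite Cmod_expi; lra).
          rewrite <- Ef by exact B'; specialize (Kq _ B'); rewrite Cmod_sub_sym in Kq.
          assert (T' := Cmod_add (q (Cexpi (s + th k)) - f (Cexpi (s + th k)))%Cx (f (Cexpi (s + th k)))).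
          replace (q (Cexpi (s + th k)) - f (Cexpi (s + th k)) + f (Cexpi (s + th k)))%Cx
            with (q (Cexpi (s + th k))) in T' by ring; lra. }
        assert (S2 : sum_f_R0 (fun k => w k * (g (Cexpi (s + th k)) + 2 * e)) M
                     = sum_f_R0 (fun k => w k * (g (Cexpi (s + th k)) + e)) M + e).
        { rewrite (sum_eq _ (fun k => w k * (g (Cexpi (s + th k)) + e) + e * w k)) by (intros; ring).
          rewrite sum_plus, sum_scal_l, Hs; ring. }
        specialize (Hav (Cexpi s)); lra.
      - intros k; assert (B' : Cmod (Cexpi (s + th k)) <= 1) by (rewrite Cmod_expi; lra).
        specialize (g0 _ B'); lra. }
    assert (Ck : forall k s, continuous (fun s => w k * F e (s + th k)) s).
    { intros k s; apply cont_mul; [apply continuous_const|].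
      apply (continuous_comp (fun s => s + th k) (F e)); [|apply cont2_l, CF].
      apply cont_add; [apply continuous_id|apply continuous_const]. }
    destruct (RInt_sum (fun k s => w k * F e (s + th k)) 0 (2 * PI) M Ck) as [E Cs].
    eapply Rle_trans; [apply (RInt_le_cont _ (fun s => sum_f_R0 (fun k => w k * F e (s + th k)) M))|].
    - lra.
    - exact Cr.
    - exact Cs.
    - intros s _; apply Pt.
    - rewrite E; rewrite (sum_eq _ (fun k => RInt (F e) 0 (2 * PI) * w k)).
      + rewrite sum_scal_l, Hs; lra.
      + intros k _; rewrite RInt_scal_cont.
        2:{ intros s; apply (continuous_comp (fun s => s + th k) (F e)); [|apply cont2_l, CF].
            apply cont_add; [apply continuous_id|apply continuous_const]. }
        rewrite (RInt_period (F e)); [ring|apply cont2_l, CF|].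
        intros s; unfold F; rewrite Cexpi_period; reflexivity. }
  (* The substitution e = 1 - x turns the limit e -> 0 into a limit x -> 1 from below. *)
  assert (Lim := limit_from_below
    (fun x => RInt (fun s => rpow (g (Cscale r (Cexpi s))) P) 0 (2 * PI) - RInt (F (1 - x)) 0 (2 * PI))).
  assert (L : RInt (fun s => rpow (g (Cscale r (Cexpi s))) P) 0 (2 * PI) - RInt (F (1 - 1)) 0 (2 * PI) <= 0).
  { apply Lim.
    - apply cont_sub; [apply continuous_const|].
      apply (continuous_comp (fun x => 1 - x) (fun e => RInt (F e) 0 (2 * PI))).
      + apply cont_sub; [apply continuous_const|apply continuous_id].
      + apply cont2_RInt; [lra|exact CF].
    - intros x Hx; specialize (Main (1 - x) ltac:(lra)); lra. }
  replace (RInt (F (1 - 1)) 0 (2 * PI)) with (RInt (fun s => rpow (g (Cexpi s)) P) 0 (2 * PI)) in L.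
  - unfold g in L; lra.
  - apply RInt_ext; intros s _; unfold F; f_equal; ring.
Qed.

(** * Integrals of the derivative over slices *)

Lemma ccont_col {U : UniformSpace} a n i (g : U -> Cx) x : ccont g x -> ccont (fun u => col a n i (g u)) x.
Proof. intros H; apply ccont_polyfun; [apply polyfun_poly1|exact H]. Qed.

Lemma ccont_pd1 {U : UniformSpace} a m n (f g : U -> Cx) x :
  ccont f x -> ccont g x -> ccont (fun u => pd1 a m n (f u) (g u)) x.
Proof.
  intros Hf Hg; apply (ccont_csum (fun i u => (RtoC (INR i) * col a n i (g u) * f u ^ (i - 1))%Cx)).
  intros i; apply ccont_mul; [apply ccont_mul; [apply ccont_const|now apply ccont_col]|now apply ccont_pow].
Qed.

Lemma ccont_num {U : UniformSpace} a m n (f g : U -> Cx) x :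
  ccont f x -> ccont g x -> ccont (fun u => num a m n (f u) (g u)) x.
Proof.
  intros Hf Hg; unfold num.
  apply ccont_sub; apply ccont_mul; first [exact (ccont_pd1 _ m n f g x Hf Hg)|exact (ccont_peval _ m n f g x Hf Hg)].
Qed.

Lemma polyfun_sub f g : polyfun f -> polyfun g -> polyfun (fun z => f z - g z)%Cx.
Proof.
  intros Hf Hg; apply (polyfun_add f (fun z => - g z)%Cx Hf).
  replace (fun z => - g z)%Cx with (fun z => (- C1) * g z)%Cx
    by (apply functional_extensionality; intros; ring).
  apply (polyfun_mul (fun _ => - C1)%Cx); [apply polyfun_const|exact Hg].
Qed.

Lemma polyfun_peval_l a m n zeta : polyfun (fun w => peval a m n w zeta).
Proof.
  replace (fun w => peval a m n w zeta) with (poly1 (fun i => col a n i zeta) m)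
    by (apply functional_extensionality; intros; now rewrite peval_col).
  apply polyfun_poly1.
Qed.

Lemma polyfun_peval_r a m n w : polyfun (peval a m n w).
Proof.
  replace (peval a m n w) with (fun z => peval (tr a) n m z w)
    by (apply functional_extensionality; intros; apply peval_tr).
  apply polyfun_peval_l.
Qed.

Lemma polyfun_pd1_l a m n zeta : polyfun (fun w => pd1 a m n w zeta).
Proof.
  apply (polyfun_csum (fun i w => RtoC (INR i) * col a n i zeta * w ^ (i - 1))%Cx); intros i.
  apply (polyfun_mul (fun _ => RtoC (INR i) * col a n i zeta)%Cx); [apply polyfun_const|].
  apply (polyfun_pow (fun w => w)), polyfun_id.
Qed.

Lemma polyfun_pd1_r a m n w : polyfun (fun zeta => pd1 a m n w zeta).
Proof.
  apply (polyfun_csum (fun i zeta => RtoC (INR i) * col a n i zeta * w ^ (i - 1))%Cx); intros i.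
  apply (polyfun_mul (fun zeta => RtoC (INR i) * col a n i zeta)%Cx); [|apply polyfun_const].
  apply (polyfun_mul (fun _ => RtoC (INR i))); [apply polyfun_const|apply polyfun_poly1].
Qed.

Lemma polyfun_num_l a m n zeta : polyfun (fun w => num a m n w zeta).
Proof.
  apply polyfun_sub; apply polyfun_mul; try apply polyfun_pd1_l; apply polyfun_peval_l.
Qed.

Lemma polyfun_num_r a m n w : polyfun (fun zeta => num a m n w zeta).
Proof.
  apply (polyfun_sub (fun zeta => pd1 (refl_coef a m n) m n w zeta * peval a m n w zeta)%Cx);
    apply polyfun_mul; try apply polyfun_pd1_r; apply polyfun_peval_r.
Qed.

(* The P-th power of the modulus of the derivative of phi, regularized by d > 0:
   [gpow 0] is |d phi / d z1|^P wherever the denominator does not vanish. *)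
Definition gpow a m n P (d : R) (z1 z2 : Cx) : R :=
  rpow (Cmod (num a m n z1 z2) / (Cmod (peval a m n z1 z2) * Cmod (peval a m n z1 z2) + d)) P.

Lemma gpow_ge0 a m n P d z1 z2 : 0 <= gpow a m n P d z1 z2.
Proof. apply rpow_ge0. Qed.

Lemma cont_gpow {U : UniformSpace} a m n P d (f g : U -> Cx) x : 1 <= P -> ccont f x -> ccont g x ->
  0 <= d -> (0 < d \/ peval a m n (f x) (g x) <> C0) -> continuous (fun u => gpow a m n P d (f u) (g u)) x.
Proof.
  intros HP Hf Hg Hd H; apply cont_rpow; [exact HP|apply cont_div].
  - now apply cont_Cmod, ccont_num.
  - apply cont_add; [|apply continuous_const]; apply cont_mul; now apply cont_Cmod, ccont_peval.
  - set (y := Cmod (peval a m n (f x) (g x))); assert (Hy : 0 <= y) by apply Cmod_ge0.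
    destruct H as [H|H]; [nra|]; apply Cmod_gt0 in H; fold y in H; nra.
Qed.

Lemma gpow_anti a m n P d z1 z2 : 0 <= P -> 0 <= d -> peval a m n z1 z2 <> C0 ->
  gpow a m n P d z1 z2 <= gpow a m n P 0 z1 z2.
Proof.
  intros HP Hd H; apply rpow_le; [exact HP|]; apply Cmod_gt0 in H.
  apply Rmult_le_compat_l; [apply Cmod_ge0|]; apply Rinv_le_contravar; nra.
Qed.

(** Where |p|^2 >= d the regularized denominator |p|^2 + d is at most 2 |p|^2. *)
Lemma gpow_half a m n P d z1 z2 : 0 <= P -> 0 < d ->
  d <= Cmod (peval a m n z1 z2) * Cmod (peval a m n z1 z2) ->
  gpow a m n P 0 z1 z2 <= rpow 2 P * gpow a m n P d z1 z2.
Proof.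
  intros HP Hd H; unfold gpow; set (y := Cmod (peval a m n z1 z2)) in *.
  assert (N0 := Cmod_ge0 (num a m n z1 z2)).
  rewrite <- rpow_mul; [|lra|].
  - apply rpow_le; [exact HP|].
    replace (2 * (Cmod (num a m n z1 z2) / (y * y + d))) with (Cmod (num a m n z1 z2) * (2 / (y * y + d)))
      by (field; lra).
    apply Rmult_le_compat_l; [exact N0|].
    rewrite Rplus_0_r; set (q := y * y) in *.
    apply Rmult_le_reg_r with (q * (q + d)); [apply Rmult_lt_0_compat; lra|].
    replace (/ q * (q * (q + d))) with (q + d) by (field; lra).
    replace (2 / (q + d) * (q * (q + d))) with (2 * q) by (field; lra); lra.
  - apply Rmult_le_pos; [exact N0|left; apply Rinv_0_lt_compat; lra].
Qed.

Lemma rsuml_ge0 f l : (forall x, In x l -> 0 <= f x) -> 0 <= rsuml f l.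
Proof.
  induction l as [|x l IH]; simpl; intros H; [lra|].
  assert (0 <= f x) by (apply H; now left); assert (0 <= rsuml f l) by (apply IH; intros; apply H; now right); lra.
Qed.

Lemma rsuml_le f l B : (forall x, In x l -> f x <= B) -> rsuml f l <= INR (length l) * B.
Proof.
  induction l as [|x l IH]; intros H; [simpl; lra|].
  change (length (x :: l)) with (S (length l)); rewrite S_INR; simpl.
  assert (f x <= B) by (apply H; now left).
  assert (rsuml f l <= INR (length l) * B) by (apply IH; intros; apply H; now right); lra.
Qed.

Lemma rsuml_in f l x : (forall x, In x l -> 0 <= f x) -> In x l -> f x <= rsuml f l.
Proof.
  induction l as [|y l IH]; [intros _ []|]; intros H [<-|Hx]; simpl.
  - assert (0 <= rsuml f l) by (apply rsuml_ge0; intros; apply H; now right); lra.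
  - assert (0 <= f y) by (apply H; now left).
    assert (f x <= rsuml f l) by (apply IH; [intros; apply H; now right|exact Hx]); lra.
Qed.

Lemma poisson_bounds x w : Cmod x < 1 -> Cmod w = 1 -> 0 <= poisson x w <= 2 / (1 - Cmod x).
Proof.
  intros Hx Hw; assert (X0 := Cmod_ge0 x); assert (T := Cmod_sub_ge w x); rewrite Hw in T.
  unfold poisson; set (D := Cmod (w - x)%Cx) in *; set (X := Cmod x) in *; split.
  - apply Rmult_le_pos; [nra|left; apply Rinv_0_lt_compat; nra].
  - apply Rmult_le_reg_r with (D * D); [nra|].
    replace ((1 - X * X) / (D * D) * (D * D)) with (1 - X * X) by (field; nra).
    apply Rmult_le_reg_r with (1 - X); [lra|].
    replace (2 / (1 - X) * (D * D) * (1 - X)) with (2 * (D * D)) by (field; lra).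
    assert ((1 - X) * (1 - X) <= D * D) by nra; nra.
Qed.

Lemma rsuml_poisson_cont l : (forall x, In x l -> Cmod x < 1) ->
  forall s, continuous (fun s => rsuml (fun x => poisson x (Cexpi s)) l) s.
Proof.
  induction l as [|x l IH]; intros H s; simpl; [apply continuous_const|].
  apply cont_add; [apply poisson_cont, H; now left|apply IH; intros; apply H; now right].
Qed.

Lemma RInt_rsuml_poisson l : (forall x, In x l -> Cmod x < 1) ->
  RInt (fun s => rsuml (fun x => poisson x (Cexpi s)) l) 0 (2 * PI) <= INR (length l) * (4 * PI).
Proof.
  induction l as [|x l IH]; intros H; [simpl; rewrite RInt_cst; lra|].
  change (length (x :: l)) with (S (length l)); rewrite S_INR; simpl.
  rewrite RInt_add_cont.
  - assert (K := RInt_poisson x (H x (or_introl eq_refl))).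
    assert (L := IH (fun y Hy => H y (or_intror Hy))); lra.
  - intros s; apply poisson_cont, H; now left.
  - apply rsuml_poisson_cont; intros; apply H; now right.
Qed.

Lemma gpow_poisson a m n P zeta l : Cmod zeta = 1 -> good a m n zeta -> root_spec a m n zeta l ->
  forall s, gpow a m n P 0 (Cexpi s) zeta = rpow (rsuml (fun x => poisson x (Cexpi s)) l) P.
Proof.
  intros Hz Hg [Hl [E Hin]] s; unfold gpow; rewrite Rplus_0_r.
  rewrite (num_poisson a m n zeta _ l Hz Hl E (Cexpi s) (Cmod_expi s)) by (apply Hg, Cmod_expi).
  rewrite Rabs_pos_eq; [reflexivity|].
  apply rsuml_ge0; intros x Hx; apply poisson_bounds; [now apply Hin|apply Cmod_expi].
Qed.

(** With b the sum of Poisson kernels, b^P <= (max b)^(P-1) b, where b <= 2m/eps and its integral is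
    at most 4 pi m. The bound is independent of d. *)
Lemma slice_upper a m n P zeta l d : 1 <= P -> 0 < d -> Cmod zeta = 1 -> good a m n zeta ->
  root_spec a m n zeta l -> l <> nil ->
  RInt (fun s => gpow a m n P d (Cexpi s) zeta) 0 (2 * PI)
  <= Rpower (2 * INR m / (1 - maxmod l)) (P - 1) * (INR m * (4 * PI)).
Proof.
  intros HP Hd Hz Hg Hroot Hn; assert (HPI := PI_RGT_0).
  destruct (Hroot) as [Hl [_ Hin]]; specialize (Hin Hg).
  destruct (maxmod_attained l Hn) as [x0 [Hx0 Ex0]]; assert (Hx1 := Hin x0 Hx0).
  set (e := 1 - maxmod l); assert (He : 0 < e) by (unfold e; lra).
  assert (Hm : 0 < INR m).
  { apply lt_0_INR; rewrite <- Hl; destruct l; [congruence|simpl; lia]. }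
  set (b := fun s => rsuml (fun x => poisson x (Cexpi s)) l).
  assert (Cb := rsuml_poisson_cont l Hin).
  set (k := Rpower (2 * INR m / e) (P - 1)); assert (Hk : 0 < k) by apply Rpower_pos.
  apply Rle_trans with (RInt (fun s => k * b s) 0 (2 * PI)).
  - apply RInt_le_cont; [lra| | |].
    + intros s; apply cont_gpow; [exact HP|apply ccont_expi_id|apply ccont_const|lra|now left].
    + intros s; apply cont_mul; [apply continuous_const|apply Cb].
    + intros s _; eapply Rle_trans; [apply gpow_anti; [lra|lra|apply Hg, Cmod_expi]|].
      rewrite (gpow_poisson a m n P zeta l Hz Hg Hroot); apply rpow_le_linear; [exact HP|split|].
      * apply rsuml_ge0; intros x Hx; apply poisson_bounds; [now apply Hin|apply Cmod_expi].
      * rewrite <- Hl; replace (2 * INR (length l) / e) with (INR (length l) * (2 / e)) by (field; lra).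
        apply rsuml_le; intros x Hx; eapply Rle_trans; [apply poisson_bounds; [now apply Hin|apply Cmod_expi]|].
        assert (U := maxmod_ub l x Hx); apply Rmult_le_compat_l; [lra|].
        apply Rinv_le_contravar; unfold e in *; lra.
      * apply Rdiv_lt_0_compat; lra.
  - rewrite RInt_scal_cont by exact Cb; apply Rmult_le_compat_l; [lra|].
    rewrite <- Hl; now apply RInt_rsuml_poisson.
Qed.

(** On an arc of length eps starting at the direction of the root nearest the circle, |w - x| <= 2
    eps, so its Poisson kernel is at least 1/(4 eps). The constant 8 includes a factor 2 for the
    regularization. *)
Lemma slice_lower a m n P zeta l d : 1 <= P -> 0 < d -> Cmod zeta = 1 -> good a m n zeta ->
  root_spec a m n zeta l -> l <> nil ->
  (forall s, d <= Cmod (peval a m n (Cexpi s) zeta) * Cmod (peval a m n (Cexpi s) zeta)) ->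
  Rpower (/ 8) P * Rpower (1 - maxmod l) (1 - P)
  <= RInt (fun s => gpow a m n P d (Cexpi s) zeta) 0 (2 * PI).
Proof.
  intros HP Hd Hz Hg Hroot Hn Hlow; assert (HPI := PI_RGT_0).
  destruct (Hroot) as [Hl [_ Hin]]; specialize (Hin Hg).
  destruct (maxmod_attained l Hn) as [x [Hx Ex]]; assert (Hx1 := Hin x Hx).
  assert (X0 := Cmod_ge0 x); rewrite <- Ex.
  set (e := 1 - Cmod x); assert (He : 0 < e <= 1) by (unfold e; lra).
  assert (Hs0 : exists s0, x = Cscale (Cmod x) (Cexpi s0)).
  { destruct (Req_dec (Cmod x) 0) as [E|E].
    - exists 0; rewrite E; apply Cmod_eq0 in E; rewrite E, Cscale_RtoC.
      replace (RtoC 0) with C0 by reflexivity; ring.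
    - destruct (unit_Cexpi (Cscale (/ Cmod x) x)) as [s0 [_ Es]].
      + rewrite Cmod_scale by (left; apply Rinv_0_lt_compat; lra); field; exact E.
      + exists s0; rewrite <- Es; unfold Cscale; simpl; rewrite (Cx_eta x) at 1; f_equal; field; exact E. }
  destruct Hs0 as [s0 Es0].
  assert (Cf : forall s, continuous (fun s => gpow a m n P d (Cexpi s) zeta) s).
  { intros s; apply cont_gpow; [exact HP|apply ccont_expi_id|apply ccont_const|lra|now left]. }
  (* Rotation moves the arc to [0, eps], inside one period, so it does not wrap around. *)
  rewrite <- (RInt_period (fun s : R => gpow a m n P d (Cexpi s) zeta) (2 * PI) s0 Cf).
  2:{ intros s; rewrite Cexpi_period; reflexivity. }
  assert (Cf' : forall s, continuous (fun s => gpow a m n P d (Cexpi (s + s0)) zeta) s).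
  { intros s; apply (continuous_comp (fun s => s + s0) (fun s => gpow a m n P d (Cexpi s) zeta)); [|apply Cf].
    apply cont_add; [apply continuous_id|apply continuous_const]. }
  apply Rle_trans with (RInt (fun s => gpow a m n P d (Cexpi (s + s0)) zeta) 0 e).
  2:{ apply RInt_mono_cont; [lra|generalize PI2_1; lra|exact Cf'|intros; apply gpow_ge0]. }
  apply Rle_trans with (RInt (fun _ => rpow (/ (8 * e)) P) 0 e).
  - rewrite RInt_cst, Rminus_0_r, rpow_Rpower by (apply Rinv_0_lt_compat; lra).
    right; replace (/ (8 * e)) with (/ 8 * / e) by (field; lra).
    rewrite <- Rpower_mult_distr by (try apply Rinv_0_lt_compat; lra).
    replace (1 - P) with (1 + - P) by ring; rewrite Rpower_plus, Rpower_1 by lra.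
    replace (Rpower (/ e) P) with (Rpower e (- P)); [ring|].
    unfold Rpower; rewrite ln_Rinv by lra; f_equal; ring.
  - apply RInt_le_cont; [lra|intros; apply continuous_const|exact Cf'|].
    intros s Hs.
    assert (G : rpow (/ (4 * e)) P <= rpow 2 P * gpow a m n P d (Cexpi (s + s0)) zeta).
    { eapply Rle_trans; [|apply gpow_half; [lra|exact Hd|apply Hlow]].
      rewrite (gpow_poisson a m n P zeta l Hz Hg Hroot); apply rpow_le; [lra|].
      apply Rle_trans with (poisson x (Cexpi (s + s0))).
      - unfold poisson.
        assert (D : Cmod (Cexpi (s + s0) - x)%Cx <= 2 * e).
        { replace (Cexpi (s + s0) - x)%Cx with (Cexpi (s + s0) - Cexpi s0 + (Cexpi s0 - x))%Cx by ring.
          eapply Rle_trans; [apply Cmod_add|].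
          assert (A1 := Cmod_expi_sub (s + s0) s0); replace (s + s0 - s0) with s in A1 by ring.
          rewrite Rabs_pos_eq in A1 by lra; specialize (A1 ltac:(lra)).
          assert (A2 : Cmod (Cexpi s0 - x)%Cx = e).
          { rewrite Es0; replace (Cexpi s0 - Cscale (Cmod x) (Cexpi s0))%Cx with (Cscale e (Cexpi s0)).
            - rewrite Cmod_scale, Cmod_expi; lra.
            - unfold e, Cscale, Csub, Cadd, Copp; simpl; f_equal; ring. }
          lra. }
        assert (D0 : 0 < Cmod (Cexpi (s + s0) - x)%Cx)
          by (assert (T := Cmod_sub_ge (Cexpi (s + s0)) x); rewrite Cmod_expi in T; lra).
        set (y := Cmod (Cexpi (s + s0) - x)%Cx) in *.
        assert (Y : y * y <= 4 * e * e) by nra.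
        apply Rmult_le_reg_r with (4 * e * (y * y)); [apply Rmult_lt_0_compat; nra|].
        replace (/ (4 * e) * (4 * e * (y * y))) with (y * y) by (field; lra).
        replace ((1 - Cmod x * Cmod x) / (y * y) * (4 * e * (y * y))) with ((1 - Cmod x * Cmod x) * (4 * e))
          by (field; lra).
        assert (e <= 1 - Cmod x * Cmod x) by (unfold e; nra); nra.
      - apply (rsuml_in (fun x => poisson x (Cexpi (s + s0)))); [|exact Hx].
        intros y Hy; apply poisson_bounds; [now apply Hin|apply Cmod_expi]. }
    replace (/ (4 * e)) with (2 * / (8 * e)) in G by (field; lra).
    rewrite rpow_mul in G; [|lra|left; apply Rinv_0_lt_compat; lra].
    apply Rmult_le_reg_l with (rpow 2 P); [rewrite rpow_Rpower by lra; apply Rpower_pos|exact G].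
Qed.

(** * Integrability over the torus *)

Lemma cont2_gpow a m n P d : 1 <= P -> 0 < d ->
  cont2 (fun s t => gpow a m n P d (Cexpi s) (Cexpi t)).
Proof.
  intros HP Hd [s t]; apply (cont_gpow a m n P d (fun z : R * R => Cexpi (fst z)) (fun z => Cexpi (snd z))).
  - exact HP.
  - apply ccont_expi, continuous_fst.
  - apply ccont_expi, continuous_snd.
  - lra.
  - now left.
Qed.

Definition slice a m n P d (t : R) : R :=
  RInt (fun s => gpow a m n P d (Cexpi s) (Cexpi t)) 0 (2 * PI).

Lemma two_PI_pos : 0 <= 2 * PI.
Proof. generalize PI_RGT_0; lra. Qed.

Lemma slice_cont a m n P d : 1 <= P -> 0 < d -> forall t, continuous (slice a m n P d) t.
Proof.
  intros HP Hd t.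
  exact (cont2_RInt (fun t s => gpow a m n P d (Cexpi s) (Cexpi t)) 0 (2 * PI) two_PI_pos
           (cont2_swap _ (cont2_gpow a m n P d HP Hd)) t).
Qed.

Lemma slice_ge0 a m n P d : 1 <= P -> 0 < d -> forall t, 0 <= slice a m n P d t.
Proof.
  intros HP Hd t; apply RInt_ge0_cont; [apply two_PI_pos| |intros; apply gpow_ge0].
  exact (cont2_l _ (cont2_swap _ (cont2_gpow a m n P d HP Hd)) t).
Qed.

(** |p|^2 has a positive minimum over the circle at [t0], and by the tube lemma half of it survives
    for nearby t. *)
Lemma good_lower_local a m n t0 : good a m n (Cexpi t0) ->
  exists eta c0, 0 < eta /\ 0 < c0 /\ forall t, Rabs (t - t0) < eta -> forall s,
    c0 <= Cmod (peval a m n (Cexpi s) (Cexpi t)) * Cmod (peval a m n (Cexpi s) (Cexpi t)).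
Proof.
  intros Hg.
  set (f := fun t s => Cmod (peval a m n (Cexpi s) (Cexpi t)) * Cmod (peval a m n (Cexpi s) (Cexpi t))).
  assert (Cf : cont2 f).
  { intros [t s]; unfold f; apply cont_mul; apply cont_Cmod, ccont_peval;
      try (apply ccont_expi, continuous_snd); apply ccont_expi, continuous_fst. }
  destruct (continuity_ab_min (f t0) 0 (2 * PI) two_PI_pos) as [s1 [Hmin _]].
  { intros s _; apply continuity_pt_filterlim, (cont2_l f Cf). }
  assert (Hp : 0 < f t0 s1).
  { unfold f; assert (K := Cmod_gt0 _ (Hg (Cexpi s1) (Cmod_expi s1))); now apply Rmult_lt_0_compat. }
  destruct (uniform_slice (U := R_UniformSpace) f 0 (2 * PI) t0 (f t0 s1 / 2) two_PI_pos ltac:(lra) Cf)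
    as [eta Heta].
  exists eta, (f t0 s1 / 2); split; [apply cond_pos|split; [lra|]]; intros t Ht s.
  destruct (unit_Cexpi (Cexpi s) (Cmod_expi s)) as [s' [Hs' E]]; rewrite E.
  specialize (Heta t Ht s' ltac:(lra)); specialize (Hmin s' ltac:(lra)).
  apply Rabs_le_between in Heta; change (f t0 s1 / 2 <= f t s'); lra.
Qed.

Lemma good_lower a m n x y : x <= y -> (forall t, x <= t <= y -> good a m n (Cexpi t)) ->
  exists d, 0 < d /\ forall t, x <= t <= y -> forall s,
    d <= Cmod (peval a m n (Cexpi s) (Cexpi t)) * Cmod (peval a m n (Cexpi s) (Cexpi t)).
Proof.
  intros Hxy Hg.
  refine (cousin (fun x y => exists d, 0 < d /\ forall t, x <= t <= y -> forall s,
    d <= Cmod (peval a m n (Cexpi s) (Cexpi t)) * Cmod (peval a m n (Cexpi s) (Cexpi t))) x y Hxy _ _).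
  - intros u v w H [d [Hd K]] [d' [Hd' K']]; exists (Rmin d d'); split; [now apply Rmin_glb_lt|].
    intros t Ht s; destruct (Rle_dec t v).
    + eapply Rle_trans; [apply Rmin_l|apply K; lra].
    + eapply Rle_trans; [apply Rmin_r|apply K'; lra].
  - intros t0 Ht0; destruct (good_lower_local a m n t0 (Hg t0 Ht0)) as [eta [c0 [He [Hc K]]]].
    exists eta; split; [exact He|]; intros u v Hu Hv Hu' Hv'; exists c0; split; [exact Hc|].
    intros t Ht s; apply K; apply Rabs_lt_between; lra.
Qed.

Lemma Rpower_anti x y q : 0 < x <= y -> q <= 0 -> Rpower y q <= Rpower x q.
Proof.
  intros H Hq; unfold Rpower; destruct (Req_dec x y) as [->|N]; [lra|].
  assert (L : ln x < ln y) by (apply ln_increasing; lra).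
  destruct (Req_dec q 0) as [->|]; [rewrite !Rmult_0_l; lra|].
  left; apply exp_increasing; nra.
Qed.

Lemma RInt_reflect (f : R -> R) c t0 : (forall t, continuous f t) ->
  RInt f c t0 = RInt (fun y => f (2 * t0 - y)) t0 (2 * t0 - c).
Proof.
  intros Hf.
  assert (Cr : forall y, continuous (fun y => f (2 * t0 - y)) y).
  { intros y; apply (continuous_comp (fun y => 2 * t0 - y) f); [|apply Hf].
    apply cont_sub; [apply continuous_const|apply continuous_id]. }
  assert (E := RInt_comp_lin f (-1) (2 * t0) t0 (2 * t0 - c)).
  replace (-1 * t0 + 2 * t0) with t0 in E by ring.
  replace (-1 * (2 * t0 - c) + 2 * t0) with c in E by ring.
  specialize (E (ex_RInt_cont _ _ _ Hf)).
  assert (S1 := RInt_Chasles_cont f c t0 c Hf); rewrite RInt_point in S1.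
  change (RInt f c t0 + RInt f t0 c = 0) in S1.
  assert (E2 : RInt f t0 c = -1 * RInt (fun y => f (2 * t0 - y)) t0 (2 * t0 - c)).
  { rewrite <- E, <- RInt_scal_cont by exact Cr; apply RInt_ext; intros y _.
    unfold scal; simpl; unfold mult; simpl; do 2 f_equal; ring. }
  lra.
Qed.

Lemma is_RInt_Rpower C k t0 x d : k < 1 -> 0 < x -> t0 + x <= d ->
  is_RInt (fun t => C * Rpower (t - t0) (- k)) (t0 + x) d
    (C / (1 - k) * Rpower (d - t0) (1 - k) - C / (1 - k) * Rpower x (1 - k)).
Proof.
  intros Hk Hx Hd.
  replace x with (t0 + x - t0) at 2 by ring.
  apply (is_RInt_derive (V := R_CompleteNormedModule) (fun t => C / (1 - k) * Rpower (t - t0) (1 - k))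
           (fun t => C * Rpower (t - t0) (- k))).
  - intros t Ht; rewrite Rmin_left, Rmax_right in Ht by lra.
    unfold Rpower; auto_derive; [lra|].
    replace (- k * ln (t - t0)) with ((1 - k) * ln (t - t0) + - ln (t - t0)) by ring.
    rewrite exp_plus, exp_Ropp, exp_ln by lra.
    replace (t + - t0) with (t - t0) by ring; field; lra.
  - intros t Ht; rewrite Rmin_left, Rmax_right in Ht by lra.
    apply (ex_derive_continuous (K := R_AbsRing) (V := R_NormedModule) (fun t => C * Rpower (t - t0) (- k))).
    unfold Rpower; auto_derive; lra.
Qed.

Lemma RInt_near_point (f : R -> R) t0 e : continuous f t0 -> (forall t, continuous f t) -> 0 < e ->
  (forall t, 0 <= f t) ->
  exists x, 0 < x /\ forall c d, t0 - x <= c <= d -> d <= t0 + x -> RInt f c d <= e.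
Proof.
  intros Hc Hf He H0; unfold continuous in Hc; rewrite filterlim_locally in Hc.
  destruct (Hc (mkposreal 1 Rlt_0_1)) as [dl Hd]; assert (Pd := cond_pos dl).
  set (B := f t0 + 1); assert (HB : 0 < B) by (unfold B; specialize (H0 t0); lra).
  exists (Rmin (dl / 2) (e / (2 * B))).
  assert (Px : 0 < e / (2 * B)) by (apply Rdiv_lt_0_compat; lra).
  split; [apply Rmin_glb_lt; lra|]; intros c d Hc1 Hd1.
  assert (M1 := Rmin_l (dl / 2) (e / (2 * B))); assert (M2 := Rmin_r (dl / 2) (e / (2 * B))).
  set (x := Rmin (dl / 2) (e / (2 * B))) in *.
  apply Rle_trans with (RInt (fun _ => B) c d).
  - apply RInt_le_cont; [lra|exact Hf|intros; apply continuous_const|]; intros t Ht.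
    assert (Bl : ball t0 dl t).
    { apply ball_R; lra. }
    specialize (Hd t Bl); apply ball_R in Hd; simpl in Hd; unfold B; lra.
  - rewrite RInt_cst; apply Rle_trans with (2 * (e / (2 * B)) * B); [|right; field; lra].
    apply Rmult_le_compat_r; lra.
Qed.

(** [f] is continuous at [t0], so a short piece there contributes at most e; the rest is bounded by
    the explicit integral. The result depends on [C] and [k] alone, which makes it uniform over the
    regularized slices. *)
Lemma RInt_sing_right (f : R -> R) t0 d C k : 0 <= k < 1 -> 0 <= C -> t0 <= d <= t0 + 1 ->
  (forall t, continuous f t) -> (forall t, 0 <= f t) ->
  (forall t, t0 < t <= d -> f t <= C * Rpower (t - t0) (- k)) -> RInt f t0 d <= C / (1 - k).
Proof.
  intros Hk HC Hd Hf H0 Hb.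
  assert (HCk : 0 <= C / (1 - k)) by (apply Rmult_le_pos; [lra|left; apply Rinv_0_lt_compat; lra]).
  apply le_epsilon; intros e He.
  destruct (RInt_near_point f t0 e (Hf t0) Hf He H0) as [x [Hx Kx]].
  destruct (Rle_dec d (t0 + x)) as [Hdx|Hdx].
  - assert (K := Kx t0 d ltac:(lra) Hdx); lra.
  - assert (K := Kx t0 (t0 + x) ltac:(lra) ltac:(lra)).
    rewrite <- (RInt_Chasles_cont f t0 (t0 + x) d) by exact Hf.
    assert (L : RInt f (t0 + x) d <= C / (1 - k)); [|lra].
    assert (HR := is_RInt_Rpower C k t0 x d ltac:(lra) Hx ltac:(lra)).
    apply Rle_trans with (RInt (fun t => C * Rpower (t - t0) (- k)) (t0 + x) d).
    + apply RInt_le; [lra|now apply ex_RInt_cont|eexists; exact HR|]; intros t Ht; apply Hb; lra.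
    + rewrite (is_RInt_unique _ _ _ _ HR).
      assert (P1 := Rpower_pos x (1 - k)).
      assert (P2 : Rpower (d - t0) (1 - k) <= 1).
      { replace 1 with (Rpower 1 (1 - k)) at 2 by (unfold Rpower; rewrite ln_1, Rmult_0_r; apply exp_0).
        apply Rle_Rpower_l; lra. }
      nra.
Qed.

Lemma RInt_sing (f : R -> R) t0 c d C k : 0 <= k < 1 -> 0 <= C -> t0 - 1 <= c <= t0 -> t0 <= d <= t0 + 1 ->
  (forall t, continuous f t) -> (forall t, 0 <= f t) ->
  (forall t, c <= t <= d -> t <> t0 -> f t <= C * Rpower (Rabs (t - t0)) (- k)) ->
  RInt f c d <= 2 * (C / (1 - k)).
Proof.
  intros Hk HC Hc Hd Hf H0 Hb.
  rewrite <- (RInt_Chasles_cont f c t0 d), (RInt_reflect f c t0) by exact Hf.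
  assert (A1 : RInt f t0 d <= C / (1 - k)).
  { apply RInt_sing_right; try assumption; intros t Ht.
    specialize (Hb t ltac:(lra) ltac:(lra)); rewrite Rabs_pos_eq in Hb by lra; exact Hb. }
  assert (A2 : RInt (fun y => f (2 * t0 - y)) t0 (2 * t0 - c) <= C / (1 - k)).
  { apply RInt_sing_right; try assumption; [lra| |auto|].
    - intros y; apply (continuous_comp (fun y => 2 * t0 - y) f); [|apply Hf].
      apply cont_sub; [apply continuous_const|apply continuous_id].
    - intros t Ht; specialize (Hb (2 * t0 - t) ltac:(lra) ltac:(lra)).
      replace (2 * t0 - t - t0) with (- (t - t0)) in Hb by ring.
      rewrite Rabs_Ropp, Rabs_pos_eq in Hb by lra; exact Hb. }
  lra.
Qed.

Lemma is_eps_unique a m n i zeta e e' : is_eps a m n i zeta e -> is_eps a m n i zeta e' -> e = e'.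
Proof.
  intros [[w [Hw ->]] Hmin] [[w' [Hw' ->]] Hmin'].
  apply Rle_antisym; [now apply Hmin|now apply Hmin'].
Qed.

Lemma sing_coord_bidegree a m n tau : stable a m n -> sing_coord a m n 1 tau -> m <> O.
Proof.
  intros Hs [Ht [w [Hw E]]] ->; unfold eval_i in E; simpl in E.
  apply (peval_disk_circle a 0 n C0 tau Hs); [rewrite Cmod_C0; lra|exact Ht|].
  rewrite <- E; reflexivity.
Qed.

Lemma not_sing_good a m n zeta : Cmod zeta = 1 -> ~ sing_coord a m n 1 zeta -> good a m n zeta.
Proof.
  intros Hz N w Hw E; apply N; split; [exact Hz|]; exists w; split; [exact Hw|exact E].
Qed.

Lemma good_isolated_angle a m n t0 : stable a m n ->
  exists eta, 0 < eta <= 1 /\ forall t, 0 < Rabs (t - t0) < eta -> good a m n (Cexpi t).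
Proof.
  intros Hs; destruct (good_isolated a m n (Cexpi t0) Hs) as [d [Hd Hg]].
  exists (Rmin d 1); split; [split; [apply Rmin_glb_lt; lra|apply Rmin_r]|]; intros t Ht.
  assert (M1 := Rmin_l d 1); assert (M2 := Rmin_r d 1).
  assert (K := Cmod_expi_sub t t0 ltac:(lra)).
  apply Hg; [apply Cmod_expi|rewrite Cmod_sub_sym; lra].
Qed.

(** Contact order in angular form: T is the chord to the singular point and lies between half the
    angle and the angle. *)
Lemma contact_local a m n t0 K : stable a m n -> m <> O -> contact_order_at a m n 1 (Cexpi t0) K ->
  exists c C eta, 0 < c /\ 0 < C /\ 0 < eta <= 1 /\ forall t, 0 < Rabs (t - t0) < eta ->
    good a m n (Cexpi t) /\ exists l T, root_spec a m n (Cexpi t) l /\ l <> nil /\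
      Rabs (t - t0) / 2 <= T <= Rabs (t - t0) /\
      c * Rpower T K <= 1 - maxmod l <= C * Rpower T K.
Proof.
  intros Hs Hm [c [C [d [Hc [HC [Hd H]]]]]].
  destruct (good_isolated_angle a m n t0 Hs) as [eta [He Hg]].
  exists c, C, (Rmin d eta); split; [exact Hc|split; [exact HC|]].
  assert (M1 := Rmin_l d eta); assert (M2 := Rmin_r d eta).
  split; [split; [apply Rmin_glb_lt; lra|lra]|]; intros t Ht.
  assert (B := Cmod_expi_sub t t0 ltac:(lra)).
  split; [apply Hg; lra|].
  destruct (root_list a m n (Cexpi t) Hs (Cmod_expi t)) as [l Hl].
  assert (Nl : l <> nil) by (intros E; apply Hm; destruct Hl as [<- _]; rewrite E; reflexivity).
  exists l, (Cmod (Cexpi t - Cexpi t0)%Cx); split; [exact Hl|split; [exact Nl|split; [exact B|]]].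
  destruct (H (Cexpi t) (Cmod_expi t)) as [e [He1 [He2 He3]]]; [rewrite Cmod_sub_sym; lra|].
  rewrite (is_eps_unique a m n 1 (Cexpi t) e (1 - maxmod l) He1) in *
    by (apply is_eps_roots; auto; apply Cmod_expi).
  rewrite Cmod_sub_sym in He2, He3; rewrite rpow_Rpower in He2, He3 by lra; split; assumption.
Qed.

(** If K (P - 1) >= 1, the slice integrals dominate k / (t - t0) to the right of t0, and the
    logarithmic divergence exceeds any given bound. *)
Lemma contact_of_bounded a m n P Mv : stable a m n -> 1 <= P ->
  (forall d, 0 < d -> RInt (slice a m n P d) 0 (2 * PI) <= Mv) -> contact_cond a m n 1 P.
Proof.
  intros Hs HP HV tau Htau; assert (Hm := sing_coord_bidegree a m n tau Hs Htau).
  destruct Htau as [Ht _].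
  destruct (contact_order_exists a m n tau Hs Hm Ht) as [K HK]; exists K; split; [exact HK|].
  apply Rnot_le_lt; intros HKP.
  destruct (unit_Cexpi tau Ht) as [t0 [Ht0 ->]].
  destruct (contact_local a m n t0 K Hs Hm HK) as [c [C [eta [Hc [HC [He H]]]]]].
  assert (HPI := PI_RGT_0).
  (* Keeps the interval inside [0, 2 pi]; it has positive length because t0 < 2 pi. *)
  set (y := Rmin (eta / 2) (2 * PI - t0)).
  assert (Hy : 0 < y) by (apply Rmin_glb_lt; lra).
  assert (Hy1 := Rmin_l (eta / 2) (2 * PI - t0)); assert (Hy2 := Rmin_r (eta / 2) (2 * PI - t0)); fold y in Hy1, Hy2.
  set (k := Rpower (/ 8) P * Rpower C (1 - P)).
  assert (Hk : 0 < k) by (apply Rmult_lt_0_compat; apply Rpower_pos).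
  assert (M0 : 0 <= Mv).
  { eapply Rle_trans; [|apply (HV 1 ltac:(lra))].
    apply RInt_ge0_cont; [apply two_PI_pos|apply slice_cont; [exact HP|lra]|apply slice_ge0; [exact HP|lra]]. }
  (* Chosen so that the integral of k / (t - t0) from t0 + x to t0 + y equals Mv + k. *)
  set (x := y * exp (- (Mv / k + 1))).
  assert (Hx0 : 0 < x) by (apply Rmult_lt_0_compat; [lra|apply exp_pos]).
  assert (Q0 : 0 <= Mv / k) by (apply Rmult_le_pos; [lra|left; now apply Rinv_0_lt_compat]).
  assert (Hx1 : x < y).
  { unfold x; rewrite <- (Rmult_1_r y) at 2; apply Rmult_lt_compat_l; [lra|].
    apply Rlt_le_trans with (exp 0); [apply exp_increasing; lra|rewrite exp_0; lra]. }
  (* Only now is [d] fixed: away from t0 the modulus of p is bounded below, and with d below that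
     bound the regularization costs a constant factor. *)
  destruct (good_lower a m n (t0 + x) (t0 + y) ltac:(lra)) as [d [Hd Hlow]].
  { intros t Ht'; apply (H t); rewrite Rabs_pos_eq; lra. }
  assert (Low : forall t, t0 + x < t < t0 + y -> k / (t - t0) <= slice a m n P d t).
  { intros t Ht'; destruct (H t) as [Hg [l [T [Hl [Nl [HT [_ HE]]]]]]]; [rewrite Rabs_pos_eq; lra|].
    rewrite Rabs_pos_eq in HT by lra.
    assert (SL := slice_lower a m n P (Cexpi t) l d HP Hd (Cmod_expi t) Hg Hl Nl (Hlow t ltac:(lra))).
    eapply Rle_trans; [|exact SL]; unfold k, Rdiv; rewrite Rmult_assoc.
    apply Rmult_le_compat_l; [left; apply Rpower_pos|].
    assert (Hmax : 0 < 1 - maxmod l).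
    { destruct (maxmod_attained l Nl) as [z [Hz Ez]]; destruct Hl as [_ [_ Hin]].
      specialize (Hin Hg z Hz); lra. }
    apply Rle_trans with (Rpower (C * Rpower T K) (1 - P)); [|apply Rpower_anti; lra].
    rewrite <- Rpower_mult_distr by (try apply Rpower_pos; lra).
    apply Rmult_le_compat_l; [left; apply Rpower_pos|].
    rewrite Rpower_mult; apply Rle_trans with (Rpower T (- (1))).
    - rewrite Rpower_Ropp, Rpower_1 by lra; apply Rinv_le_contravar; lra.
    - apply Rpower_decr; [lra|lra]. }
  assert (R1 : is_RInt (fun t => k / (t - t0)) (t0 + x) (t0 + y) (k * ln y - k * ln x)).
  { replace y with (t0 + y - t0) at 2 by ring; replace x with (t0 + x - t0) at 2 by ring.
    apply (is_RInt_derive (V := R_CompleteNormedModule) (fun t => k * ln (t - t0)) (fun t => k / (t - t0))).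
    - intros t Ht'; rewrite Rmin_left, Rmax_right in Ht' by lra; auto_derive; [lra|].
      replace (t + - t0) with (t - t0) by ring; field; lra.
    - intros t Ht'; rewrite Rmin_left, Rmax_right in Ht' by lra.
      apply cont_div; [apply continuous_const| |lra].
      apply cont_sub; [apply continuous_id|apply continuous_const]. }
  assert (R2 : k * ln y - k * ln x <= Mv).
  { rewrite <- (is_RInt_unique _ _ _ _ R1).
    apply Rle_trans with (RInt (slice a m n P d) (t0 + x) (t0 + y)).
    - apply RInt_le; [lra|eexists; exact R1|apply ex_RInt_cont; now apply slice_cont|exact Low].
    - eapply Rle_trans; [|apply (HV d Hd)].
      apply RInt_mono_cont; [lra|lra|now apply slice_cont|now apply slice_ge0]. }
  unfold x in R2; rewrite ln_mult, ln_exp in R2 by (try apply exp_pos; lra).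
  replace (k * ln y - k * (ln y + - (Mv / k + 1))) with (Mv + k) in R2 by (field; lra); lra.
Qed.

(** By [cousin] a local bound independent of d suffices: an integrable power at singular
    coordinates, a fixed continuous majorant elsewhere. *)
Lemma bounded_of_contact a m n P : stable a m n -> 1 <= P -> contact_cond a m n 1 P ->
  exists Mv, forall d, 0 < d -> RInt (slice a m n P d) 0 (2 * PI) <= Mv.
Proof.
  intros Hs HP HC; assert (HPI := PI_RGT_0).
  refine (cousin (fun x y => exists Mv, forall d, 0 < d -> RInt (slice a m n P d) x y <= Mv)
            0 (2 * PI) two_PI_pos _ _).
  - intros u v w Huv [M1 K1] [M2 K2]; exists (M1 + M2); intros d Hd.
    rewrite <- (RInt_Chasles_cont _ u v w) by now apply slice_cont.
    specialize (K1 d Hd); specialize (K2 d Hd); lra.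
  - intros t0 Ht0; destruct (classic (sing_coord a m n 1 (Cexpi t0))) as [Hb|Hg].
    + assert (Hm := sing_coord_bidegree a m n _ Hs Hb).
      destruct (HC _ Hb) as [K [HK HKP]].
      destruct (contact_local a m n t0 K Hs Hm HK) as [c [C [eta [Hc [HCc [He H]]]]]].
      exists eta; split; [lra|]; intros u v Hu Hv Hu' Hv'.
      (* [RInt_sing] wants a nonnegative exponent, while the sign of K is not recorded in
         [contact_cond]. *)
      set (k := Rmax (K * (P - 1)) 0).
      assert (Hk : 0 <= k < 1) by (split; [apply Rmax_r|apply Rmax_lub_lt; lra]).
      (* The last factor compensates T >= |t - t0| / 2 under the exponent -k. *)
      set (B := Rpower (2 * INR m / c) (P - 1) * (INR m * (4 * PI)) * Rpower (/ 2) (- k)).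
      assert (Hmp : 0 < INR m) by (apply lt_0_INR; lia).
      assert (HB : 0 <= B).
      { apply Rmult_le_pos; [apply Rmult_le_pos; [|nra]|]; left; apply Rpower_pos. }
      exists (2 * (B / (1 - k))); intros d Hd.
      apply (RInt_sing _ t0); [exact Hk|exact HB|lra|lra|now apply slice_cont|now apply slice_ge0|].
      intros t Ht Nt.
      assert (Hab : 0 < Rabs (t - t0) < eta).
      { split; [apply Rabs_pos_lt; lra|apply Rabs_lt_between; lra]. }
      destruct (H t Hab) as [Hg [l [T [Hl [Nl [HT [HE _]]]]]]].
      eapply Rle_trans; [apply (slice_upper a m n P (Cexpi t) l d HP Hd (Cmod_expi t) Hg Hl Nl)|].
      unfold B; set (y := Rabs (t - t0)) in *.
      assert (PT := Rpower_pos T K).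
      apply Rle_trans with (Rpower (2 * INR m / c) (P - 1) * Rpower T (- k) * (INR m * (4 * PI))).
      * apply Rmult_le_compat_r; [apply Rmult_le_pos; lra|].
        apply Rle_trans with (Rpower (2 * INR m / c * Rpower T (- K)) (P - 1)).
        -- assert (Q : 0 < c * Rpower T K) by (apply Rmult_lt_0_compat; lra).
           apply Rle_Rpower_l; [lra|split; [apply Rdiv_lt_0_compat; lra|]].
           rewrite Rpower_Ropp.
           replace (2 * INR m / c * / Rpower T K) with (2 * INR m / (c * Rpower T K)) by (field; lra).
           apply Rmult_le_compat_l; [lra|apply Rinv_le_contravar; lra].
        -- rewrite <- Rpower_mult_distr, Rpower_mult by (try apply Rpower_pos; apply Rdiv_lt_0_compat; lra).
           apply Rmult_le_compat_l; [left; apply Rpower_pos|].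
           apply Rpower_decr; [lra|]; assert (L := Rmax_l (K * (P - 1)) 0); fold k in L; lra.
      * assert (Q : Rpower T (- k) <= Rpower (/ 2) (- k) * Rpower y (- k)).
        { rewrite Rpower_mult_distr by lra; apply Rpower_anti; lra. }
        assert (P1 := Rpower_pos (2 * INR m / c) (P - 1)).
        assert (P2 : 0 <= Rpower (2 * INR m / c) (P - 1) * (INR m * (4 * PI))).
        { apply Rmult_le_pos; nra. }
        apply Rmult_le_compat_l with (1 := P2) in Q; lra.
    + apply not_sing_good in Hg; [|apply Cmod_expi].
      destruct (good_lower_local a m n t0 Hg) as [eta [c0 [He [Hc0 Hlow]]]].
      exists eta; split; [exact He|]; intros u v Hu Hv Hu' Hv'.
      set (F := fun t s => rpow (Cmod (num a m n (Cexpi s) (Cexpi t)) / c0) P).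
      assert (CF : cont2 F).
      { intros [t s]; apply cont_rpow; [exact HP|apply cont_div; [|apply continuous_const|lra]].
        apply cont_Cmod, ccont_num; [apply ccont_expi, continuous_snd|apply ccont_expi, continuous_fst]. }
      exists (RInt (fun t => RInt (F t) 0 (2 * PI)) u v); intros d Hd.
      apply RInt_le_cont; [lra|now apply slice_cont|apply cont2_RInt; [apply two_PI_pos|exact CF]|].
      intros t Ht; apply RInt_le_cont; [apply two_PI_pos| |apply cont2_l, CF|].
      * exact (cont2_l _ (cont2_swap _ (cont2_gpow a m n P d HP Hd)) t).
      * intros s _; apply rpow_le; [lra|]; apply Rmult_le_compat_l; [apply Cmod_ge0|].
        assert (L := Hlow t ltac:(apply Rabs_lt_between; lra) s); apply Rinv_le_contravar; lra.
Qed.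

(** * The Hardy space criterion *)

Lemma gpow_0 a m n P z1 z2 : gpow a m n P 0 z1 z2
  = rpow (Cmod (num a m n z1 z2) / (Cmod (peval a m n z1 z2) * Cmod (peval a m n z1 z2))) P.
Proof. unfold gpow; rewrite Rplus_0_r; reflexivity. Qed.

Lemma cont2_gpow0 a m n P r1 r2 : 1 <= P ->
  (forall s t, peval a m n (Cscale r1 (Cexpi s)) (Cscale r2 (Cexpi t)) <> C0) ->
  cont2 (fun s t => gpow a m n P 0 (Cscale r1 (Cexpi s)) (Cscale r2 (Cexpi t))).
Proof.
  intros HP H [s t].
  apply (cont_gpow a m n P 0 (fun z : R * R => Cscale r1 (Cexpi (fst z))) (fun z => Cscale r2 (Cexpi (snd z)))).
  - exact HP.
  - apply ccont_scale; [apply continuous_const|apply ccont_expi, continuous_fst].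
  - apply ccont_scale; [apply continuous_const|apply ccont_expi, continuous_snd].
  - lra.
  - right; apply H.
Qed.

Lemma peval_closed_disk a m n z1 z2 : stable a m n -> Cmod z1 <= 1 -> Cmod z2 < 1 ->
  peval a m n z1 z2 <> C0.
Proof.
  intros Hs [H1|H1] H2; [now apply Hs|now apply peval_circle_disk].
Qed.

Lemma hardy_mean_l a m n P r z2 : stable a m n -> 1 <= P -> 0 <= r < 1 -> Cmod z2 < 1 ->
  RInt (fun s => gpow a m n P 0 (Cscale r (Cexpi s)) z2) 0 (2 * PI)
  <= RInt (fun s => gpow a m n P 0 (Cexpi s) z2) 0 (2 * PI).
Proof.
  intros Hs HP Hr Hz.
  assert (H := hardy_mean P (fun w => num a m n w z2) (fun w => peval a m n w z2) r HP
                 (polyfun_num_l a m n z2) (polyfun_peval_l a m n z2) Hr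
                 (fun w Hw => peval_closed_disk a m n w z2 Hs Hw Hz)).
  rewrite (RInt_ext _ _ _ _ (fun s _ => gpow_0 a m n P (Cscale r (Cexpi s)) z2)).
  rewrite (RInt_ext _ _ _ _ (fun s _ => gpow_0 a m n P (Cexpi s) z2)); exact H.
Qed.

Lemma hardy_mean_r a m n P r z1 : stable a m n -> 1 <= P -> 0 <= r < 1 -> Cmod z1 = 1 ->
  good (tr a) n m z1 ->
  RInt (fun t => gpow a m n P 0 z1 (Cscale r (Cexpi t))) 0 (2 * PI)
  <= RInt (fun t => gpow a m n P 0 z1 (Cexpi t)) 0 (2 * PI).
Proof.
  intros Hs HP Hr Hz Hg.
  assert (H := hardy_mean P (fun w => num a m n z1 w) (peval a m n z1) r HP
                 (polyfun_num_r a m n z1) (polyfun_peval_r a m n z1) Hr).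
  rewrite (RInt_ext _ _ _ _ (fun t _ => gpow_0 a m n P z1 (Cscale r (Cexpi t)))).
  rewrite (RInt_ext _ _ _ _ (fun t _ => gpow_0 a m n P z1 (Cexpi t))); apply H.
  intros w [Hw|Hw]; [now apply peval_circle_disk|rewrite <- peval_tr; now apply Hg].
Qed.

(** The radius of z_1 is raised first, while |z_2| = r < 1 keeps p zero-free on the closed disk in
    z_1; then that of z_2, for z_1 = exp(is) off the singular coordinates. The factor 2^P comes from
    the regularization, and the 1 bounds the neglected neighbourhoods. *)
Lemma torus_upper a m n P r Mv : stable a m n -> 1 <= P -> 0 < r < 1 ->
  (forall d, 0 < d -> RInt (slice a m n P d) 0 (2 * PI) <= Mv) ->
  RInt (fun s => RInt (fun t => gpow a m n P 0 (Cscale r (Cexpi s)) (Cscale r (Cexpi t))) 0 (2 * PI)) 0 (2 * PI)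
  <= rpow 2 P * Mv + 1.
Proof.
  intros Hs HP Hr HV.
  assert (Hd1 : forall s, Cmod (Cscale r (Cexpi s)) < 1) by (intros s; rewrite Cmod_scale, Cmod_expi; lra).
  assert (Crr := cont2_gpow0 a m n P r r HP (fun s t => proj1 Hs _ _ (Hd1 s) (Hd1 t))).
  assert (C1r : cont2 (fun s t => gpow a m n P 0 (Cexpi s) (Cscale r (Cexpi t)))).
  { assert (K := cont2_gpow0 a m n P 1 r HP).
    replace (fun s t => gpow a m n P 0 (Cexpi s) (Cscale r (Cexpi t)))
      with (fun s t => gpow a m n P 0 (Cscale 1 (Cexpi s)) (Cscale r (Cexpi t))).
    - apply K; intros s t; rewrite Cscale_1; apply peval_circle_disk; [exact Hs|apply Cmod_expi|apply Hd1].
    - apply functional_extensionality; intros s; apply functional_extensionality; intros t.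
      rewrite Cscale_1; reflexivity. }
  set (A := fun s => RInt (fun t => gpow a m n P 0 (Cexpi s) (Cscale r (Cexpi t))) 0 (2 * PI)).
  assert (CA : forall s, continuous A s) by exact (cont2_RInt _ 0 (2 * PI) two_PI_pos C1r).
  assert (A0 : forall s, 0 <= A s).
  { intros s; apply RInt_ge0_cont; [apply two_PI_pos|apply (cont2_l _ C1r)|intros; apply gpow_ge0]. }
  apply Rle_trans with (RInt A 0 (2 * PI)).
  { rewrite (fubini_cont _ 0 (2 * PI) 0 (2 * PI) two_PI_pos two_PI_pos Crr).
    unfold A; rewrite (fubini_cont _ 0 (2 * PI) 0 (2 * PI) two_PI_pos two_PI_pos C1r).
    apply RInt_le_cont; [apply two_PI_pos| | |].
    - exact (cont2_RInt _ 0 (2 * PI) two_PI_pos (cont2_swap _ Crr)).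
    - exact (cont2_RInt _ 0 (2 * PI) two_PI_pos (cont2_swap _ C1r)).
    - intros t _; apply hardy_mean_l; [exact Hs|exact HP|lra|apply Hd1]. }
  set (Ad := fun d s => RInt (fun t => gpow a m n P d (Cexpi s) (Cexpi t)) 0 (2 * PI)).
  assert (CAd : forall d, 0 < d -> forall s, continuous (Ad d) s).
  { intros d Hd; exact (cont2_RInt _ 0 (2 * PI) two_PI_pos (cont2_gpow a m n P d HP Hd)). }
  assert (Ad0 : forall d s, 0 < d -> 0 <= Ad d s).
  { intros d s Hd; apply RInt_ge0_cont; [apply two_PI_pos|apply (cont2_l _ (cont2_gpow a m n P d HP Hd))|].
    intros; apply gpow_ge0. }
  assert (P2 := rpow_ge0 2 P).
  assert (Good : forall x y, x <= y -> (forall s, x <= s <= y -> good (tr a) n m (Cexpi s)) ->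
            exists d0, 0 < d0 /\ forall d, 0 < d <= d0 -> RInt A x y <= rpow 2 P * RInt (Ad d) x y).
  { intros x y Hxy Hg; destruct (good_lower (tr a) n m x y Hxy Hg) as [d0 [Hd0 Hlow]].
    exists d0; split; [exact Hd0|]; intros d Hd.
    rewrite <- RInt_scal_cont by (apply CAd; lra).
    apply RInt_le_cont; [exact Hxy|exact CA| |].
    - intros s; apply cont_mul; [apply continuous_const|apply CAd; lra].
    - intros s Hxs; unfold A, Ad.
      assert (Hgs := Hg s ltac:(lra)).
      eapply Rle_trans; [apply hardy_mean_r; [exact Hs|exact HP|lra|apply Cmod_expi|exact Hgs]|].
      assert (Cd := cont2_l _ (cont2_gpow a m n P d HP ltac:(lra)) s).
      rewrite <- (RInt_scal_cont (fun t => gpow a m n P d (Cexpi s) (Cexpi t))) by exact Cd.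
      apply RInt_le_cont; [apply two_PI_pos| | |].
      + intros t; apply cont_gpow; [exact HP|apply ccont_const|apply ccont_expi_id|lra|right].
        rewrite <- peval_tr; apply Hgs, Cmod_expi.
      + intros t; apply cont_mul; [apply continuous_const|apply Cd].
      + intros t _; apply gpow_half; [lra|lra|].
        specialize (Hlow s ltac:(lra) t); rewrite peval_tr in Hlow; lra. }
  (* Near a singular s no pointwise comparison of [A] with [Ad] is available. As r is fixed, [A] is
     continuous there, and a short interval costs at most e. *)
  assert (Main : forall e, 0 < e -> exists d0, 0 < d0 /\ forall d, 0 < d <= d0 ->
            RInt A 0 (2 * PI) <= rpow 2 P * RInt (Ad d) 0 (2 * PI) + e).
  { refine (cousin (fun x y => forall e, 0 < e -> exists d0, 0 < d0 /\ forall d, 0 < d <= d0 ->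
              RInt A x y <= rpow 2 P * RInt (Ad d) x y + e) 0 (2 * PI) two_PI_pos _ _).
    - intros u v w Huv K1 K2 e He.
      destruct (K1 (e / 2) ltac:(lra)) as [d1 [Hd1' L1]]; destruct (K2 (e / 2) ltac:(lra)) as [d2 [Hd2' L2]].
      exists (Rmin d1 d2); split; [now apply Rmin_glb_lt|]; intros d Hd.
      assert (M1 := Rmin_l d1 d2); assert (M2 := Rmin_r d1 d2).
      specialize (L1 d ltac:(lra)); specialize (L2 d ltac:(lra)).
      rewrite <- (RInt_Chasles_cont A u v w) by exact CA.
      rewrite <- (RInt_Chasles_cont (Ad d) u v w) by (apply CAd; lra); lra.
    - intros s0 Hs0; destruct (good_isolated_angle (tr a) n m s0 (stable_tr a m n Hs)) as [eta [He Hg]].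
      exists eta; split; [lra|]; intros u v Hu Hv Hu' Hv' e Hepos.
      destruct (RInt_near_point A s0 e (CA s0) CA Hepos A0) as [x [Hx Kx]].
      (* [u1, v1] is the part of [u, v] within x of s0; the two outer pieces are either degenerate
         or free of singular coordinates. *)
      set (u1 := Rmax u (s0 - x)); set (v1 := Rmin v (s0 + x)).
      assert (Hu1 : u <= u1 <= s0 /\ s0 - x <= u1)
        by (unfold u1; repeat split; [apply Rmax_l|apply Rmax_lub; lra|apply Rmax_r]).
      assert (Hv1 : s0 <= v1 <= v /\ v1 <= s0 + x)
        by (unfold v1; repeat split; [apply Rmin_glb; lra|apply Rmin_l|apply Rmin_r]).
      assert (L : exists d0, 0 < d0 /\ forall d, 0 < d <= d0 -> RInt A u u1 <= rpow 2 P * RInt (Ad d) u u1).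
      { destruct (Rle_dec (s0 - x) u) as [Hc|Hc].
        - assert (E : u1 = u) by (unfold u1; apply Rmax_left; lra).
          exists 1; split; [lra|]; intros d Hd; rewrite E, !RInt_point; change (0 <= rpow 2 P * 0); lra.
        - assert (E : u1 = s0 - x) by (unfold u1; apply Rmax_right; lra).
          apply Good; [lra|]; intros s Hss; apply Hg; rewrite Rabs_left; lra. }
      assert (Rr : exists d0, 0 < d0 /\ forall d, 0 < d <= d0 -> RInt A v1 v <= rpow 2 P * RInt (Ad d) v1 v).
      { destruct (Rle_dec v (s0 + x)) as [Hc|Hc].
        - assert (E : v1 = v) by (unfold v1; apply Rmin_left; lra).
          exists 1; split; [lra|]; intros d Hd; rewrite E, !RInt_point; change (0 <= rpow 2 P * 0); lra.
        - assert (E : v1 = s0 + x) by (unfold v1; apply Rmin_right; lra).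
          apply Good; [lra|]; intros s Hss; apply Hg; rewrite Rabs_pos_eq; lra. }
      destruct L as [d1 [Hd1' L1]], Rr as [d2 [Hd2' L2]].
      exists (Rmin d1 d2); split; [now apply Rmin_glb_lt|]; intros d Hd.
      assert (M1 := Rmin_l d1 d2); assert (M2 := Rmin_r d1 d2).
      specialize (L1 d ltac:(lra)); specialize (L2 d ltac:(lra)).
      specialize (Kx u1 v1 ltac:(lra) ltac:(lra)).
      rewrite <- (RInt_Chasles_cont A u u1 v), <- (RInt_Chasles_cont A u1 v1 v) by exact CA.
      rewrite <- (RInt_Chasles_cont (Ad d) u u1 v), <- (RInt_Chasles_cont (Ad d) u1 v1 v) by (apply CAd; lra).
      assert (I0 : 0 <= RInt (Ad d) u1 v1).
      { apply RInt_ge0_cont; [lra|apply CAd; lra|intros; apply Ad0; lra]. }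
      assert (0 <= rpow 2 P * RInt (Ad d) u1 v1) by now apply Rmult_le_pos.
      lra. }
  destruct (Main 1 ltac:(lra)) as [d [Hd K]]; specialize (K d ltac:(lra)).
  assert (E : RInt (Ad d) 0 (2 * PI) = RInt (slice a m n P d) 0 (2 * PI)).
  { exact (fubini_cont _ 0 (2 * PI) 0 (2 * PI) two_PI_pos two_PI_pos (cont2_gpow a m n P d HP Hd)). }
  specialize (HV d Hd); rewrite E in K; apply Rmult_le_compat_l with (1 := P2) in HV; lra.
Qed.

(** For fixed d the integrand is continuous up to r = 1 although p may vanish on the torus, and for
    r < 1 it lies below the unregularized one. The limit r -> 1 thus plays the part of Fatou's
    lemma. *)
Lemma torus_lower a m n P Mw : stable a m n -> 1 <= P ->
  (forall r, 0 < r < 1 ->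
    RInt (fun s => RInt (fun t => gpow a m n P 0 (Cscale r (Cexpi s)) (Cscale r (Cexpi t))) 0 (2 * PI)) 0 (2 * PI)
    <= Mw) ->
  forall d, 0 < d -> RInt (slice a m n P d) 0 (2 * PI) <= Mw.
Proof.
  intros Hs HP HW d Hd.
  (* Radius and outer angle form one parameter, so that the inner integral is jointly continuous in
     both. *)
  set (f := fun (z : R * R) t => gpow a m n P d (Cscale (fst z) (Cexpi (snd z))) (Cscale (fst z) (Cexpi t))).
  assert (Cf : forall z : (R * R) * R, continuous (fun z => f (fst z) (snd z)) z).
  { intros [[r s] t]; unfold f.
    assert (K1 : continuous (T := prod_UniformSpace (prod_UniformSpace R_UniformSpace R_UniformSpace) R_UniformSpace)
                   (fun z : R * R * R => fst (fst z)) (r, s, t))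
      by (apply (continuous_comp fst fst); apply continuous_fst).
    assert (K2 : continuous (T := prod_UniformSpace (prod_UniformSpace R_UniformSpace R_UniformSpace) R_UniformSpace)
                   (fun z : R * R * R => snd (fst z)) (r, s, t))
      by (apply (continuous_comp fst snd); [apply continuous_fst|apply continuous_snd]).
    apply (cont_gpow a m n P d (fun z : R * R * R => Cscale (fst (fst z)) (Cexpi (snd (fst z))))
             (fun z : R * R * R => Cscale (fst (fst z)) (Cexpi (snd z)))); [exact HP| | |lra|now left].
    - apply ccont_scale; [exact K1|now apply ccont_expi].
    - apply ccont_scale; [exact K1|apply ccont_expi, continuous_snd]. }
  assert (Cg : cont2 (fun r s => RInt (f (r, s)) 0 (2 * PI))).
  { intros [r s]; apply (continuous_ext (fun z : R * R => RInt (f z) 0 (2 * PI))); [intros [x y]; reflexivity|].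
    apply (RInt_param_cont (U := prod_UniformSpace R_UniformSpace R_UniformSpace) f);
      [apply two_PI_pos|exact Cf]. }
  set (F := fun r => RInt (fun s => RInt (f (r, s)) 0 (2 * PI)) 0 (2 * PI) - Mw).
  assert (HF : F 1 <= 0).
  { apply limit_from_below.
    - apply cont_sub; [|apply continuous_const].
      exact (cont2_RInt _ 0 (2 * PI) two_PI_pos Cg 1).
    - intros r Hr; unfold F; apply Rle_minus; eapply Rle_trans; [|apply (HW r Hr)].
      assert (Hd1 : forall s, Cmod (Cscale r (Cexpi s)) < 1) by (intros s; rewrite Cmod_scale, Cmod_expi; lra).
      assert (Crr := cont2_gpow0 a m n P r r HP (fun s t => proj1 Hs _ _ (Hd1 s) (Hd1 t))).
      apply RInt_le_cont; [apply two_PI_pos|apply (cont2_l _ Cg)| |].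
      + exact (cont2_RInt _ 0 (2 * PI) two_PI_pos Crr).
      + intros s _; apply RInt_le_cont; [apply two_PI_pos|apply (cont_slice f Cf (r, s))|apply (cont2_l _ Crr)|].
        intros t _; unfold f; cbn [fst snd]; apply gpow_anti; [lra|lra|apply (proj1 Hs); apply Hd1]. }
  unfold F in HF; apply Rminus_le in HF; eapply Rle_trans; [|exact HF]; right.
  assert (C := cont2_gpow a m n P d HP Hd).
  transitivity (RInt (fun s => RInt (fun t => gpow a m n P d (Cexpi s) (Cexpi t)) 0 (2 * PI)) 0 (2 * PI)).
  - symmetry; exact (fubini_cont _ 0 (2 * PI) 0 (2 * PI) two_PI_pos two_PI_pos C).
  - apply RInt_ext; intros s _; apply RInt_ext; intros t _; unfold f; simpl; rewrite !Cscale_1; reflexivity.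
Qed.

Lemma torus_bounded_iff_contact a m n P : stable a m n -> 1 <= P ->
  (exists Mw, forall r, 0 < r < 1 ->
    RInt (fun s => RInt (fun t => gpow a m n P 0 (Cscale r (Cexpi s)) (Cscale r (Cexpi t))) 0 (2 * PI)) 0 (2 * PI)
    <= Mw) <-> contact_cond a m n 1 P.
Proof.
  intros Hs HP; split.
  - intros [Mw HW]; apply (contact_of_bounded a m n P Mw Hs HP), (torus_lower a m n P Mw Hs HP HW).
  - intros HC; destruct (bounded_of_contact a m n P Hs HP HC) as [Mv HV].
    exists (rpow 2 P * Mv + 1); intros r Hr; now apply torus_upper.
Qed.

(** * From integral bounds to membership in the Hardy space *)

Lemma Int2_cont (g : R -> R -> R) I : cont2 g ->
  Int2 g I <-> RInt (fun s => RInt (g s) 0 (2 * PI)) 0 (2 * PI) = I.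
Proof.
  intros Cg; split.
  - intros [h [Hh [pr E]]]; rewrite <- E, <- RInt_Reals; apply RInt_ext; intros s _.
    destruct (Hh s) as [pr' <-]; apply RInt_Reals.
  - intros <-; exists (fun s => RInt (g s) 0 (2 * PI)); split.
    + intros s; exists (ex_RInt_Reals_0 _ _ _ (ex_RInt_cont (g s) 0 (2 * PI) (cont2_l g Cg s))).
      symmetry; apply RInt_Reals.
    + exists (ex_RInt_Reals_0 _ _ _ (ex_RInt_cont _ 0 (2 * PI) (cont2_RInt g 0 (2 * PI) two_PI_pos Cg))).
      symmetry; apply RInt_Reals.
Qed.

(** Only the values of [f] on tori of radius r < 1 enter, so [f] may be replaced there by a
    continuous formula; the factor 4 pi^2 is absorbed into the bound. *)
Lemma in_Hardy_cont P f (G : R -> R -> R -> R) :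
  (forall r s t, 0 < r < 1 -> rpow (Cmod (f (Cscale r (Cexpi s)) (Cscale r (Cexpi t)))) P = G r s t) ->
  (forall r, 0 < r < 1 -> cont2 (G r)) ->
  in_Hardy P f <-> exists Mw, forall r, 0 < r < 1 ->
    RInt (fun s => RInt (G r s) 0 (2 * PI)) 0 (2 * PI) <= Mw.
Proof.
  intros E CG; assert (HPI : 0 < 4 * PI ^ 2) by (generalize (pow_lt PI 2 PI_RGT_0); lra).
  assert (E' : forall r, 0 < r < 1 ->
    (fun s t => rpow (Cmod (f (Cscale r (Cexpi s)) (Cscale r (Cexpi t)))) P) = G r).
  { intros r Hr; apply functional_extensionality; intros s; apply functional_extensionality; intros t; auto. }
  split; intros [M H].
  - exists (M * (4 * PI ^ 2)); intros r Hr; destruct (H r Hr) as [I [HI HM]].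
    rewrite E' in HI by exact Hr; apply Int2_cont in HI; [|now apply CG]; rewrite HI.
    apply Rmult_le_reg_r with (/ (4 * PI ^ 2)); [now apply Rinv_0_lt_compat|].
    rewrite Rmult_assoc, Rinv_r, Rmult_1_r by lra; exact HM.
  - exists (M / (4 * PI ^ 2)); intros r Hr; exists (RInt (fun s => RInt (G r s) 0 (2 * PI)) 0 (2 * PI)).
    rewrite E' by exact Hr; split; [apply Int2_cont; [now apply CG|reflexivity]|].
    apply Rmult_le_compat_r; [left; now apply Rinv_0_lt_compat|now apply H].
Qed.

Lemma is_partial_phi a m n z1 z2 L : peval a m n z1 z2 <> C0 -> is_partial 1 (phi a m n) z1 z2 L ->
  L = (num a m n z1 z2 / (peval a m n z1 z2 * peval a m n z1 z2))%Cx.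
Proof.
  intros Hp H; unfold is_partial in H; simpl in H.
  apply (cder_quotient_unique (fun w => peval (refl_coef a m n) m n w z2) (fun w => peval a m n w z2) z1
           (pd1 (refl_coef a m n) m n z1 z2) (pd1 a m n z1 z2)); [| |exact Hp|exact H].
  - replace (fun w => peval (refl_coef a m n) m n w z2) with (poly1 (fun i => col (refl_coef a m n) n i z2) m)
      by (apply functional_extensionality; intros; now rewrite peval_col).
    apply cder_poly1.
  - replace (fun w => peval a m n w z2) with (poly1 (fun i => col a n i z2) m)
      by (apply functional_extensionality; intros; now rewrite peval_col).
    apply cder_poly1.
Qed.

Lemma rpow_partial_phi a m n P z1 z2 L : peval a m n z1 z2 <> C0 -> is_partial 1 (phi a m n) z1 z2 L ->
  rpow (Cmod L) P = gpow a m n P 0 z1 z2.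
Proof.
  intros Hp H; rewrite (is_partial_phi a m n z1 z2 L Hp H), gpow_0.
  rewrite Cmod_div, Cmod_mul by (now apply Cmul_neq0); reflexivity.
Qed.

Lemma peval_refl_tr a m n z1 z2 :
  peval (refl_coef (tr a) n m) n m z1 z2 = peval (refl_coef a m n) m n z2 z1.
Proof. exact (peval_tr (refl_coef a m n) m n z1 z2). Qed.

Lemma is_partial_tr a m n z1 z2 L :
  is_partial 2 (phi a m n) z1 z2 L -> is_partial 1 (phi (tr a) n m) z2 z1 L.
Proof.
  assert (E : phi (tr a) n m = fun x y => phi a m n y x).
  { apply functional_extensionality; intros x; apply functional_extensionality; intros y.
    unfold phi; rewrite peval_tr, peval_refl_tr; reflexivity. }
  rewrite E; intros H; exact H.
Qed.

Lemma contact_cond_tr a m n P : contact_cond (tr a) n m 1 P <-> contact_cond a m n 2 P.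
Proof.
  assert (E1 : eval_i 1 (peval (tr a) n m) = eval_i 2 (peval a m n)).
  { apply functional_extensionality; intros w; apply functional_extensionality; intros z; apply peval_tr. }
  assert (E2 : eval_i 1 (peval (refl_coef (tr a) n m) n m) = eval_i 2 (peval (refl_coef a m n) m n)).
  { apply functional_extensionality; intros w; apply functional_extensionality; intros z; apply peval_refl_tr. }
  unfold contact_cond, contact_order_at, sing_coord, is_eps; rewrite E1, E2; reflexivity.
Qed.

Theorem theorem4p1 (a : nat -> nat -> Cx) (m n : nat) (i : nat) (P : R)
  (dphi : Cx -> Cx -> Cx)
  (Hbideg : exact_bidegree a m n)
  (Hnozero : forall z1 z2, Cmod z1 < 1 -> Cmod z2 < 1 -> peval a m n z1 z2 <> C0)
  (Hatoral : atoral a m n)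
  (Hfin : exists l : list (Cx * Cx), forall z1 z2, Cmod z1 = 1 -> Cmod z2 = 1 ->
            peval a m n z1 z2 = C0 -> List.In (z1, z2) l)
  (Hi : i = 1%nat \/ i = 2%nat)
  (HP : 1 <= P)
  (Hd : forall z1 z2, Cmod z1 < 1 -> Cmod z2 < 1 ->
          is_partial i (phi a m n) z1 z2 (dphi z1 z2)) :
  in_Hardy P dphi <-> contact_cond a m n i P.
Proof.
  assert (Hs : stable a m n) by (split; assumption).
  assert (Hr : forall r s, 0 < r < 1 -> Cmod (Cscale r (Cexpi s)) < 1)
    by (intros r s H; rewrite Cmod_scale, Cmod_expi; lra).
  destruct Hi as [-> | ->].
  - rewrite <- torus_bounded_iff_contact by assumption.
    apply (in_Hardy_cont P dphi
      (fun r s t => gpow a m n P 0 (Cscale r (Cexpi s)) (Cscale r (Cexpi t)))).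
    + intros r s t H; apply rpow_partial_phi; [apply Hnozero|apply Hd]; now apply Hr.
    + intros r H; apply cont2_gpow0; [exact HP|]; intros; apply Hnozero; now apply Hr.
  (* For i = 2 the variables are exchanged. This reverses the order of integration in the Hardy
     norm, which Fubini restores on each torus of radius r < 1. *)
  - assert (Hs' := stable_tr a m n Hs).
    rewrite <- contact_cond_tr, <- torus_bounded_iff_contact by assumption.
    assert (C : forall r, 0 < r < 1 ->
      cont2 (fun s t => gpow (tr a) n m P 0 (Cscale r (Cexpi s)) (Cscale r (Cexpi t)))).
    { intros r H; apply cont2_gpow0; [exact HP|]; intros; apply Hs'; now apply Hr. }
    rewrite (in_Hardy_cont P dphi
      (fun r s t => gpow (tr a) n m P 0 (Cscale r (Cexpi t)) (Cscale r (Cexpi s)))).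
    + assert (F := fun r Hr1 => fubini_cont _ 0 (2 * PI) 0 (2 * PI) two_PI_pos two_PI_pos (C r Hr1)).
      split; intros [Mw H]; exists Mw; intros r Hr1; specialize (H r Hr1); specialize (F r Hr1); simpl in F.
      * rewrite F; exact H.
      * rewrite <- F; exact H.
    + intros r s t H; apply rpow_partial_phi; [apply Hs'; now apply Hr|].
      apply is_partial_tr, Hd; now apply Hr.
    + intros r H; exact (cont2_swap _ (C r H)).
Qed.
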